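(* Let $A$ be a finitely generated (unital) associative $\Bbbk$-algebra. Restriction to $A\otimes A\subset \mathbb{O}(A)_1\otimes \mathbb{O}(A)_1$ (where $a\in A$ is identified with $a\otimes\mathbf 1\otimes \mathrm{id}_1$) yields a bijection between di-twisted Poisson brackets $\{-,-\}$ on $\mathbb{O}(A)$ and pairs $\bigl(\{\!\!\{-,-\}\!\!\}_{\mathrm{id}},\{\!\!\{-,-\}\!\!\}_{(12)}\bigr)$ of coupled double Poisson brackets on $A$. The correspondence is given by $$\{a,b\}=\{\!\!\{a,b\}\!\!\}_{\mathrm{id}}\otimes \mathrm{id}_2+\{\!\!\{a,b\}\!\!\}_{(12)}\otimes (12)\in\mathbb{O}(A)_2,\qquad a,b\in A,$$ where $\{\!\!\{-,-\}\!\!\}_{\mathrm{id}}\colon A\otimes A\to A\otimes A\otimes S(A_\natural)$ is a right double bracket and $\{\!\!\{-,-\}\!\!\}_{(12)}\colon A\otimes A\to A\otimes A\otimes S(A_\natural)$ is a double bracket.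
   Context: **Conventions.** $\Bbbk$ is an algebraically closed field of characteristic zero, $\otimes=\otimes_\Bbbk$, algebras are unital. $A_\natural=A/[A,A]$ is the quotient of $A$ by the linear span of commutators, $a\mapsto\overline a$ is the projection $A\to A_\natural$, and $S(A_\natural)$ is the symmetric algebra of the vector space $A_\natural$, with unit $\mathbf 1$. $S(n)$ is the symmetric group; permutations are composed right to left, and $S(n)$ acts on $A^{\otimes n}$ by $\sigma(a_1\otimes\dots\otimes a_n)=a_{\sigma^{-1}(1)}\otimes\dots\otimes a_{\sigma^{-1}(n)}$. On $A^{\otimes n}\otimes S(A_\natural)$ permutations act on the $A$-factors only. **Double and right double brackets.** For a linear map $\{\!\!\{-,-\}\!\!\}:A\otimes A\to A\otimes A\otimes S(A_\natural)$ write (summation suppressed) $\{\!\!\{a,b\}\!\!\}=\{\!\!\{a,b\}\!\!\}'\otimes\{\!\!\{a,b\}\!\!\}''\otimes\{\!\!\{a,b\}\!\!\}'''$. Assume it is skew-symmetric: $\{\!\!\{a,b\}\!\!\}=-(12)\{\!\!\{b,a\}\!\!\}$. It is a *double bracket* if for all $a,b,c\in A$ $$\{\!\!\{a,bc\}\!\!\}=\{\!\!\{a,b\}\!\!\}'\otimes\{\!\!\{a,b\}\!\!\}''c\otimes\{\!\!\{a,b\}\!\!\}'''+b\{\!\!\{a,c\}\!\!\}'\otimes\{\!\!\{a,c\}\!\!\}''\otimes\{\!\!\{a,c\}\!\!\}''',$$ and a *right double bracket* if for all $a,b,c\in A$ $$\{\!\!\{a,bc\}\!\!\}=\{\!\!\{a,b\}\!\!\}'\otimes\{\!\!\{a,b\}\!\!\}''c\otimes\{\!\!\{a,b\}\!\!\}'''+\{\!\!\{a,c\}\!\!\}'\otimes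 b\{\!\!\{a,c\}\!\!\}''\otimes\{\!\!\{a,c\}\!\!\}'''.$$ **Coupled double Poisson brackets.** Let $\{\!\!\{-,-\}\!\!\}_{\mathrm{id}}$ be a right double bracket and $\{\!\!\{-,-\}\!\!\}_{(12)}$ a double bracket. Define (well-defined) maps $A\otimes A_\natural\to A\otimes S(A_\natural)$ by $$\{a,\overline f\}_{\mathrm{id}}=\{\!\!\{a,f\}\!\!\}'_{\mathrm{id}}\otimes\overline{\{\!\!\{a,f\}\!\!\}''_{\mathrm{id}}}\cdot\{\!\!\{a,f\}\!\!\}'''_{\mathrm{id}},\qquad \{a,\overline f\}_{(12)}=\{\!\!\{a,f\}\!\!\}''_{(12)}\{\!\!\{a,f\}\!\!\}'_{(12)}\otimes\{\!\!\{a,f\}\!\!\}'''_{(12)},$$ and extend them to $A\otimes S(A_\natural)\to A\otimes S(A_\natural)$ by $\{a,\overline{f_1}\cdots\overline{f_r}\}_y=\sum_k(\prod_{l\ne k}\overline{f_l})\{a,\overline{f_k}\}_y$ (with $S(A_\natural)$ acting on the second factor; in particular $\{a,\mathbf 1\}_y=0$); write $\{a,g\}_y=\{a,g\}'_y\otimes\{a,g\}''_y$. Write $e=\mathrm{id}$, $s=(12)$. For $x,y\in\{e,s\}$ and $a,b,c\in A$, with $w=\{\!\!\{b,c\}\!\!\}_x=w'\otimes w''\otimes w'''$, define elements of $A^{\otimes3}\otimes S(A_\natural)$ ($y$ is the outer and $x$ the inner bracket): $$L_{yx}(a,b,c)=\{\!\!\{a,w'\}\!\!\}'_y\otimes\{\!\!\{a,w'\}\!\!\}''_y\otimes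 w''\otimes\{\!\!\{a,w'\}\!\!\}'''_y\cdot w''',$$ $$R_{yx}(a,b,c)=w'\otimes\{\!\!\{a,w''\}\!\!\}'_y\otimes\{\!\!\{a,w''\}\!\!\}''_y\otimes\{\!\!\{a,w''\}\!\!\}'''_y\cdot w''',$$ $$X_{yx}(a,b,c)=w'\otimes w''\otimes\{a,w'''\}'_y\otimes\{a,w'''\}''_y.$$ The pair is a pair of *coupled double Poisson brackets* if for all $a,b,c\in A$: 1) $L_{ee}(a,b,c)+(123)L_{ee}(b,c,a)+(132)L_{ee}(c,a,b)+(12)\bigl[R_{ee}(a,b,c)+(132)R_{ee}(b,c,a)+(123)R_{ee}(c,a,b)\bigr]+(123)\bigl[X_{ee}(a,b,c)+(123)X_{ee}(b,c,a)+(132)X_{ee}(c,a,b)\bigr]+(123)\bigl[X_{se}(a,b,c)+(123)X_{se}(b,c,a)+(132)X_{se}(c,a,b)\bigr]=0$; 2) $L_{se}(a,b,c)+(13)R_{se}(b,c,a)+(132)L_{es}(c,a,b)+(23)R_{es}(c,a,b)+X_{es}(c,a,b)+X_{ss}(c,a,b)=0$; 3) $L_{ss}(a,b,c)+(123)L_{ss}(b,c,a)+(132)L_{ss}(c,a,b)=0$. **The double coordinate ring.** $\mathbb{O}(A)=\bigoplus_{n\ge0}\mathbb{O}(A)_n$, $\mathbb{O}(A)_n=A^{\otimes n}\otimes S(A_\natural)\otimes\Bbbk[S(n)]$, with product $(a\otimes f\otimes u)(b\otimes g\otimes v)=(a\otimes b)\otimes fg\otimes(u\times v)$, where $u\times v\in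 S(n+m)$ acts by $u$ on the first $n$ letters and by $v$ on the last $m$. $\mathrm{id}_n$ is the identity of $S(n)$; $|\alpha|$ is the degree of homogeneous $\alpha$. $\mathbb{O}(A)_n$ is an $S(n)$-bimodule by $u\cdot(a\otimes f\otimes\tau)\cdot v=u(a)\otimes f\otimes u\tau v$, and $\mathrm{Ad}(u)(\alpha)=u\cdot\alpha\cdot u^{-1}$. The linear map $\pi:\mathbb{O}(A)\to\mathbb{O}(A)$ of degree $-1$ vanishes on $\mathbb{O}(A)_0$ and for $n\geq 1$ is given by $$\pi(a_1\otimes\dots\otimes a_n\otimes f\otimes u)=\begin{cases}(a_2\otimes\dots\otimes a_n)\otimes\overline{a_1}\cdot f\otimes u_*,&u(1)=1,\\ (a_2\otimes\dots\otimes a_{k-1}\otimes a_1a_k\otimes a_{k+1}\otimes\dots\otimes a_n)\otimes f\otimes u_*,&k=u(1)>1,\end{cases}$$ where $u_*\in S(n-1)$ is obtained from $u$ by deleting $1$ from its cycle decomposition and relabelling $i\mapsto i-1$. For $\tau\in S(n)$ and $k_1,\dots,k_n\ge0$, $\tau^{k_1,\dots,k_n}\in S(k_1+\dots+k_n)$ splits the letters into consecutive blocks of lengths $k_1,\dots,k_n$ and permutes these blocks according to $\tau$ (the $i$-th block is moved to the $\tau(i)$-th place). **Di-twisted Poisson brackets.** A di-twisted Poisson bracket on $\mathbb{O}(A)$ is a linear map $\{-,-\}:\mathbb{O}(A)\otimes\mathbb{O}(A)\to\mathbb{O}(A)$, homogeneous of degree zero ($\{\mathbb{O}(A)_n,\mathbb{O}(A)_m\}\subset\mathbb{O}(A)_{n+m}$),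 such that for homogeneous $\alpha,\beta,\gamma$: (i) $\mathbb{O}(A)_n\otimes\mathbb{O}(A)_m\to\mathbb{O}(A)_{n+m}$ is a map of $S(n)\times S(m)\subset S(n+m)$ bimodules; (ii) $\{\pi(\alpha),\beta\}=\pi\{\alpha,\beta\}$ whenever $|\alpha|\ge1$; (iii) $\{\beta,\alpha\}=-\mathrm{Ad}((12)^{|\alpha|,|\beta|})\{\alpha,\beta\}$; (iv) $\{\alpha,\beta\gamma\}=\{\alpha,\beta\}\gamma+\mathrm{Ad}((12)^{|\beta|,|\alpha|,|\gamma|})(\beta\{\alpha,\gamma\})$ and $\{\alpha\beta,\gamma\}=\mathrm{Ad}((23)^{|\alpha|,|\gamma|,|\beta|})(\{\alpha,\gamma\}\beta)+\alpha\{\beta,\gamma\}$; (v) $\{\alpha,\{\beta,\gamma\}\}+\mathrm{Ad}((123)^{|\beta|,|\gamma|,|\alpha|})\{\beta,\{\gamma,\alpha\}\}+\mathrm{Ad}((132)^{|\gamma|,|\alpha|,|\beta|})\{\gamma,\{\alpha,\beta\}\}=0$. *)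

(* Defs.v *)
From HB Require Import structures.
From mathcomp Require Import all_boot all_order all_fingroup all_algebra.
From mathcomp Require Import generic_quotient ring_quotient finmap monalg.
From mathcomp Require Import boolp classical_sets functions.

Set Implicit Arguments.
Unset Strict Implicit.
Unset Printing Implicit Defensive.

Import GRing.Theory.
Local Open Scope ring_scope.

Declare Scope dcr_scope.
Delimit Scope dcr_scope with dcr.

Reserved Notation "a \ot f" (at level 38, no associativity).

Section LinearQuotient.
Variables (k : fieldType) (V : lmodType k) (rel : V -> Prop).

Inductive lspan : V -> Prop :=
| lspan0 : lspan 0
| lspanD c x y : rel x -> lspan y -> lspan (c *: x + y).

Lemma lspan_lin c x y : lspan x -> lspan y -> lspan (c *: x + y).
Proof.
move=> Sx Sy; elim: Sx => [|d u v ru _ IH]; first by rewrite scaler0 add0r.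
by rewrite scalerDr scalerA -addrA; apply: lspanD.
Qed.

Definition lspan_pred : {pred V} := fun x => `[<lspan x>].

Lemma lspan_zmod_closed : zmod_closed lspan_pred.
Proof.
split; first by apply/asboolP; apply: lspan0.
move=> x y /asboolP Sx /asboolP Sy; apply/asboolP.
by rewrite addrC -scaleN1r; apply: lspan_lin.
Qed.

HB.instance Definition _ :=
  GRing.isZmodClosed.Build V lspan_pred lspan_zmod_closed.

Definition lquot : Type := Quotient.quot lspan_pred.

HB.instance Definition _ := GRing.Zmodule.on lquot.

Definition lpi (x : V) : lquot := \pi_(Quotient.quot lspan_pred)%qT x.
Definition lrepr (q : lquot) : V := repr (q : Quotient.quot lspan_pred).

Lemma lreprK : cancel lrepr lpi.
Proof. by move=> q; rewrite /lpi /lrepr reprK. Qed.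

Lemma lpi_eq x y : lpi x = lpi y <-> lspan (x - y).
Proof.
rewrite /lpi; split=> [/eqP|S]; last apply/eqP.
  by rewrite -Quotient.idealrBE => /asboolP.
by rewrite -Quotient.idealrBE; apply/asboolP.
Qed.

Lemma lpiB : zmod_morphism lpi.
Proof. by move=> x y; rewrite /lpi; exact: raddfB. Qed.

Definition lscale (c : k) (q : lquot) : lquot := lpi (c *: lrepr q).

Lemma lpiZ c x : lpi (c *: x) = lscale c (lpi x).
Proof.
apply/lpi_eq; rewrite -scalerBr -[_ *: _]addr0; apply: lspan_lin lspan0.
by apply/lpi_eq; rewrite lreprK.
Qed.

HB.instance Definition _ := GRing.isZmodMorphism.Build V lquot lpi lpiB.

Fact lscaleA c d q : lscale c (lscale d q) = lscale (c * d) q.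
Proof. by rewrite -[q]lreprK -!lpiZ scalerA. Qed.
Fact lscale1 : left_id 1 lscale.
Proof. by move=> q; rewrite -[q]lreprK -!lpiZ scale1r. Qed.
Fact lscaleDr : right_distributive lscale +%R.
Proof.
move=> c p q; rewrite -[q]lreprK -[p]lreprK -raddfD -!lpiZ scalerDr.
exact: raddfD.
Qed.
Fact lscaleDl q : {morph lscale^~ q : c d / c + d}.
Proof. by move=> c d; rewrite -[q]lreprK -!lpiZ scalerDl; exact: raddfD. Qed.

HB.instance Definition _ :=
  GRing.Zmodule_isLmodule.Build k lquot lscaleA lscale1 lscaleDr lscaleDl.

Lemma lpi_linear : linear lpi.
Proof. by move=> c x y; rewrite raddfD /= lpiZ. Qed.

HB.instance Definition _ :=
  GRing.isLinear.Build k V lquot *:%R lpi lpi_linear.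

End LinearQuotient.

Section Presented.
Variables (k : fieldType) (X : choiceType).

Definition fgen (x : X) : {malg k[X]} := << x >>.

Variable rel : {malg k[X]} -> Prop.
Definition pgen (x : X) : lquot rel := lpi rel (fgen x).

Section Lift.
Variables (W : lmodType k) (h : X -> W).

Definition fext (g : {malg k[X]}) : W := \sum_(x <- msupp g) g@_x *: h x.

Lemma fextEw (d : {fset X}) g : (msupp g `<=` d)%fset ->
  fext g = \sum_(x <- d) g@_x *: h x.
Proof.
move=> le; rewrite /fext (big_fset_incl _ le) // => x _ xg.
by rewrite mcoeff_outdom // scale0r.
Qed.

Lemma fext_linear : linear fext.
Proof.
move=> c f g.
pose d := (msupp f `|` msupp g `|` msupp (c *: f + g))%fset.
have le1 : (msupp f `<=` d)%fset.
  by rewrite /d -fsetUA fsubsetUl.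
have le2 : (msupp g `<=` d)%fset.
  by rewrite /d fsetUAC fsubsetUr.
rewrite (fextEw le1) (fextEw le2) (@fextEw d) ?fsubsetUr //.
rewrite scaler_sumr -big_split; apply: eq_bigr => x _ /=.
by rewrite mcoeffD mcoeffZ scalerDl scalerA.
Qed.

HB.instance Definition _ :=
  GRing.isLinear.Build k {malg k[X]} W *:%R fext fext_linear.

Lemma fextE x : fext (fgen x) = h x.
Proof.
rewrite /fext /fgen (big_fset_incl _ msuppU_le) => [|y].
  by rewrite big_seq_fset1 mcoeffUU scale1r.
by move=> _ /mcoeff_outdom ->; rewrite scale0r.
Qed.

Lemma fext_relE c x y z :
  fext (fgen x - (c *: fgen y + fgen z)) = h x - (c *: h y + h z).
Proof. by rewrite raddfB /= linearP /= !fextE. Qed.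

(* The linear map with [pgen x |-> h x]. It is defined through a choice of   *)
(* representatives, which is immaterial as soon as [h] kills the relations:  *)
(* this is [plift_linear] and [pliftE].                                      *)
Definition plift (q : lquot rel) : W := fext (lrepr q).

Hypothesis h_rel : forall r, rel r -> fext r = 0.

Lemma fext_lspan g : lspan rel g -> fext g = 0.
Proof.
elim=> [|c x y rx _ IH]; first exact: raddf0.
by rewrite linearP /= h_rel // scaler0 add0r.
Qed.

Lemma plift_pi g : plift (lpi rel g) = fext g.
Proof.
apply/eqP; rewrite -subr_eq0 -raddfB /=; apply/eqP/fext_lspan.
by apply/lpi_eq; rewrite lreprK.
Qed.

Lemma plift_linear : linear plift.
Proof.
by move=> c p q; rewrite -[p]lreprK -[q]lreprK -linearP !plift_pi linearP.
Qed.

Lemma pliftE x : plift (pgen x) = h x.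
Proof. by rewrite plift_pi fextE. Qed.

End Lift.

Lemma pgen_rel c x y z : rel (fgen x - (c *: fgen y + fgen z)) ->
  pgen x = c *: pgen y + pgen z.
Proof.
move=> rxyz; rewrite /pgen -linearP; apply/lpi_eq.
rewrite -[_ - _]scale1r -[_ *: _]addr0.
exact: lspanD (lspan0 _).
Qed.

Lemma pres_ind (P : lquot rel -> Prop) :
  P 0 -> (forall c x q, P q -> P (c *: pgen x + q)) -> forall q, P q.
Proof.
move=> P0 PD q; rewrite -[q]lreprK; move: (lrepr q) => g.
rewrite [g]monalgE; elim: (enum_fset _) => [|x s IH].
  by rewrite big_nil raddf0.
rewrite big_cons raddfD /=.
suff -> : << g@_x *g x >> = g@_x *: fgen x by rewrite linearZ; apply: PD.
by apply/malgP => y; rewrite mcoeffZ !mcoeffU mulr_natr.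
Qed.

End Presented.

Definition finitely_generated (k : fieldType) (A : algType k) : Prop :=
  exists gens : seq A, forall P : {pred A},
    GRing.subalg_closed P -> {subset gens <= P} -> forall a : A, a \in P.

Section SymmetricAlgebra.
Variables (k : fieldType) (V : lmodType k).

(* The word [:: v_1; ...; v_r] stands for the product v_1 ... v_r.           *)
Inductive sym_rel : {malg k[seq V]} -> Prop :=
| sym_rel_lin s t c v w :
    sym_rel (fgen k (s ++ (c *: v + w) :: t)
             - (c *: fgen k (s ++ v :: t) + fgen k (s ++ w :: t)))
| sym_rel_perm s t : perm_eq s t -> sym_rel (fgen k s - fgen k t).

Definition sym : Type := lquot sym_rel.
HB.instance Definition _ := GRing.Lmodule.on sym.

Definition symw (s : seq V) : sym := pgen sym_rel s.
Definition sym1 : sym := symw [::].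
Definition symv (v : V) : sym := symw [:: v].

Definition symlift (W : lmodType k) (h : seq V -> W) : sym -> W :=
  @plift k _ sym_rel W h.

Definition sym_compat (W : lmodType k) (h : seq V -> W) : Prop :=
  (forall s t c v w, h (s ++ (c *: v + w) :: t) =
                     c *: h (s ++ v :: t) + h (s ++ w :: t)) /\
  (forall s t, perm_eq s t -> h s = h t).

Lemma sym_compat_rel (W : lmodType k) (h : seq V -> W) : sym_compat h ->
  forall r, sym_rel r -> fext h r = 0.
Proof.
move=> [hl hp] r [s t c v w|s t st].
  by rewrite fext_relE hl subrr.
by rewrite raddfB /= !fextE (hp _ _ st) subrr.
Qed.

Lemma symlift_linear (W : lmodType k) (h : seq V -> W) :
  sym_compat h -> linear (symlift h).
Proof. by move=> /sym_compat_rel; apply: plift_linear. Qed.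

Lemma symliftE (W : lmodType k) (h : seq V -> W) s :
  sym_compat h -> symlift h (symw s) = h s.
Proof. by move=> /sym_compat_rel H; apply: pliftE. Qed.

Lemma sym_ind (P : sym -> Prop) :
  P 0 -> (forall c s q, P q -> P (c *: symw s + q)) -> forall q, P q.
Proof. exact: pres_ind. Qed.

Lemma symw_compat s : sym_compat (fun t => symw (s ++ t)).
Proof.
split=> [t u c v w|t u tu].
  by rewrite !catA; apply: pgen_rel; apply: sym_rel_lin.
apply/lpi_eq; rewrite -[_ - _]scale1r -[_ *: _]addr0.
by apply: lspanD (lspan0 _); apply: sym_rel_perm; rewrite perm_cat2l.
Qed.

(* Multiplication is induced by concatenation of words.                      *)
Definition symmul (f g : sym) : sym :=
  symlift (fun s => symlift (fun t => symw (s ++ t)) g) f.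

Lemma symmul_linr f : linear (symmul f).
Proof.
move=> c g h.
have E x : symmul f x = \sum_(s <- msupp (lrepr f))
    (lrepr f)@_s *: symlift (fun t => symw (s ++ t)) x by [].
rewrite !E scaler_sumr -big_split; apply: eq_bigr => s _ /=.
by rewrite (symlift_linear (symw_compat s)) scalerDr !scalerA mulrC.
Qed.

Lemma symw_compatl t : sym_compat (fun s => symw (s ++ t)).
Proof.
have [hl hp] := symw_compat t.
have E s : symw (s ++ t) = symw (t ++ s).
  by have [_] := symw_compat [::]; apply; rewrite perm_catC.
by split=> [s u c v w|s u su]; rewrite !E ?hl //; apply: hp.
Qed.

Lemma symmul_compat g :
  sym_compat (fun s => symlift (fun t => symw (s ++ t)) g).
Proof.
split=> [s t c v w|s t st].
  elim/sym_ind: g => [|d u g IH].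
    have L z : symlift (fun t => symw (z ++ t)) 0 = 0.
      have := symlift_linear (symw_compat z) (-1) 0 0.
      by rewrite scaler0 addr0 scaleN1r addNr.
    by rewrite !L scaler0 addr0.
  rewrite !(symlift_linear (symw_compat _)) !symliftE; do ?exact: symw_compat.
  rewrite IH (symw_compatl u).1 !scalerDr !scalerA [d * c]mulrC.
  by rewrite addrACA.
congr (symlift _ g); apply: funext => u.
by have [_] := symw_compatl u; apply.
Qed.

Lemma symmul_linl g : linear (symmul^~ g).
Proof. exact: symlift_linear (symmul_compat g). Qed.

Lemma symmulw s t : symmul (symw s) (symw t) = symw (s ++ t).
Proof.
by rewrite /symmul (symliftE _ (symmul_compat _)) (symliftE _ (symw_compat _)).
Qed.

Let mull0 f : symmul f 0 = 0.
Proof.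
by have := symmul_linr f (-1) 0 0; rewrite scaler0 addr0 scaleN1r addNr.
Qed.
Let mul0l f : symmul 0 f = 0.
Proof.
by have := symmul_linl f (-1) 0 0; rewrite scaler0 addr0 scaleN1r addNr.
Qed.

Fact symmulC : commutative symmul.
Proof.
have wC s t : symmul (symw s) (symw t) = symmul (symw t) (symw s).
  by rewrite !symmulw; have [_] := symw_compat [::]; apply; rewrite perm_catC.
have wfC s f : symmul (symw s) f = symmul f (symw s).
  elim/sym_ind: f => [|c t f IH]; first by rewrite mull0 mul0l.
  by rewrite (symmul_linl _ c) (symmul_linr _ c) IH wC.
move=> f g; elim/sym_ind: f => [|c s f IH]; first by rewrite mull0 mul0l.
by rewrite (symmul_linl _ c) (symmul_linr _ c) IH wfC.
Qed.

Fact symmulA : associative symmul.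
Proof.
have wA s t h : symmul (symw s) (symmul (symw t) h) = symmul (symw (s ++ t)) h.
  elim/sym_ind: h => [|c u h IH]; first by rewrite !mull0.
  by rewrite !(symmul_linr _ c) IH !symmulw catA.
have wfA s g h : symmul (symw s) (symmul g h) = symmul (symmul (symw s) g) h.
  elim/sym_ind: g => [|c t g IH]; first by rewrite mul0l !mull0 mul0l.
  rewrite (symmul_linl _ c) !(symmul_linr _ c) (symmul_linl _ c) IH.
  by rewrite wA symmulw.
move=> f g h; elim/sym_ind: f => [|c s f IH]; first by rewrite !mul0l.
by rewrite !(symmul_linl _ c) IH wfA.
Qed.

Fact symmul1 : left_id sym1 symmul.
Proof.
move=> f; elim/sym_ind: f => [|c s f IH]; first by rewrite mull0.
by rewrite (symmul_linr _ c) IH symmulw.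
Qed.

Fact symmulDl : left_distributive symmul +%R.
Proof. by move=> f g h; have := symmul_linl h 1 f g; rewrite !scale1r. Qed.

Fact sym1_neq0 : sym1 != 0.
Proof.
pose h (s : seq V) : k^o := if s is [::] then 1 else 0.
have hc : sym_compat h.
  split=> [[|? ?] t c v w|[|? ?] [|? ?] //=]; rewrite /= ?scaler0 ?addr0 //.
    by move=> /perm_size.
  by move=> /perm_size.
apply/eqP => /(congr1 (symlift h)); rewrite symliftE //.
have := symlift_linear hc (-1) 0 0.
rewrite scaler0 addr0 scaleN1r addNr => -> /eqP.
by rewrite oner_eq0.
Qed.

HB.instance Definition _ := GRing.Zmodule_isComNzRing.Build sym
  symmulA symmulC symmul1 symmulDl sym1_neq0.

Fact sym_scalerAl (c : k) (x y : sym) : c *: (x * y) = (c *: x) * y.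
Proof.
by have := symmul_linl y c x 0; rewrite addr0 mul0l addr0 => H; apply: esym H.
Qed.

HB.instance Definition _ :=
  GRing.Lmodule_isLalgebra.Build k sym sym_scalerAl.
HB.instance Definition _ := GRing.Lalgebra_isComAlgebra.Build k sym.

End SymmetricAlgebra.

Section Tensor.
Variables (k : fieldType) (A S : lmodType k) (n : nat).

Definition tset (a : n.-tuple A) (i : 'I_n) (x : A) : n.-tuple A :=
  [tuple if j == i then x else tnth a j | j < n].

Inductive tens_rel : {malg k[(n.-tuple A * S)%type]} -> Prop :=
| tens_rel_l a f i c x y :
    tens_rel (fgen k (tset a i (c *: x + y), f)
              - (c *: fgen k (tset a i x, f) + fgen k (tset a i y, f)))
| tens_rel_r a c f g :
    tens_rel (fgen k (a, c *: f + g)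
              - (c *: fgen k (a, f) + fgen k (a, g))).

Definition tens : Type := lquot tens_rel.
HB.instance Definition _ := GRing.Lmodule.on tens.

Definition tpure (a : n.-tuple A) (f : S) : tens := pgen tens_rel (a, f).

(* The linear map sending [tpure a f] to [F a f], for [F] linear in each of  *)
(* its n + 1 arguments: see [tlift_linear] and [tliftE].                     *)
Definition tlift (W : lmodType k) (F : n.-tuple A -> S -> W) : tens -> W :=
  @plift k _ tens_rel W (fun p => F p.1 p.2).

Definition multilinear (W : lmodType k) (F : n.-tuple A -> S -> W) : Prop :=
  (forall a f i c x y, F (tset a i (c *: x + y)) f =
                       c *: F (tset a i x) f + F (tset a i y) f) /\
  (forall a, linear (F a)).

Lemma multilinear_rel (W : lmodType k) (F : n.-tuple A -> S -> W) :
  multilinear F ->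
  forall r, tens_rel r -> fext (fun p => F p.1 p.2) r = 0.
Proof.
move=> [Fl Fr] r [a f i c x y|a c f g].
  by rewrite fext_relE Fl subrr.
by rewrite fext_relE Fr subrr.
Qed.

Lemma tlift_linear (W : lmodType k) (F : n.-tuple A -> S -> W) :
  multilinear F -> linear (tlift F).
Proof. by move=> /multilinear_rel; apply: plift_linear. Qed.

Lemma tliftE (W : lmodType k) (F : n.-tuple A -> S -> W) a f :
  multilinear F -> tlift F (tpure a f) = F a f.
Proof. by move=> /multilinear_rel H; apply: (pliftE H). Qed.

Lemma tpure_multilinear : multilinear tpure.
Proof.
split=> [a f i c x y|a c f g]; apply: pgen_rel.
  exact: tens_rel_l.
exact: tens_rel_r.
Qed.

Lemma tens_ind (P : tens -> Prop) :
  P 0 -> (forall c a f t, P t -> P (c *: tpure a f + t)) -> forall t, P t.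
Proof. by move=> P0 PD; apply: pres_ind => // c [a f] t; apply: PD. Qed.

End Tensor.

Notation "a \ot f" := (tpure a f) : dcr_scope.

Section DirectSum.
Variables (k : fieldType) (V : nat -> lmodType k).

Definition bounded_supp (f : forall n, V n) : Prop :=
  exists N, forall n, (N <= n)%N -> f n = 0.

Record dsum := DSum { dcomp : forall n, V n; dcompP : bounded_supp dcomp }.

Lemma dsumP (x y : dsum) : (forall n, dcomp x n = dcomp y n) -> x = y.
Proof.
case: x y => [f fP] [g gP] /= fg.
have E : f = g by apply: functional_extensionality_dep.
by subst g; congr DSum; apply: Prop_irrelevance.
Qed.

HB.instance Definition _ := gen_eqMixin dsum.
HB.instance Definition _ := gen_choiceMixin dsum.

Fact dzeroP : bounded_supp (fun=> 0). Proof. by exists 0%N. Qed.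
Fact doppP (x : dsum) : bounded_supp (fun n => - dcomp x n).
Proof. by have [N xN] := dcompP x; exists N => n /xN ->; rewrite oppr0. Qed.
Fact daddP (x y : dsum) : bounded_supp (fun n => dcomp x n + dcomp y n).
Proof.
have [N xN] := dcompP x; have [M yM] := dcompP y; exists (maxn N M) => n.
by rewrite geq_max => /andP[/xN -> /yM ->]; rewrite addr0.
Qed.
Fact dscaleP (c : k) (x : dsum) : bounded_supp (fun n => c *: dcomp x n).
Proof. by have [N xN] := dcompP x; exists N => n /xN ->; rewrite scaler0. Qed.

Definition dzero := DSum dzeroP.
Definition dopp x := DSum (doppP x).
Definition dadd x y := DSum (daddP x y).
Definition dscale c x := DSum (dscaleP c x).

Fact daddA : associative dadd.
Proof. by move=> x y z; apply: dsumP => n /=; rewrite addrA. Qed.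
Fact daddC : commutative dadd.
Proof. by move=> x y; apply: dsumP => n /=; rewrite addrC. Qed.
Fact dadd0 : left_id dzero dadd.
Proof. by move=> x; apply: dsumP => n /=; rewrite add0r. Qed.
Fact daddN : left_inverse dzero dopp dadd.
Proof. by move=> x; apply: dsumP => n /=; rewrite addNr. Qed.

HB.instance Definition _ := GRing.isZmodule.Build dsum daddA daddC dadd0 daddN.

Fact dscaleA c d x : dscale c (dscale d x) = dscale (c * d) x.
Proof. by apply: dsumP => n /=; rewrite scalerA. Qed.
Fact dscale1 : left_id 1 dscale.
Proof. by move=> x; apply: dsumP => n /=; rewrite scale1r. Qed.
Fact dscaleDr : right_distributive dscale +%R.
Proof. by move=> c x y; apply: dsumP => n /=; rewrite scalerDr. Qed.
Fact dscaleDl x : {morph dscale^~ x : c d / c + d}.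
Proof. by move=> c d; apply: dsumP => n /=; rewrite scalerDl. Qed.

HB.instance Definition _ :=
  GRing.Zmodule_isLmodule.Build k dsum dscaleA dscale1 dscaleDr dscaleDl.

Definition dinj_fun n (x : V n) (m : nat) : V m :=
  if @eqP _ n m is ReflectT e then ecast i (V i) e x else 0.

Fact dinjP n (x : V n) : bounded_supp (dinj_fun x).
Proof.
exists n.+1 => m nm; rewrite /dinj_fun; case: eqP => // e.
by rewrite e ltnn in nm.
Qed.

Definition dinj n (x : V n) : dsum := DSum (dinjP x).

Definition homog (x : dsum) (n : nat) : Prop :=
  forall m, m != n -> dcomp x m = 0.

Definition dbound (x : dsum) : nat := projT1 (cid (dcompP x)).

Definition dlift (W : lmodType k) (h : forall n, V n -> W) (x : dsum) : W :=
  \sum_(n < dbound x) h n (dcomp x n).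

Lemma dinj_comp n (x : V n) : dcomp (dinj x) n = x.
Proof.
rewrite /= /dinj_fun; case: eqP => // e.
by rewrite (eq_irrelevance e erefl).
Qed.

Lemma dinj_homog n (x : V n) : homog (dinj x) n.
Proof.
move=> m nm; rewrite /= /dinj_fun; case: eqP => // e.
by rewrite e eqxx in nm.
Qed.

Lemma homogE x n : homog x n -> x = dinj (dcomp x n).
Proof.
move=> xn; apply: dsumP => m; have [->|nm] := eqVneq m n.
  by rewrite dinj_comp.
by rewrite xn // dinj_homog.
Qed.

Section DLift.
Variables (W : lmodType k) (h : forall n, V n -> W).
Hypothesis h_lin : forall n, linear (@h n).

Lemma dlift0 n : @h n 0 = 0.
Proof.
have := @h_lin n (-1) 0 0.
by rewrite scaler0 addr0 scaleN1r addNr.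
Qed.

Lemma dliftEw x N : (forall n, (N <= n)%N -> dcomp x n = 0) ->
  dlift h x = \sum_(n < N) h (dcomp x n).
Proof.
have E M M' : (M <= M')%N -> (forall n, (M <= n)%N -> dcomp x n = 0) ->
    \sum_(n < M') h (dcomp x n) = \sum_(n < M) h (dcomp x n).
  move=> /subnKC <-; elim: (M' - M)%N => [|d IH] xM; first by rewrite addn0.
  by rewrite addnS big_ord_recr /= IH // xM ?leq_addr // dlift0 addr0.
move=> xN; rewrite /dlift /dbound; case: cid => M /= xM.
by have [le|/ltnW le] := leqP N M; rewrite (E _ _ le).
Qed.

Lemma dlift_linear : linear (dlift h).
Proof.
move=> c x y.
have [N xN] := dcompP x; have [M yM] := dcompP y.
rewrite (@dliftEw x (maxn N M)) => [|n]; last first.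
  by rewrite geq_max => /andP[/xN].
rewrite (@dliftEw y (maxn N M)) => [|n]; last first.
  by rewrite geq_max => /andP[_ /yM].
rewrite (@dliftEw _ (maxn N M)) => [|n]; last first.
  by rewrite geq_max /= => /andP[/xN -> /yM ->]; rewrite scaler0 addr0.
rewrite scaler_sumr -big_split; apply: eq_bigr => n _ /=.
exact: (@h_lin n).
Qed.

Lemma dliftE n (x : V n) : dlift h (dinj x) = h x.
Proof.
rewrite (@dliftEw _ n.+1) => [|m nm]; last first.
  by rewrite dinj_homog // gtn_eqF.
rewrite big_ord_recr big1 => [|i _]; last first.
  by rewrite dinj_homog ?dlift0 //= ltn_eqF.
by rewrite dinj_comp /= add0r.
Qed.

End DLift.

End DirectSum.

(* Right-to-left composition, whereas [(u * v)%g] applies [u] first.         *)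
Definition rlcomp n (u v : 'S_n) : 'S_n := (v * u)%g.

Definition l1 : 'I_3 := ord0.
Definition l2 : 'I_3 := @Ordinal 3 1 isT.
Definition l3 : 'I_3 := ord_max.
Definition p12 : 'S_3 := tperm l1 l2.
Definition p13 : 'S_3 := tperm l1 l3.
Definition p23 : 'S_3 := tperm l2 l3.
Definition p123 : 'S_3 := perm (@ordS_inj 3).
Definition p132 : 'S_3 := (p123^-1)%g.
Definition s12 : 'S_2 := tperm ord0 ord_max.

Definition pcross_fun n m (u : 'S_n) (v : 'S_m) (i : 'I_(n + m)) :
    'I_(n + m) :=
  match fintype.split i with
  | inl j => lshift m (u j)
  | inr j => rshift n (v j)
  end.

Fact pcross_inj n m (u : 'S_n) (v : 'S_m) : injective (pcross_fun u v).
Proof.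
move=> i j; rewrite /pcross_fun.
case: (splitP i) => i' Ei; case: (splitP j) => j' Ej E; apply: ord_inj.
- by move/lshift_inj/perm_inj: E => E; rewrite Ei Ej E.
- by move/eqP: E; rewrite eq_lrshift.
- by move/eqP: E; rewrite eq_rlshift.
- by move/rshift_inj/perm_inj: E => E; rewrite Ei Ej E.
Qed.

Definition pcross n m (u : 'S_n) (v : 'S_m) : 'S_(n + m) :=
  perm (@pcross_inj n m u v).

(* Deleting the letter 1 from the cycle decomposition of u: the letter sent  *)
(* to 1, if distinct from 1, is sent to u(1) instead.                        *)
Definition pdel_fun n (u : 'S_n.+1) (i : 'I_n) : 'I_n :=
  if unlift ord0 (u (lift ord0 i)) is Some j then j
  else odflt i (unlift ord0 (u ord0)).

Fact pdel_inj n (u : 'S_n.+1) : injective (pdel_fun u).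
Proof.
have key i : lift ord0 (pdel_fun u i) =
    if u (lift ord0 i) == ord0 then u ord0 else u (lift ord0 i).
  rewrite /pdel_fun; case: unliftP => [j ->|ui].
    by rewrite eq_sym (negPf (neq_lift _ _)).
  rewrite ui eqxx; case: unliftP => [j -> //|u0].
  by have := perm_inj (etrans ui (esym u0)).
move=> i j E; have := congr1 (lift ord0) E; rewrite !key.
case: eqP => ui; case: eqP => uj.
- by move=> _; apply: (@lift_inj _ ord0); apply: (@perm_inj _ u); rewrite ui uj.
- by move/perm_inj => H; have := neq_lift ord0 j; rewrite -H eqxx.
- by move/perm_inj => H; have := neq_lift ord0 i; rewrite H eqxx.
- by move/perm_inj/lift_inj.
Qed.

Definition pdel n (u : 'S_n.+1) : 'S_n := perm (@pdel_inj n u).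

Section BlockPermutation.
Variables (r : nat) (s : 'S_r) (d : 'I_r -> nat).

(* The letter at offset o in the i-th block goes to offset o of the block at *)
(* the s(i)-th place, which is preceded by the blocks l with s(l) < s(i).    *)
Definition bperm_nat (x : 'I_(\sum_i d i)) : nat :=
  (\sum_(l | s l < s (tagnat.sig1 x)) d l + tagnat.sig2 x)%N.

Lemma bperm_nat_lt (x : 'I_(\sum_i d i)) (P : pred 'I_r) :
  P (tagnat.sig1 x) -> (forall l, (s l < s (tagnat.sig1 x))%N -> P l) ->
  (bperm_nat x < \sum_(l | P l) d l)%N.
Proof.
move=> Px PP; rewrite /bperm_nat (bigD1 _ Px) /= addnC -addSn.
apply: leq_add (ltn_ord _) _.
rewrite big_mkcond [leqRHS]big_mkcond; apply: leq_sum => l _.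
case: ifP => // /[dup] /PP -> lt /=.
by case: eqP lt => // ->; rewrite ltnn.
Qed.

Fact bperm_ltn x : (bperm_nat x < \sum_i d i)%N.
Proof. exact: bperm_nat_lt. Qed.

Definition bperm_fun x : 'I_(\sum_i d i) := Ordinal (bperm_ltn x).

Fact bperm_inj : injective bperm_fun.
Proof.
move=> x y /(congr1 val) /= E.
have lt (z t : 'I_(\sum_i d i)) : (s (tagnat.sig1 z) < s (tagnat.sig1 t))%N ->
    (bperm_nat z < bperm_nat t)%N.
  move=> zt; apply: (@leq_trans (\sum_(l | (s l < s (tagnat.sig1 t))%N) d l)).
    by apply: bperm_nat_lt => // l /ltn_trans; apply.
  exact: leq_addr.
have Exy : tagnat.sig1 x = tagnat.sig1 y.
  apply: (@perm_inj _ s); apply: ord_inj.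
  case: (ltngtP (s (tagnat.sig1 x)) (s (tagnat.sig1 y))) => // lt_xy.
    by have := lt _ _ lt_xy; rewrite E ltnn.
  by have := lt _ _ lt_xy; rewrite E ltnn.
apply: tagnat.sig_inj; move: E; rewrite /bperm_nat.
rewrite /tagnat.sig2 /tagnat.sig1 in Exy *.
case: (tagnat.sig x) (tagnat.sig y) Exy => [i o] [j p] /= ij; subst j.
by move/addnI/ord_inj ->.
Qed.

Definition bperm : 'S_(\sum_i d i) := perm bperm_inj.

End BlockPermutation.

Local Open Scope dcr_scope.

Section DoubleCoordinateRing.
Variables (k : fieldType) (A : algType k).

Definition is_commutator (x : A) : Prop := exists a b, x = a * b - b * a.

Definition Anat : Type := lquot is_commutator.
HB.instance Definition _ := GRing.Lmodule.on Anat.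

Definition SA : Type := sym Anat.
HB.instance Definition _ := GRing.ComAlgebra.on SA.

Definition bar (a : A) : SA := symv (lpi is_commutator a).

Definition TA (n : nat) : Type := tens A SA n.
HB.instance Definition _ n := GRing.Lmodule.on (TA n).

Definition tact n (s : 'S_n) : TA n -> TA n :=
  tlift (fun a f => [tuple tnth a ((s^-1)%g i) | i < n] \ot f : TA n).

(* Sweedler notation: [sw1 w F] is F(w', w'') for w in A (x) S(A_nat), and   *)
(* [sw2 w F] is F(w', w'', w''') for w in A (x) A (x) S(A_nat).              *)
Definition sw1 (W : lmodType k) (w : TA 1) (F : A -> SA -> W) : W :=
  tlift (fun a f => F (tnth a ord0) f) w.
Definition sw2 (W : lmodType k) (w : TA 2) (F : A -> A -> SA -> W) : W :=
  tlift (fun a f => F (tnth a ord0) (tnth a ord_max) f) w.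

Definition bracket : Type := A -> A -> TA 2.

Definition skew (D : bracket) : Prop :=
  forall a b, D a b = - tact s12 (D b a).

Definition double_bracket (D : bracket) : Prop :=
  [/\ bilinear_for *:%R *:%R D, skew D &
   forall a b c, D a (b * c) =
     sw2 (D a b) (fun x y f => [tuple x; y * c] \ot f : TA 2) +
     sw2 (D a c) (fun x y f => [tuple b * x; y] \ot f : TA 2)].

Definition right_double_bracket (D : bracket) : Prop :=
  [/\ bilinear_for *:%R *:%R D, skew D &
   forall a b c, D a (b * c) =
     sw2 (D a b) (fun x y f => [tuple x; y * c] \ot f : TA 2) +
     sw2 (D a c) (fun x y f => [tuple x; b * y] \ot f : TA 2)].

(* {a, -}_id and {a, -}_(12) on A_nat, computed on a representative of the   *)
(* class; the choice is immaterial for the brackets they are applied to.     *)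
Definition act_id (D : bracket) (a : A) (phi : Anat) : TA 1 :=
  sw2 (D a (lrepr phi)) (fun x y f => [tuple x] \ot (bar y * f) : TA 1).
Definition act_s12 (D : bracket) (a : A) (phi : Anat) : TA 1 :=
  sw2 (D a (lrepr phi)) (fun x y f => [tuple y * x] \ot f : TA 1).

(* Extension of d : A_nat -> A (x) S(A_nat) to S(A_nat) by the Leibniz rule. *)
Definition act_ext (d : Anat -> TA 1) : SA -> TA 1 :=
  symlift (fun w : seq Anat => \sum_(i < size w)
    sw1 (d (tnth (in_tuple w) i)) (fun x g =>
      [tuple x] \ot
        ((\prod_(l < size w | l != i) symv (tnth (in_tuple w) l) : SA) * g)
      : TA 1)).

(* In [Lt], [Rt] and [Xt] the outer bracket comes first.                     *)
Definition Lt (Dy Dx : bracket) (a b c : A) : TA 3 :=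
  sw2 (Dx b c) (fun w1 w2 w3 =>
    sw2 (Dy a w1) (fun x y f => [tuple x; y; w2] \ot (f * w3) : TA 3)).
Definition Rt (Dy Dx : bracket) (a b c : A) : TA 3 :=
  sw2 (Dx b c) (fun w1 w2 w3 =>
    sw2 (Dy a w2) (fun x y f => [tuple w1; x; y] \ot (f * w3) : TA 3)).
Definition Xt (dy : A -> Anat -> TA 1) (Dx : bracket) (a b c : A) : TA 3 :=
  sw2 (Dx b c) (fun w1 w2 w3 =>
    sw1 (act_ext (dy a) w3) (fun x f => [tuple w1; w2; x] \ot f : TA 3)).

Definition coupled1 (De Ds : bracket) : Prop := forall a b c,
  Lt De De a b c + tact p123 (Lt De De b c a) + tact p132 (Lt De De c a b)
  + tact p12 (Rt De De a b c + tact p132 (Rt De De b c a)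
              + tact p123 (Rt De De c a b))
  + tact p123 (Xt (act_id De) De a b c + tact p123 (Xt (act_id De) De b c a)
               + tact p132 (Xt (act_id De) De c a b))
  + tact p123 (Xt (act_s12 Ds) De a b c + tact p123 (Xt (act_s12 Ds) De b c a)
               + tact p132 (Xt (act_s12 Ds) De c a b)) = 0.

Definition coupled2 (De Ds : bracket) : Prop := forall a b c,
  Lt Ds De a b c + tact p13 (Rt Ds De b c a) + tact p132 (Lt De Ds c a b)
  + tact p23 (Rt De Ds c a b) + Xt (act_id De) Ds c a b
  + Xt (act_s12 Ds) Ds c a b = 0.

Definition coupled3 (Ds : bracket) : Prop := forall a b c,
  Lt Ds Ds a b c + tact p123 (Lt Ds Ds b c a) + tact p132 (Lt Ds Ds c a b) = 0.

Definition coupled_double_poisson (D : bracket * bracket) : Prop :=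
  [/\ right_double_bracket D.1, double_bracket D.2,
      coupled1 D.1 D.2, coupled2 D.1 D.2 & coupled3 D.2].

(* M (x) k[S(n)] is realised as the space of functions S(n) -> M.            *)
Definition OAn (n : nat) : Type := {ffun 'S_n -> TA n}.
HB.instance Definition _ n := GRing.Lmodule.on (OAn n).

Definition gtens n (t : TA n) (u : 'S_n) : OAn n :=
  [ffun v => if v == u then t else 0].

Definition OA : Type := dsum OAn.
HB.instance Definition _ := GRing.Lmodule.on OA.

Definition ogen n (a : n.-tuple A) (f : SA) (u : 'S_n) : OA :=
  dinj (V := OAn) (gtens (a \ot f) u).

(* The linear map with [ogen a f u |-> F n a f u].                           *)
Definition oext (W : lmodType k)
    (F : forall n, n.-tuple A -> SA -> 'S_n -> W) : OA -> W :=
  dlift (V := OAn) (fun n (x : OAn n) =>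
    \sum_(u : 'S_n) tlift (fun a f => F n a f u) (x u)).

Definition omul (x y : OA) : OA :=
  oext (fun n a f u => oext (fun m b g v =>
    ogen [tuple of a ++ b] (f * g) (pcross u v)) y) x.

(* The S(n)-bimodule O(A)_n. On O(A) the operations [lactO], [ractO], [AdO]  *)
(* first project to O(A)_n: they are only meant for elements of degree n.    *)
Definition lactn n (u : 'S_n) (x : OAn n) : OAn n :=
  \sum_(v : 'S_n) gtens (tact u (x v)) (rlcomp u v).
Definition ractn n (x : OAn n) (u : 'S_n) : OAn n :=
  \sum_(v : 'S_n) gtens (x v) (rlcomp v u).

Definition lactO n (u : 'S_n) (x : OA) : OA :=
  dinj (V := OAn) (lactn u (dcomp x n)).
Definition ractO n (x : OA) (u : 'S_n) : OA :=
  dinj (V := OAn) (ractn (dcomp x n) u).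
Definition AdO n (u : 'S_n) (x : OA) : OA := ractO (lactO u x) (u^-1)%g.

Definition opi_gen n : n.-tuple A -> SA -> 'S_n -> OA :=
  match n return n.-tuple A -> SA -> 'S_n -> OA with
  | 0 => fun _ _ _ => 0
  | n'.+1 => fun a f u =>
    let a1 := tnth a ord0 in
    if u ord0 == ord0 then
      ogen [tuple tnth a (lift ord0 j) | j < n'] (bar a1 * f) (pdel u)
    else
      ogen [tuple (if lift ord0 j == u ord0
                   then a1 * tnth a (lift ord0 j)
                   else tnth a (lift ord0 j)) | j < n'] f (pdel u)
  end.

Definition opi : OA -> OA := oext opi_gen.

Definition bperm2 (s : 'S_2) (n m : nat) := bperm s (tnth [tuple n; m]).
Definition bperm3 (s : 'S_3) (n m p : nat) := bperm s (tnth [tuple n; m; p]).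

Record ditwisted (B : OA -> OA -> OA) : Prop := Ditwisted {
  ditwisted_bilinear : bilinear_for *:%R *:%R B;

  ditwisted_homog : forall n m (x y : OA), homog x n -> homog y m ->
    homog (B x y) (n + m);

  ditwisted_bimod : forall n m (x y : OA) (u u' : 'S_n) (v v' : 'S_m),
    homog x n -> homog y m ->
    B (ractO (lactO u x) u') (ractO (lactO v y) v') =
    ractO (lactO (pcross u v) (B x y)) (pcross u' v');

  ditwisted_pi : forall n m (x y : OA), (0 < n)%N -> homog x n -> homog y m ->
    B (opi x) y = opi (B x y);

  ditwisted_skew : forall n m (x y : OA), homog x n -> homog y m ->
    B y x = - AdO (bperm2 s12 n m) (B x y);

  ditwisted_leibnizr : forall n m p (x y z : OA),
    homog x n -> homog y m -> homog z p ->
    B x (omul y z) =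
    omul (B x y) z + AdO (bperm3 p12 m n p) (omul y (B x z));

  ditwisted_leibnizl : forall n m p (x y z : OA),
    homog x n -> homog y m -> homog z p ->
    B (omul x y) z =
    AdO (bperm3 p23 n p m) (omul (B x z) y) + omul x (B y z);

  ditwisted_jacobi : forall n m p (x y z : OA),
    homog x n -> homog y m -> homog z p ->
    B x (B y z) + AdO (bperm3 p123 m p n) (B y (B z x))
    + AdO (bperm3 p132 p n m) (B z (B x y)) = 0
}.

Definition oiota (a : A) : OA := ogen [tuple a] 1 1%g.

(* The pair of coefficients at id and (12) of the degree 2 element {a, b}.   *)
Definition restriction (B : OA -> OA -> OA) : bracket * bracket :=
  (fun a b => (dcomp (B (oiota a) (oiota b)) 2 : OAn 2) 1%g,
   fun a b => (dcomp (B (oiota a) (oiota b)) 2 : OAn 2) s12).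

End DoubleCoordinateRing.

(* Main.v *)
Require Import Defs.
From HB Require Import structures.
From mathcomp Require Import all_boot all_order all_fingroup all_algebra.
From mathcomp Require Import finmap monalg boolp classical_sets functions ring.
Set Implicit Arguments.
Unset Strict Implicit.
Unset Printing Implicit Defensive.
Import GRing.Theory.
Local Open Scope ring_scope.

(* O(A) embeds into a commutative algebra S generated by strands a_ij, linear in
   a, with an output label i and an input label j, and by loops (the classes of
   elements of A): a_1 (x) ... (x) a_n (x) f (x) u is sent to f times the product
   of the strands (a_i)_{i,u^-1(i)}, labels being counted from 0. In S the product
   of O(A) becomes multiplication after a shift of labels, the bimodule structure
   a relabelling of outputs and inputs, and pi the contraction of output 0 with
   input 0.
   A right double bracket and a double bracket yield a biderivation of S, given
   on strands by {a_ij, b_kl} = x_ij y_kl f + x'_il y'_kj f', where x (x) y (x) f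
   is the value of the first bracket and x' (x) y' (x) f' that of the second. It
   is skew and commutes with relabellings and contractions, so that it induces on
   O(A) a bracket satisfying everything but the Jacobi identity. The latter is
   equivalent to the usual Jacobi identity on S; as loops are contracted strands,
   it has to be checked only on a_00, b_11, c_22, where its components along the
   six permutations are the coupling conditions.
   Conversely, O(A) is generated by A under products, pi and the bimodule
   structure, hence a bracket is determined by its restriction to A; and the
   Leibniz rule in A follows from bc = pi((b (x) c) . (12)). *)

(** The gain of passing to S is that its factors commute and carry their own labels: the block
    permutations of the axioms merely move labels, and skew-symmetry, the Leibniz rules and the
    Jacobi identity lose their twists. Two facts are needed to come back: [embed] is injective,
    because tensors can be read off a sum of monomials one output after the other, and the bracket
    of two images is an image, by a count of labels. The delicate axiom is (ii). Contraction is no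
    algebra map: a strand may meet itself and become a loop, or be composed with another strand.
    Operators of this kind are handled through the two-argument maps [stcontr], whose second
    argument carries the other factors. That the bracket commutes with contraction rests on the
    Leibniz rules of both brackets in their first argument; the same rules make the bracket of a
    loop depend only on its class in A_nat. Of the six components of the Jacobi identity one is
    condition 1, the three transpositions give condition 2 for the rotations of a, b, c, and the two
    3-cycles give condition 3, the second time with the opposite sign and with b and c exchanged. *)

Lemma linear_0 (k : fieldType) (V W : lmodType k) (f : V -> W) :
  linear f -> f 0 = 0.
Proof.
move=> fl; have := fl (-1) 0 0.
by rewrite scaler0 addr0 scaleN1r addNr.
Qed.

(** * Symmetric algebras *)

(* The symmetric algebra of V, seen only through its universal property: its
   construction has to be hidden, because unification would otherwise try to
   compare two elements by unfolding the quotient. *)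
Record symAlg (k : fieldType) (V : lmodType k) := SymAlg {
  salg :> comAlgType k;
  sword : seq V -> salg;
  sword_nil : sword [::] = 1;
  sword_cat : forall s t, sword (s ++ t) = sword s * sword t;
  sword_lin : linear (fun v => sword [:: v]);
  sword_ind : forall P : salg -> Prop, P 0 ->
    (forall c s x, P x -> P (c *: sword s + x)) -> forall x, P x;
  slift : forall W : lmodType k, (seq V -> W) -> salg -> W;
  slift_linear : forall (W : lmodType k) (h : seq V -> W),
    sym_compat h -> linear (slift h);
  sliftE : forall (W : lmodType k) (h : seq V -> W) s,
    sym_compat h -> slift h (sword s) = h s
}.

Section Sym.
Variables (k : fieldType) (V : lmodType k).

Let symw_catE (s t : seq V) : symw (s ++ t) = symw s * symw t.
Proof. by symmetry; exact: symmulw. Qed.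

Let symw_lin : linear (fun v : V => symw [:: v]).
Proof. by move=> c v w; have [/(_ [::] [::] c v w)] := @symw_compat k V [::]. Qed.

Definition sym_symAlg : symAlg V := @SymAlg k V (sym V) (@symw k V) erefl
  symw_catE symw_lin (@sym_ind k V) (@symlift k V) (@symlift_linear k V)
  (fun W h s => @symliftE k V W h s).

(** An opaque copy, on which the strand algebra is built. The transparent [sym_symAlg] is kept for
    S(A_nat), whose carrier is prescribed by the definition of O(A). *)
Fact symAlg_exists : symAlg V. Proof. exact: sym_symAlg. Qed.

End Sym.

Section SymmetricAlgebraCalculus.
Variables (k : fieldType) (V : lmodType k) (S : symAlg V).

Definition sgen (v : V) : S := sword S [:: v].

Lemma sgen_linear : linear sgen. Proof. exact: sword_lin. Qed.
HB.instance Definition _ := GRing.isLinear.Build k V S *:%R sgen sgen_linear.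

Lemma sword_cons v s : sword S (v :: s) = sgen v * sword S s.
Proof. by rewrite -cat1s sword_cat. Qed.

Lemma sgen_ind (P : S -> Prop) :
  P 0 -> (forall c x y, P x -> P y -> P (c *: x + y)) ->
  P 1 -> (forall v x, P x -> P (sgen v * x)) -> forall x, P x.
Proof.
move=> P0 PD P1 PM; elim/(@sword_ind _ _ S) => // c s q Pq.
apply: PD => // {q Pq}; elim: s => [|v s IH]; first by rewrite sword_nil.
by rewrite sword_cons; apply: PM.
Qed.

Section Hom.
Variables (C : comAlgType k) (h : V -> C).
Hypothesis h_lin : linear h.

Definition symhom_fun : S -> C := slift (fun s => \prod_(v <- s) h v).

Lemma symhom_compat : sym_compat (fun s => \prod_(v <- s) h v).
Proof.
split=> [s t c v w|s t st]; last exact: perm_big.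
by rewrite !big_cat !big_cons /= h_lin mulrDl mulrDr -scalerAl -scalerAr.
Qed.

Lemma symhom_linear : linear symhom_fun.
Proof. exact: slift_linear symhom_compat. Qed.

Lemma symhomv v : symhom_fun (sgen v) = h v.
Proof. by rewrite [LHS](sliftE _ _ symhom_compat) big_seq1. Qed.

Lemma symhom1 : symhom_fun 1 = 1.
Proof. by rewrite -(sword_nil S) [LHS](sliftE _ _ symhom_compat) big_nil. Qed.

Lemma symhomM x y : symhom_fun (x * y) = symhom_fun x * symhom_fun y.
Proof.
elim/(@sword_ind _ _ S): x => [|c s x IH].
  by rewrite mul0r !(linear_0 symhom_linear) mul0r.
rewrite mulrDl -scalerAl !symhom_linear /= mulrDl IH -scalerAl.
congr (_ *: _ + _).
elim/(@sword_ind _ _ S): y {IH} => [|d t y IH].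
  by rewrite mulr0 !(linear_0 symhom_linear) mulr0.
rewrite mulrDr -scalerAr -sword_cat !symhom_linear mulrDr IH -scalerAr.
by rewrite ![symhom_fun (sword _ _)](sliftE _ _ symhom_compat) big_cat.
Qed.

End Hom.

Section Contr.
Variables (W : lmodType k) (d : V -> S -> W).

(** The letters already passed are accumulated in [y], so that [d v] always receives the product of
    all the other letters. *)
Fixpoint contrw (s : seq V) (y : S) : W :=
  if s is v :: t then d v (sword S t * y) + contrw t (sgen v * y) else 0.

(* On a product of generators, [contr d (v_1 ... v_r) y] is the sum over l of
   [d v_l] applied to y and all the other factors. Derivations are the case
   [d v y = D v * y], and the contraction of an output with an input is a
   differential operator of order two of this kind. *)
Definition contr (x y : S) : W := slift (fun s => contrw s y) x.

Hypothesis d_lin : bilinear_for *:%R *:%R d.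

Let dl y : linear (d^~ y). Proof. exact: d_lin.1. Qed.
Let dr v : linear (d v). Proof. exact: d_lin.2. Qed.

Lemma contrw_linear s : linear (contrw s).
Proof.
elim: s => [|v s IH] c x y /=; first by rewrite scaler0 addr0.
by rewrite !mulrDr -!scalerAr dr IH scalerDr addrACA.
Qed.

Lemma contrw_cat s t y :
  contrw (s ++ t) y = contrw s (sword S t * y) + contrw t (sword S s * y).
Proof.
elim: s y => [|v s IH] y /=; first by rewrite add0r sword_nil mul1r.
rewrite IH sword_cat sword_cons addrA; congr (d v _ + contrw s _ + contrw t _).
- by rewrite mulrA.
- by rewrite mulrCA.
- by rewrite mulrA [sword S s * _]mulrC.
Qed.

Lemma contrw_compat y : sym_compat (fun s => contrw s y).
Proof.
split=> [s t c v w|s t]; last first.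
  (* Permutations of words are generated by exchanges of adjacent blocks. *)
  apply: (@catCA_perm_subst V _ (fun s => contrw s y)) => s1 s2 s3.
  rewrite !contrw_cat !sword_cat addrCA.
  by congr (_ + (_ + _)); congr (contrw _ _); ring.
rewrite !contrw_cat -!(cat1s _ t) !contrw_cat !sword_cat /= !addr0 sword_nil dl.
rewrite [sword S [:: _ + _]]sgen_linear !mulrDl -!scalerAl !contrw_linear.
by rewrite /sgen !scalerDr [in LHS](addrACA (c *: d _ _)) [LHS]addrACA.
Qed.

Lemma contr_linearl y : linear (contr^~ y).
Proof. exact: slift_linear (contrw_compat y). Qed.

Lemma contr_w s y : contr (sword S s) y = contrw s y.
Proof. exact: sliftE (contrw_compat y). Qed.

Lemma contr_linearr x : linear (contr x).
Proof.
move=> c y z; elim/(@sword_ind _ _ S): x => [|e s x IH].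
  by rewrite !(linear_0 (contr_linearl _)) scaler0 addr0.
rewrite !contr_linearl IH !contr_w contrw_linear !scalerDr !scalerA.
by rewrite addrACA [e * c]mulrC.
Qed.

Lemma contr0l y : contr 0 y = 0. Proof. exact: linear_0 (contr_linearl y). Qed.
Lemma contr0r x : contr x 0 = 0. Proof. exact: linear_0 (contr_linearr x). Qed.

Lemma contr_v v y : contr (sgen v) y = d v y.
Proof. by rewrite contr_w /= addr0 sword_nil mul1r. Qed.

Lemma contr1 y : contr 1 y = 0.
Proof. by rewrite -(sword_nil S) contr_w. Qed.

(** A Leibniz rule in which the factor that is not acted upon moves into the second argument. In
    this form it also covers operators of order two. *)
Lemma contrM x x' y : contr (x * x') y = contr x (x' * y) + contr x' (x * y).
Proof.
elim/(@sword_ind _ _ S): x => [|c s x IH].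
  by rewrite !mul0r !contr0l contr0r addr0.
rewrite !mulrDl contr_linearl -!scalerAl !(contr_linearl, contr_linearr) IH.
rewrite [RHS]addrACA -scalerDr; congr (_ *: _ + _).
elim/(@sword_ind _ _ S): x' {IH} => [|e t x' IH].
  by rewrite mulr0 mul0r contr0l contr0r contr0l addr0.
rewrite mulrDr mulrDl -!scalerAr -!scalerAl !(contr_linearl, contr_linearr) IH.
by rewrite [RHS]addrACA -scalerDr -sword_cat !contr_w contrw_cat.
Qed.

End Contr.

End SymmetricAlgebraCalculus.

(** * Strand algebras *)

(* A strand with value in A goes from an input label j to an output label i and
   is encoded by the shape [Some (i, j)]; [None] is the shape of a loop. *)
Definition stshape := option (nat * nat).

Section StrandAlgebra.
Variables (k : fieldType) (A : algType k).

(** The admissible values on generators: the second clause says that a loop only sees the class of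
    its value in A_nat. *)
Definition strand_family (W : lmodType k) (h : stshape -> A -> W) : Prop :=
  (forall s, linear (h s)) /\ (forall a b, h None (a * b) = h None (b * a)).

(** Two universal properties are recorded: [sthom] extends values on strands to an algebra map,
    [stcontr] extends them to an operator obeying the rule [contrM]. Derivations, contraction and
    the extraction of tensors are instances of the latter. *)
Record strandAlg := StrandAlg {
  stalg :> comAlgType k;
  strand : stshape -> A -> stalg;
  strand_familyP : strand_family strand;
  strand_ind : forall P : stalg -> Prop, P 0 ->
    (forall c x y, P x -> P y -> P (c *: x + y)) -> P 1 ->
    (forall s a x, P x -> P (strand s a * x)) -> forall x, P x;
  sthom : forall C : comAlgType k, (stshape -> A -> C) -> stalg -> C;
  sthom_linear : forall C h, strand_family h -> linear (@sthom C h);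
  sthom1 : forall C h, strand_family h -> @sthom C h 1 = 1;
  sthomM : forall C h, strand_family h ->
    forall x y, @sthom C h (x * y) = sthom h x * sthom h y;
  sthom_strand : forall C h, strand_family h ->
    forall s a, @sthom C h (strand s a) = h s a;
  stcontr : forall W : lmodType k, (stshape -> A -> stalg -> W) ->
    stalg -> stalg -> W;
  stcontr_laws : forall (W : lmodType k) (d : stshape -> A -> stalg -> W),
    (forall y, strand_family (fun s a => d s a y)) ->
    (forall s a, linear (d s a)) ->
    [/\ forall y, linear (fun x => stcontr d x y),
        forall x, linear (stcontr d x),
        forall y, stcontr d 1 y = 0,
        forall s a y, stcontr d (strand s a) y = d s a y &
        forall x x' y, stcontr d (x * x') y =
                       stcontr d x (x' * y) + stcontr d x' (x * y)]
}.

(** The vanishing summand in the loop relation gives it the shape x - (c y + z) to which [pgen_rel]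
    and [fext_relE] apply. *)
Inductive strand_rel : {malg k[(stshape * A)%type]} -> Prop :=
| strand_rel_lin s c a b :
    strand_rel (fgen k (s, c *: a + b) - (c *: fgen k (s, a) + fgen k (s, b)))
| strand_rel_loop a b :
    strand_rel (fgen k (None, a * b)
                - (0 *: fgen k (None, 0 : A) + fgen k (None, b * a))).

Definition strand_space : Type := lquot strand_rel.
HB.instance Definition _ := GRing.Lmodule.on strand_space.

Let vgen (s : stshape) (a : A) : strand_space := pgen strand_rel (s, a).
Let vlift (W : lmodType k) (h : stshape -> A -> W) : strand_space -> W :=
  plift (fun p => h p.1 p.2).

Let vgen_family : strand_family vgen.
Proof.
split=> [s c a b|a b]; first by apply: pgen_rel; exact: strand_rel_lin.
rewrite [LHS](pgen_rel (c := 0) (y := (None, 0)) (z := (None, b * a))).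
  by rewrite scale0r add0r.
exact: strand_rel_loop.
Qed.

Let vlift_rel (W : lmodType k) (h : stshape -> A -> W) : strand_family h ->
  forall r, strand_rel r -> fext (fun p => h p.1 p.2) r = 0.
Proof.
move=> [hl hc] r [s c a b|a b]; rewrite fext_relE /=; first by rewrite hl subrr.
by rewrite scale0r add0r hc subrr.
Qed.

Let vlift_linear (W : lmodType k) (h : stshape -> A -> W) :
  strand_family h -> linear (vlift h).
Proof. by move=> /vlift_rel; apply: plift_linear. Qed.

Let vliftE (W : lmodType k) (h : stshape -> A -> W) s a :
  strand_family h -> vlift h (vgen s a) = h s a.
Proof. by move=> /vlift_rel H; rewrite [LHS](pliftE H). Qed.

(** The symmetric algebra of [strand_space], which is a copy of A for each pair of labels together
    with a copy of A_nat for the loops. *)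
Fact strandAlg_exists : strandAlg.
Proof.
pose S := symAlg_exists strand_space.
have gl := @sgen_linear k strand_space S.
have dP (W : lmodType k) (d : stshape -> A -> S -> W) :
    (forall y, strand_family (fun s a => d s a y)) ->
    (forall s a, linear (d s a)) ->
    bilinear_for *:%R *:%R
      (fun v y => vlift (fun s a => d s a y) v).
  move=> d1 d2; split=> [y|v] c x z /=; first exact: vlift_linear.
  elim/pres_ind: v => [|e [s a] q IH].
    by rewrite !(linear_0 (vlift_linear (d1 _))) scaler0 addr0.
  rewrite !(vlift_linear (d1 _)) !(vliftE _ _ (d1 _)) IH d2 !scalerDr !scalerA.
  by rewrite [e * c]mulrC addrACA.
exists S (fun s a => sgen S (vgen s a))
  (fun C h => symhom_fun (vlift h))
  (fun W d => contr (fun v y => vlift (fun s a => d s a y) v)).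
- split=> [s c a b|a b]; last by rewrite vgen_family.2.
  by rewrite vgen_family.1 gl.
- move=> P P0 PD P1 PM; elim/sgen_ind => // v x Px.
  elim/pres_ind: v => [|c [s a] q IH].
    by rewrite (linear_0 gl) mul0r.
  by rewrite gl mulrDl -scalerAl; apply: PD => //; apply: PM.
- by move=> C h /vlift_linear; exact: symhom_linear.
- by move=> C h /vlift_linear; exact: symhom1.
- by move=> C h /vlift_linear hl x y; exact: symhomM.
- move=> C h hf s a; rewrite symhomv ?vliftE //; exact: vlift_linear.
- move=> W d d1 d2; split.
  + exact: contr_linearl (dP _ _ d1 d2).
  + exact: contr_linearr (dP _ _ d1 d2).
  + exact: contr1 (dP _ _ d1 d2).
  + by move=> s a y; rewrite (contr_v (dP _ _ d1 d2)) vliftE.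
  + exact: contrM (dP _ _ d1 d2).
Qed.

End StrandAlgebra.

Section TraceAlgebra.
Variables (k : fieldType) (A : algType k).

Local Notation SAalg := (sym_symAlg (Anat A)).

Lemma SA_ind (P : SA A -> Prop) :
  P 0 -> (forall c f g, P f -> P g -> P (c *: f + g)) -> P 1 ->
  (forall a f, P f -> P (bar a * f)) -> forall f, P f.
Proof.
move=> P0 PD P1 PM; apply: (@sgen_ind _ _ SAalg P P0 PD P1) => v x Px.
by rewrite -[v]lreprK; apply: PM.
Qed.

Lemma bar_linear : linear (@bar k A).
Proof.
move=> c a b; rewrite /bar linearP; exact: (@sgen_linear _ _ SAalg).
Qed.

Lemma lpi_comm (a b : A) :
  lpi (@is_commutator k A) (a * b) = lpi (@is_commutator k A) (b * a).
Proof.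
apply/lpi_eq; rewrite -[_ - _]scale1r -[_ *: _]addr0; apply: lspanD (lspan0 _).
by exists a, b.
Qed.

Lemma bar_comm (a b : A) : bar (a * b) = bar (b * a).
Proof. by rewrite /bar lpi_comm. Qed.

Section LiftToAnat.
Variables (W : lmodType k) (h : A -> W).
Hypotheses (h_lin : linear h) (h_comm : forall a b, h (a * b) = h (b * a)).

(** Makes harmless the choice of representatives in maps on A_nat, such as [act_id] and
    [act_s12]. *)
Lemma lrepr_lpi (a : A) : h (lrepr (lpi (@is_commutator k A) a)) = h a.
Proof.
apply/eqP; rewrite -subr_eq0; apply/eqP.
have hB x y : h (x - y) = h x - h y.
  by rewrite [x - y]addrC -(scaleN1r y) h_lin scaleN1r addrC.
rewrite -hB; have /lpi_eq : lpi (@is_commutator k A) (lrepr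
  (lpi (@is_commutator k A) a)) = lpi (@is_commutator k A) a by rewrite lreprK.
elim=> [|c _ y [x [z ->]] _ IH]; first exact: linear_0.
by rewrite h_lin hB h_comm subrr scaler0 add0r IH.
Qed.

Lemma lrepr_linear : linear (fun phi : Anat A => h (lrepr phi)).
Proof.
move=> c phi psi; rewrite -[phi in LHS]lreprK -[psi in LHS]lreprK.
rewrite -linearP lrepr_lpi; exact: h_lin.
Qed.
End LiftToAnat.

End TraceAlgebra.

Section StrandCalculus.
Variables (k : fieldType) (A : algType k) (S : strandAlg A).
Local Notation st := (strand S).

Lemma st_linear s : linear (st s). Proof. exact: (strand_familyP S).1. Qed.
HB.instance Definition _ s := GRing.isLinear.Build k A S *:%R (st s)
  (st_linear s).

Lemma st_comm a b : st None (a * b) = st None (b * a).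
Proof. exact: (strand_familyP S).2. Qed.

Local Notation SAalg := (sym_symAlg (Anat A)).
Let stNone (phi : Anat A) : S := st None (lrepr phi).

Let stNone_linear : linear stNone.
Proof. exact: lrepr_linear (@st_linear None) st_comm. Qed.

Definition iota_SA : SA A -> S := @symhom_fun _ _ (sym_symAlg (Anat A)) S stNone.
Local Notation ii := iota_SA.

Lemma iota_linear : linear ii.
Proof. exact: (@symhom_linear _ _ SAalg S stNone stNone_linear). Qed.

Lemma iota1 : ii 1 = 1.
Proof. exact: (@symhom1 _ _ SAalg S stNone stNone_linear). Qed.

Lemma iotaM f g : ii (f * g) = ii f * ii g.
Proof. exact: (@symhomM _ _ SAalg S stNone stNone_linear). Qed.

Lemma iota0 : ii 0 = 0. Proof. exact: linear_0 iota_linear. Qed.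

Lemma iota_bar a : ii (bar a) = st None a.
Proof.
apply: (etrans (@symhomv _ _ SAalg S stNone stNone_linear _)).
exact: lrepr_lpi (@st_linear None) st_comm a.
Qed.

Lemma iota_barM a f : ii (bar a * f) = st None a * ii f.
Proof. by rewrite iotaM iota_bar. Qed.

(** Subalgebras cut out by conditions on labels: on them relabellings can be compared, and
    contraction is linear over those that avoid its label. *)
Inductive gen_by (P : stshape -> Prop) : S -> Prop :=
| gen_by0 : gen_by P 0
| gen_byD c x y : gen_by P x -> gen_by P y -> gen_by P (c *: x + y)
| gen_by1 : gen_by P 1
| gen_by_st s a x : P s -> gen_by P x -> gen_by P (st s a * x).

Lemma gen_byM P x y : gen_by P x -> gen_by P y -> gen_by P (x * y).
Proof.
move=> Px Py; elim: Px => [|c u v _ IHu _ IHv||s a u Ps _ IH].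
- by rewrite mul0r; exact: gen_by0.
- by rewrite mulrDl -scalerAl; apply: gen_byD.
- by rewrite mul1r.
- by rewrite -mulrA; apply: gen_by_st.
Qed.

Lemma gen_by_strand (P : stshape -> Prop) s a : P s -> gen_by P (st s a).
Proof. by move=> Ps; rewrite -[st s a]mulr1; apply: gen_by_st (gen_by1 P). Qed.

Lemma gen_by_prod P I (r : seq I) (F : I -> S) :
  (forall i, gen_by P (F i)) -> gen_by P (\prod_(i <- r) F i).
Proof.
move=> PF; elim: r => [|i r IH]; first by rewrite big_nil; exact: gen_by1.
by rewrite big_cons; apply: gen_byM.
Qed.

Lemma gen_by_iota (P : stshape -> Prop) f : P None -> gen_by P (ii f).
Proof.
move=> P0; elim/SA_ind: f => [|c f g IHf IHg||a f IH].
- by rewrite iota0; exact: gen_by0.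
- by rewrite iota_linear; apply: gen_byD.
- by rewrite iota1; exact: gen_by1.
- by rewrite iota_barM; apply: gen_by_st.
Qed.

Lemma gen_by_sub (P Q : stshape -> Prop) x :
  (forall s, P s -> Q s) -> gen_by P x -> gen_by Q x.
Proof.
move=> PQ; elim=> [|c u v _ IHu _ IHv||s a u Ps _ IH].
- exact: gen_by0.
- exact: gen_byD.
- exact: gen_by1.
- by apply: gen_by_st => //; apply: PQ.
Qed.

Lemma gen_by_all x : gen_by (fun=> True) x.
Proof.
elim/(@strand_ind _ _ S): x => [|c x y||s a x].
- exact: gen_by0.
- exact: gen_byD.
- exact: gen_by1.
- exact: gen_by_st.
Qed.

Section Contraction.
Variables (W : lmodType k) (d : stshape -> A -> S -> W).
Hypothesis d_fam : forall y, strand_family (fun s a => d s a y).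
Hypothesis d_lin : forall s a, linear (d s a).
Local Notation K := (stcontr d).

Lemma stcontr_linearl y : linear (K^~ y).
Proof. by have [] := stcontr_laws d_fam d_lin. Qed.
Lemma stcontr_linearr x : linear (K x).
Proof. by have [] := stcontr_laws d_fam d_lin. Qed.
Lemma stcontr1 y : K 1 y = 0.
Proof. by have [] := stcontr_laws d_fam d_lin. Qed.
Lemma stcontr_st s a y : K (st s a) y = d s a y.
Proof. by have [] := stcontr_laws d_fam d_lin. Qed.
Lemma stcontrM x x' y : K (x * x') y = K x (x' * y) + K x' (x * y).
Proof. by have [] := stcontr_laws d_fam d_lin. Qed.
Lemma stcontr0l y : K 0 y = 0.
Proof. exact: linear_0 (stcontr_linearl y). Qed.
Lemma stcontr_gen_by (P : stshape -> Prop) x y :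
  (forall s a z, P s -> d s a z = 0) -> gen_by P x -> K x y = 0.
Proof.
move=> dP Px; elim: Px y => [|c u v _ IHu _ IHv||s a u Ps _ IH] y.
- exact: stcontr0l.
- by rewrite stcontr_linearl IHu IHv scaler0 addr0.
- exact: stcontr1.
- by rewrite stcontrM stcontr_st dP // IH addr0.
Qed.
End Contraction.

Lemma stcontr_comb (W : lmodType k) (c : k) (d e g : stshape -> A -> S -> W) :
  (forall y, strand_family (fun s a => d s a y)) ->
  (forall s a, linear (d s a)) ->
  (forall y, strand_family (fun s a => e s a y)) ->
  (forall s a, linear (e s a)) ->
  (forall y, strand_family (fun s a => g s a y)) ->
  (forall s a, linear (g s a)) ->
  (forall s a y, g s a y = c *: d s a y + e s a y) ->
  forall x y, stcontr g x y = c *: stcontr d x y + stcontr e x y.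
Proof.
move=> df dl ef el gf gl E x; elim/(@strand_ind _ _ S): x => [|b x x' IH IH'||s a x IH] y.
- by rewrite !stcontr0l // scaler0 addr0.
- by rewrite !stcontr_linearl // IH IH' !scalerDr !scalerA addrACA [b * c]mulrC.
- by rewrite !stcontr1 // scaler0 addr0.
- by rewrite !stcontrM // !stcontr_st // E IH scalerDr addrACA.
Qed.

Section Relabelling.
Variables (phi psi : nat -> nat).

Definition rlshape (s : stshape) : stshape :=
  omap (fun p => (phi p.1, psi p.2)) s.

Definition relabel : S -> S := sthom (fun s a => st (rlshape s) a).

Lemma relabel_family : strand_family (fun s a => st (rlshape s) a).
Proof. by split=> [s|a b]; [exact: st_linear | exact: st_comm]. Qed.

Lemma relabel_linear : linear relabel.
Proof. exact: sthom_linear relabel_family. Qed.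
HB.instance Definition _ := GRing.isLinear.Build k S S *:%R relabel
  relabel_linear.

Lemma relabel_monoid : monoid_morphism relabel.
Proof.
split; first exact: sthom1 relabel_family.
by move=> x y; exact: sthomM relabel_family _ _.
Qed.
HB.instance Definition _ := GRing.isMonoidMorphism.Build S S relabel
  relabel_monoid.

Lemma relabel_st s a : relabel (st s a) = st (rlshape s) a.
Proof. exact: sthom_strand relabel_family _ _. Qed.

Lemma relabel_iota f : relabel (ii f) = ii f.
Proof.
elim/SA_ind: f => [|c f g IHf IHg||a f IH].
- by rewrite iota0 linear0.
- by rewrite iota_linear relabel_linear IHf IHg.
- by rewrite iota1 rmorph1.
- by rewrite iota_barM rmorphM /= relabel_st IH.
Qed.
End Relabelling.

Lemma eq_relabel (P : stshape -> Prop) phi psi phi' psi' x :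
  (forall s, P s -> rlshape phi psi s = rlshape phi' psi' s) ->
  gen_by P x -> relabel phi psi x = relabel phi' psi' x.
Proof.
move=> E; elim=> [|c u v _ IHu _ IHv||s a u Ps _ IH].
- by rewrite !linear0.
- by rewrite !relabel_linear IHu IHv.
- by rewrite !rmorph1.
- by rewrite !rmorphM /= !relabel_st E // IH.
Qed.

Lemma relabel_comp phi psi phi' psi' x :
  relabel phi psi (relabel phi' psi' x) = relabel (phi \o phi') (psi \o psi') x.
Proof.
elim/(@strand_ind _ _ S): x => [|c x y IHx IHy||s a x IH].
- by rewrite !linear0.
- by rewrite !relabel_linear IHx IHy.
- by rewrite !rmorph1.
- by rewrite !rmorphM /= !relabel_st IH; case: s => [[]|].
Qed.

Lemma relabel_id x : relabel id id x = x.
Proof.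
elim/(@strand_ind _ _ S): x => [|c x y IHx IHy||s a x IH].
- by rewrite linear0.
- by rewrite relabel_linear IHx IHy.
- by rewrite rmorph1.
- by rewrite rmorphM /= relabel_st IH; case: s => [[]|].
Qed.

End StrandCalculus.

(** * The embedding of O(A) *)

Section Tensors.
Variables (k : fieldType) (A Q : lmodType k).

Lemma tset_tnth n (a : n.-tuple A) i x j :
  tnth (tset a i x) j = if j == i then x else tnth a j.
Proof. by rewrite tnth_mktuple. Qed.

Lemma multilinear_prod (C : comAlgType k) n (g : 'I_n -> A -> C) (h : Q -> C) :
  (forall i, linear (g i)) -> linear h ->
  multilinear (fun (a : n.-tuple A) f => h f * \prod_i g i (tnth a i)).
Proof.
move=> gl hl; split=> [a f i c x y|a c f f']; last by rewrite hl mulrDl scalerAl.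
have E z : \prod_j g j (tnth (tset a i z) j) =
    g i z * \prod_(j | j != i) g j (tnth a j).
  rewrite (bigD1 i) //= tset_tnth eqxx; congr (_ * _).
  by apply: eq_bigr => j /negPf ji; rewrite tset_tnth ji.
by rewrite !E gl mulrDl mulrDr -scalerAl -scalerAr.
Qed.

Definition trilinear (W : lmodType k) (F : A -> A -> Q -> W) : Prop :=
  [/\ forall y f, linear (fun x => F x y f), forall x f, linear (fun y => F x y f)
    & forall x y, linear (F x y)].

Lemma trilinear_multilinear (W : lmodType k) (F : A -> A -> Q -> W) :
  trilinear F ->
  multilinear (fun (a : 2.-tuple A) f => F (tnth a ord0) (tnth a ord_max) f).
Proof.
move=> [F1 F2 F3]; split=> [a f i c x y|a]; last exact: F3.
rewrite !tset_tnth; have [->|] := eqVneq i ord0; first by rewrite /= F1.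
by case: (unliftP ord0 i) => [j ->|-> //]; rewrite [j]ord1 /= F2.
Qed.

Lemma tuple2E (a : 2.-tuple A) : a = [tuple tnth a ord0; tnth a ord_max].
Proof.
by apply: val_inj; case: a => -[|x [|y []]] //= sz; rewrite !(tnth_nth x).
Qed.

Local Open Scope dcr_scope.

Lemma tens2_ind (P : tens A Q 2 -> Prop) :
  P 0 -> (forall c x y f t, P t -> P (c *: ([tuple x; y] \ot f) + t)) ->
  forall t, P t.
Proof.
by move=> P0 PD; apply: tens_ind => // c a f t; rewrite [a]tuple2E; apply: PD.
Qed.

Lemma tens2_ext (W : lmodType k) (F G : tens A Q 2 -> W) :
  linear F -> linear G ->
  (forall x y f, F ([tuple x; y] \ot f) = G ([tuple x; y] \ot f)) ->
  forall t, F t = G t.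
Proof.
move=> Fl Gl E; elim/tens2_ind => [|c x y f t IH]; first by rewrite !linear_0.
by rewrite Fl Gl E IH.
Qed.

Lemma tens_ext n (W : lmodType k) (F G : tens A Q n -> W) :
  linear F -> linear G ->
  (forall a f, F (a \ot f) = G (a \ot f)) -> forall t, F t = G t.
Proof.
move=> Fl Gl E; elim/tens_ind => [|c a f t IH]; first by rewrite !linear_0.
by rewrite Fl Gl E IH.
Qed.

Lemma tpure2_trilinear : trilinear (fun x y f => [tuple x; y] \ot f : tens A Q 2).
Proof.
have [tl tr] := tpure_multilinear A Q 2.
have E (x y : A) i (z : A) : tset [tuple x; y] i z =
    [tuple (if i == ord0 then z else x); (if i == ord0 then y else z)].
  apply: eq_from_tnth => j; rewrite tset_tnth.
  case: (unliftP ord0 j) => [j' ->|->]; case: (unliftP ord0 i) => [i' ->|->] //;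
  by rewrite ?[i']ord1 ?[j']ord1 //=.
split=> [y f|x f|x y].
- by move=> c x x'; have := tl [tuple x; y] f ord0 c x x'; rewrite !E /=.
- by move=> c y y'; have := tl [tuple x; y] f ord_max c y y'; rewrite !E /=.
- exact: tr.
Qed.

End Tensors.

Section Evaluation.
Variables (k : fieldType) (A : algType k) (S : strandAlg A).
Local Notation st := (strand S).
Local Notation ii := (@iota_SA k A S).
Local Open Scope dcr_scope.

Lemma sw2_linear (W : lmodType k) (F : A -> A -> SA A -> W) :
  trilinear F -> linear (fun w : TA A 2 => sw2 w F).
Proof. by move/trilinear_multilinear/tlift_linear. Qed.

Lemma sw2E (W : lmodType k) (F : A -> A -> SA A -> W) x y f :
  trilinear F -> sw2 ([tuple x; y] \ot f : TA A 2) F = F x y f.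
Proof. by move=> /trilinear_multilinear FM; rewrite [LHS]tliftE. Qed.

Definition strand_val n (p : 'I_n -> stshape) : TA A n -> S :=
  tlift (fun a f => ii f * \prod_i st (p i) (tnth a i)).

Lemma strand_val_multilinear n (p : 'I_n -> stshape) :
  multilinear (fun (a : n.-tuple A) (f : SA A) =>
                 ii f * \prod_i st (p i) (tnth a i)).
Proof.
apply: (@multilinear_prod k A (SA A) S n (fun i => st (p i)) ii) => [i|].
  exact: st_linear.
exact: iota_linear.
Qed.

Lemma strand_val_linear n (p : 'I_n -> stshape) : linear (strand_val p).
Proof. exact: tlift_linear (strand_val_multilinear p). Qed.
HB.instance Definition _ n p := GRing.isLinear.Build k (TA A n) S *:%R
  (@strand_val n p) (@strand_val_linear n p).

Lemma strand_valE n (p : 'I_n -> stshape) a f :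
  strand_val p (a \ot f) = ii f * \prod_i st (p i) (tnth a i).
Proof. exact: tliftE (strand_val_multilinear p). Qed.

Definition perm_shape n (u : 'S_n) (i : 'I_n) : stshape :=
  Some (val i, val ((u^-1)%g i)).

(* The embedding of O(A)_n: the permutation u is turned into n strands, the
   i-th one going from u^-1(i) to i and carrying the i-th tensor factor. *)
Definition embed n (x : OAn A n) : S :=
  \sum_(u : 'S_n) strand_val (perm_shape u) (x u).

Lemma embed_linear n : linear (@embed n).
Proof.
move=> c x y; rewrite /embed scaler_sumr -big_split; apply: eq_bigr => u _ /=.
by rewrite !ffunE linearP.
Qed.
HB.instance Definition _ n := GRing.isLinear.Build k (OAn A n) S *:%R
  (@embed n) (@embed_linear n).

Lemma embed_gtens n (t : TA A n) u :
  embed (gtens t u) = strand_val (perm_shape u) t.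
Proof.
rewrite /embed (bigD1 u) //= big1 ?addr0 => [|v /negPf vu]; rewrite !ffunE.
  by rewrite eqxx.
by rewrite vu linear0.
Qed.

Lemma OAn_ind n (P : OAn A n -> Prop) :
  P 0 -> (forall c x y, P x -> P y -> P (c *: x + y)) ->
  (forall a f u, P (gtens (a \ot f) u)) -> forall x, P x.
Proof.
move=> P0 PD Pg x.
have Pt t u : P (gtens t u).
  elim/tens_ind: t => [|c a f t IH].
    have -> // : gtens 0 u = 0 :> OAn A n.
    by apply/ffunP => v; rewrite !ffunE if_same.
  have -> : gtens (c *: (a \ot f) + t) u = c *: gtens (a \ot f) u + gtens t u.
    by apply/ffunP => v; rewrite !ffunE; case: ifP => _ //; rewrite scaler0 addr0.
  exact: PD.
have -> : x = \sum_u gtens (x u) u.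
  apply/ffunP => v; rewrite sum_ffunE (bigD1 v) //= ffunE eqxx big1 ?addr0 //.
  by move=> u /negPf uv; rewrite ffunE eq_sym uv.
elim/big_ind: _ => // y z Py Pz; rewrite -[y]scale1r; exact: PD.
Qed.

Definition sprod (r : seq ((nat * nat) * A)) : S :=
  \prod_(x <- r) st (Some x.1) x.2.

Lemma sprod_cons x r : sprod (x :: r) = st (Some x.1) x.2 * sprod r.
Proof. exact: big_cons. Qed.

Lemma sprod_gen_by (P : stshape -> Prop) r :
  (forall x, x \in r -> P (Some x.1)) -> gen_by P (sprod r).
Proof.
elim: r => [_|x r IH Pr]; first by rewrite /sprod big_nil; exact: gen_by1.
rewrite sprod_cons; apply: gen_by_st; first by apply: Pr; rewrite mem_head.
by apply: IH => y yr; apply: Pr; rewrite inE yr orbT.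
Qed.

Definition strands n (u : 'S_n) (a : n.-tuple A) :=
  [seq ((val i, val ((u^-1)%g i)), tnth a i) | i <- enum 'I_n].

Lemma embed_pure n (a : n.-tuple A) f u :
  embed (gtens (a \ot f) u) = ii f * sprod (strands u a).
Proof. by rewrite embed_gtens strand_valE /sprod big_map big_enum. Qed.

Section Retraction.
Variables (n : nat) (q : nat -> nat).

Let aug_fun (s : stshape) (a : A) : SA A := if s is None then bar a else 0.
Let aug : S -> SA A := sthom aug_fun.

Let aug_family : strand_family aug_fun.
Proof.
split=> [[s|]|a b] /=; last exact: bar_comm.
- by move=> c a b; rewrite scaler0 addr0.
- exact: bar_linear.
Qed.

Let aug_linear : linear aug. Proof. exact: sthom_linear aug_family. Qed.

Let aug_iota f : aug (ii f) = f.
Proof.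
elim/SA_ind: f => [|c f g IHf IHg||a f IH].
- by rewrite iota0 (linear_0 aug_linear).
- by rewrite iota_linear aug_linear IHf IHg.
- rewrite iota1; exact: (@sthom1 k A S (SA A) aug_fun aug_family).
- rewrite iota_barM; apply: (etrans (@sthomM k A S (SA A) aug_fun aug_family _ _)).
  by rewrite (@sthom_strand k A S (SA A) aug_fun aug_family) [X in _ * X]IH.
Qed.

Definition pick_strand (E : seq A -> S -> TA A n) (l : seq A)
    (s : stshape) (a : A) (y : S) : TA A n :=
  if s is Some (i, j) then
    if (i == size l) && (j == q i) then E (rcons l a) y else 0
  else 0.

(* Removes successively the strands with outputs [size l, ..., size l + m - 1],
   provided that their inputs are prescribed by q, and appends their values to
   l; what is left is evaluated in S(A_nat). *)
Fixpoint extract (m : nat) (l : seq A) : S -> TA A n :=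
  if m is m'.+1 then
    fun y => stcontr (pick_strand (extract m') l) y 1
  else fun y => [tuple nth 0 l i | i < n] \ot aug y.

Lemma pick_family E l :
  (forall y, linear (fun a => E (rcons l a) y)) ->
  forall y, strand_family (fun s a => pick_strand E l s a y).
Proof.
move=> El y; split=> // -[[i j]|] /=; last by move=> c a b; rewrite scaler0 addr0.
by move=> c a b; case: ifP => _; [exact: El | rewrite scaler0 addr0].
Qed.

Lemma pick_linear E l : (forall a, linear (E (rcons l a))) ->
  forall s a, linear (pick_strand E l s a).
Proof.
move=> El [[i j]|] a c x y /=; last by rewrite scaler0 addr0.
by case: ifP => _; [exact: (El a) | rewrite scaler0 addr0].
Qed.

(** Both claims go through one induction: for [stcontr] to be a legitimate operator, the next stage
    has to be linear in the value just appended as well as in the remaining monomial. *)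
Lemma extract_multilinear m :
  (forall l, (size l + m)%N = n -> linear (extract m l)) /\
  (forall l1 l2 y, (size l1 + (size l2).+1 + m)%N = n ->
     linear (fun a => extract m (l1 ++ a :: l2) y)).
Proof.
elim: m => [|m [IH1 IH2]].
  have [tl tr] := tpure_multilinear A (SA A) n; split=> [l _|l1 l2 y sz] c x z /=.
    by rewrite aug_linear; exact: tr.
  have ltn : (size l1 < n)%N by rewrite -sz addn0 addnS ltnS leq_addr.
  pose t b := [tuple nth 0 (l1 ++ b :: l2) i | i < n].
  have E b : t b = tset (t x) (Ordinal ltn) b.
    apply: eq_from_tnth => j; rewrite tset_tnth !tnth_mktuple !nth_cat.
    case: ltnP => [lj|]; first by case: eqP lj => // -> /=; rewrite ltnn.
    rewrite leq_eqVlt => /orP[/eqP ej|lj]; last first.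
      have -> : (j == Ordinal ltn) = false by apply/eqP => ej; rewrite ej ltnn in lj.
      by rewrite -subn_gt0 in lj; case: (j - size l1)%N lj.
    have -> : j == Ordinal ltn by apply/eqP/val_inj.
    by rewrite -ej subnn.
  by have := tl (t x) (aug y) (Ordinal ltn) c x z; rewrite -!E.
have fam l : (size l + m.+1)%N = n ->
    forall y, strand_family (fun s a => pick_strand (extract m) l s a y).
  move=> sl; apply: pick_family => y c a b; rewrite -!cats1; apply: IH2.
  by rewrite /= addn1 addSn -addnS.
have lin l : (size l + m.+1)%N = n ->
    forall s a, linear (pick_strand (extract m) l s a).
  by move=> sl; apply: pick_linear => a; apply: IH1; rewrite size_rcons addSn -addnS.
split=> [l sl|l1 l2 y sz] c a b /=; first by apply: stcontr_linearl; auto.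
have sz' d : (size (l1 ++ d :: l2) + m.+1)%N = n by rewrite size_cat.
apply: stcontr_comb; auto => -[[i j]|] d z /=; last by rewrite scaler0 addr0.
rewrite !size_cat /=; case: ifP => _; last by rewrite scaler0 addr0.
by rewrite !rcons_cat !rcons_cons; apply: IH2; rewrite size_rcons -sz !addnS !addSn.
Qed.

(** The outputs of [r] increase from [size l], so at each stage only the first strand can be picked:
    the loops and the strands with larger outputs contribute nothing. *)
Lemma extract_sprod f r l m : size r = m -> (size l + m)%N = n ->
  [seq x.1.1 | x <- r] = iota (size l) m ->
  extract m l (ii f * sprod r) =
  if all (fun x => x.1.2 == q x.1.1) r then
    [tuple nth 0 (l ++ [seq x.2 | x <- r]) i | i < n] \ot f
  else 0.
Proof.
elim: r m l => [|[[o i] a] r IH] m l.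
  move=> /= <- sl _; rewrite cats0 /sprod big_nil mulr1 /= aug_iota.
  reflexivity.
case: m => [|m] sr; first by discriminate sr.
rewrite [map _ _]/= [iota _ _]/= => sl [-> outs].
rewrite [extract _ _]/= [all _ _]/= [map _ _]/=.
have [ex1 ex2] := extract_multilinear m.
have fam : forall y, strand_family (fun s a => pick_strand (extract m) l s a y).
  apply: pick_family => y c b b'; rewrite -!cats1; apply: ex2.
  by rewrite /= addn1 addSn -addnS.
have lin : forall s a, linear (pick_strand (extract m) l s a).
  by apply: pick_linear => b; apply: ex1; rewrite size_rcons addSn -addnS.
rewrite sprod_cons mulrCA stcontrM // stcontr_st // mulr1 /= eqxx /=.
rewrite (@stcontr_gen_by _ _ _ _ _ fam lin
    (fun s => if s is Some (i, _) then size l < i else true)%N); first last.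
- apply: gen_byM; first exact: gen_by_iota.
  apply: sprod_gen_by => -[[j p] b] xr /=.
  have : j \in [seq x.1.1 | x <- r] by apply/mapP; exists (j, p, b).
  by rewrite outs mem_iota => /andP[].
- by move=> [[j p]|] b z //= lj; rewrite gtn_eqF.
rewrite addr0; case: eqP => //= _; rewrite IH; [|by case: sr|..].
- by rewrite cat_rcons.
- by rewrite size_rcons addSn -addnS.
- by rewrite size_rcons.
Qed.

End Retraction.

(** For each u, extraction with inputs prescribed by u^-1 recovers the component at u, since a
    monomial belonging to another permutation has a strand with the wrong input. *)
Lemma embed_inj n : injective (@embed n).
Proof.
move=> x y xy; apply/ffunP => u.
(* The value 0 beyond n is never consulted, as all outputs are smaller than n. *)
pose q i := if insub i is Some i' then val ((u^-1)%g i' : 'I_n) else 0%N.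
have [/(_ [::] erefl) ext_lin _] := extract_multilinear n q n.
have E (z : OAn A n) : extract n q n [::] (embed z) = z u.
  elim/OAn_ind: z => [|c z z' IH IH'|a f v].
  - by rewrite linear0 (linear_0 ext_lin) ffunE.
  - by rewrite linearP ext_lin IH IH' !ffunE.
  rewrite embed_pure extract_sprod //; first last.
  - by rewrite -map_comp; under eq_map do rewrite /=; rewrite val_enum_ord.
  - by rewrite size_map -cardE card_ord.
  rewrite ffunE all_map /=.
  have -> : [seq x.2 | x <- strands v a] = a.
    by rewrite -map_comp -[RHS]map_tnth_enum.
  have -> : [tuple nth 0 a i | i < n] = a.
    by apply: eq_from_tnth => i; rewrite tnth_mktuple -tnth_nth.
  congr (if _ then _ else _); apply/allP/eqP => [H|<- i _ /=]; last first.
    by rewrite /q valK.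
  apply: invg_inj; apply/permP => i; apply: val_inj.
  by have := H i (mem_enum _ _); rewrite /= /q valK => /eqP ->.
by rewrite -!E xy.
Qed.

End Evaluation.

(** * The image of the embedding, described by multisets of labels *)

Section Weights.
Variables (k : fieldType) (A : algType k) (S : strandAlg A).
Local Notation st := (strand S).
Local Notation ii := (@iota_SA k A S).
Local Open Scope dcr_scope.

Definition outs (s : stshape) : seq nat := if s is Some p then [:: p.1] else [::].
Definition ins (s : stshape) : seq nat := if s is Some p then [:: p.2] else [::].

(** A multigrading of S by the multisets of outputs and of inputs; [weight_perm] makes the lists
    multisets. The weight with both multisets {0, ..., n - 1} is the image of O(A)_n. *)
Inductive weight : seq nat -> seq nat -> S -> Prop :=
| weight0 O I : weight O I 0
| weightD O I c x y : weight O I x -> weight O I y -> weight O I (c *: x + y)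
| weight1 : weight [::] [::] 1
| weight_st s a O I x :
    weight O I x -> weight (outs s ++ O) (ins s ++ I) (st s a * x)
| weight_perm O I O' I' x : perm_eq O O' -> perm_eq I I' ->
    weight O I x -> weight O' I' x.

Lemma weight_strand s a : weight (outs s) (ins s) (st s a).
Proof.
rewrite -[st s a]mulr1 -[outs s]cats0 -[ins s]cats0; exact: weight_st weight1.
Qed.

Lemma weightM O I O' I' x y : weight O I x -> weight O' I' y ->
  weight (O ++ O') (I ++ I') (x * y).
Proof.
move=> wx wy; elim: wx => {O I x} [O I|O I c x z _ IHx _ IHz||s a O I x _ IH|
  O I P J x pO pI _ IH].
- by rewrite mul0r; exact: weight0.
- by rewrite mulrDl -scalerAl; exact: weightD.
- by rewrite mul1r.
- by rewrite -mulrA -!catA; exact: weight_st.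
- by apply: weight_perm IH; rewrite perm_cat2r.
Qed.

Lemma weight_iota f : weight [::] [::] (ii f).
Proof.
elim/SA_ind: f => [|c f g IHf IHg||a f IH].
- by rewrite iota0; exact: weight0.
- by rewrite iota_linear; exact: weightD.
- by rewrite iota1; exact: weight1.
- by rewrite iota_barM; exact: (@weight_st None).
Qed.

Lemma weight_sprod r :
  weight [seq x.1.1 | x <- r] [seq x.1.2 | x <- r] (sprod S r).
Proof.
elim: r => [|x r IH]; first by rewrite /sprod big_nil; exact: weight1.
by rewrite sprod_cons; exact: (@weight_st (Some x.1)).
Qed.

Lemma weight_relabel phi psi O I x :
  weight O I x -> weight (map phi O) (map psi I) (relabel phi psi x).
Proof.
elim=> {O I x} [O I|O I c x z _ IHx _ IHz||s a O I x _ IH|O I P J x pO pI _ IH].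
- by rewrite linear0; exact: weight0.
- by rewrite relabel_linear; exact: weightD.
- by rewrite rmorph1; exact: weight1.
- rewrite rmorphM /= relabel_st !map_cat.
  have -> : map phi (outs s) = outs (rlshape phi psi s) by case: s.
  have -> : map psi (ins s) = ins (rlshape phi psi s) by case: s.
  exact: weight_st.
- by apply: weight_perm IH; apply: perm_map.
Qed.

(** A normal form in which the outputs come in a prescribed order, while the inputs are known up to
    permutation only: this is how the monomials of [embed] look. *)
Inductive sorted_form (O I : seq nat) : S -> Prop :=
| sorted_form0 : sorted_form O I 0
| sorted_formD c f r x : [seq x.1.1 | x <- r] = O ->
    perm_eq [seq x.1.2 | x <- r] I -> sorted_form O I x ->
    sorted_form O I (c *: (ii f * sprod S r) + x).

Lemma sorted_form_lin O I c x y :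
  sorted_form O I x -> sorted_form O I y -> sorted_form O I (c *: x + y).
Proof.
move=> Sx Sy; elim: Sx => [|d f r z rO rI _ IH]; first by rewrite scaler0 add0r.
by rewrite scalerDr scalerA -addrA; apply: sorted_formD.
Qed.

Lemma sorted_form_map O I O' I' (F : S -> S) : linear F ->
  (forall f r, [seq x.1.1 | x <- r] = O -> perm_eq [seq x.1.2 | x <- r] I ->
     sorted_form O' I' (F (ii f * sprod S r))) ->
  forall x, sorted_form O I x -> sorted_form O' I' (F x).
Proof.
move=> Fl FS x; elim=> [|c f r y rO rI _ IH].
  by rewrite linear_0 //; exact: sorted_form0.
by rewrite Fl; apply: sorted_form_lin => //; apply: FS.
Qed.

Lemma sorted_form_term O I f r : [seq x.1.1 | x <- r] = O ->
  perm_eq [seq x.1.2 | x <- r] I -> sorted_form O I (ii f * sprod S r).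
Proof.
move=> rO rI; rewrite -[_ * _]addr0 -[_ * _]scale1r.
by apply: sorted_formD => //; exact: sorted_form0.
Qed.

Lemma mul_linear (a : S) : linear (fun x : S => a * x).
Proof. by move=> c x y /=; rewrite mulrDr scalerAr. Qed.

(** As the factors commute, a new strand can be inserted at the place where its output stands in the
    prescribed order. *)
Lemma weight_sorted O I x : weight O I x ->
  forall O', perm_eq O' O -> sorted_form O' I x.
Proof.
elim=> {O I x} [O I|O I c x z _ IHx _ IHz||s a O I x _ IH|O I P J x pO pI _ IH]
  O' OO'.
- exact: sorted_form0.
- by apply: sorted_form_lin; [apply: IHx | apply: IHz].
- have -> : 1 = ii 1 * sprod S [::] by rewrite iota1 /sprod big_nil mul1r.
  by apply: sorted_form_term => //; rewrite (perm_small_eq _ OO').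
- case: s OO' => [[i j]|] /= OO'; last first.
    apply: sorted_form_map (@mul_linear (st None a)) _ _ (IH _ OO') => f r rO rI.
    by rewrite mulrA -iota_barM; apply: sorted_form_term.
  have iO' : i \in O' by rewrite (perm_mem OO') mem_head.
  case/splitPr: iO' OO' => O1 O2 OO'.
  have {}OO' : perm_eq (O1 ++ O2) O.
    by rewrite -(perm_cons i) -(permPr OO') -cat1s perm_catCA.
  apply: sorted_form_map (@mul_linear (st (Some (i, j)) a)) _ _ (IH _ OO').
  move=> f r rO rI; rewrite mulrCA.
  pose r1 := take (size O1) r; pose r2 := drop (size O1) r.
  have -> : st (Some (i, j)) a * sprod S r = sprod S (r1 ++ (i, j, a) :: r2).
    rewrite -[r in LHS](cat_take_drop (size O1)) /sprod !big_cat big_cons /=.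
    by rewrite mulrCA.
  apply: sorted_form_term.
    by rewrite map_cat /= -/r1 map_take map_drop rO take_size_cat ?drop_size_cat.
  rewrite map_cat /= -cat1s perm_catCA /= perm_cons -map_cat cat_take_drop.
  exact: rI.
- have := IH _ (perm_trans OO' _); rewrite perm_sym => /(_ pO).
  elim=> [|c f r y rO rI _ IH']; first exact: sorted_form0.
  by apply: sorted_formD => //; exact: perm_trans rI pI.
Qed.

(** Once the outputs are in order, the inputs of each monomial list a permutation of 0, ..., n - 1,
    and the monomial is the image of a pure tensor. *)
Lemma weight_embed n x : weight (iota 0 n) (iota 0 n) x ->
  exists z : OAn A n, x = embed S z.
Proof.
move=> /weight_sorted/(_ _ (perm_refl _)).
elim=> [|c f r {}x rO rI _ [z ->]]; first by exists 0; rewrite linear0.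
suff [a [u E]] : exists (a : n.-tuple A) u, strands u a = r.
  by exists (c *: gtens (a \ot f) u + z); rewrite linearP /= embed_pure E.
have sr : size r = n by rewrite -(size_iota 0 n) -rO size_map.
pose d : (nat * nat) * A := ((0%N, 0%N), 0).
have ltw (i : 'I_n) : ((nth d r i).1.2 < n)%N.
  have := perm_mem rI (nth d r i).1.2; rewrite mem_iota leq0n add0n /= => <-.
  by apply/mapP; exists (nth d r i); rewrite ?mem_nth ?sr.
pose w i := Ordinal (ltw i).
have w_inj : injective w.
  move=> i j /(congr1 val) /= E; apply: val_inj => /=.
  have U : uniq [seq x.1.2 | x <- r] by rewrite (perm_uniq rI) iota_uniq.
  apply/eqP; rewrite -(nth_uniq 0%N _ _ U) ?size_map ?sr //.
  by rewrite !(nth_map d) ?sr // E.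
(* The i-th strand of the image of u has input u^-1(i), whence the inverse of the permutation [w] of
   the inputs. *)
exists [tuple (nth d r i).2 | i < n], (perm w_inj)^-1%g.
rewrite /strands invgK -[RHS](mkseq_nth d) /mkseq sr -val_enum_ord -map_comp.
apply: eq_map => i /=; rewrite tnth_mktuple permE /=.
have : val i = (nth d r i).1.1.
  by rewrite -(nth_map d 0%N (fun x => x.1.1)) ?sr // rO nth_iota.
by case: (nth d r i) => [[o j] b] /= ->.
Qed.

Lemma embed_weight n (z : OAn A n) : weight (iota 0 n) (iota 0 n) (embed S z).
Proof.
elim/OAn_ind: z => [|c x y IHx IHy|a f u].
- by rewrite linear0; exact: weight0.
- by rewrite linearP; exact: weightD.
rewrite embed_pure -[iota 0 n]cat0s; apply: weightM; first exact: weight_iota.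
apply: weight_perm (weight_sprod _).
  by rewrite -map_comp -val_enum_ord.
rewrite -map_comp /= -val_enum_ord.
have -> : [seq val ((u^-1)%g i) | i <- enum 'I_n] =
    [seq val i | i <- [seq (u^-1)%g i | i <- enum (ordinal n)]] by rewrite -[RHS]map_comp.
apply: perm_map; apply: uniq_perm; rewrite ?enum_uniq //.
  by rewrite map_inj_uniq ?enum_uniq //; exact: perm_inj.
move=> i; rewrite mem_enum; apply/mapP; exists (u i); first by rewrite mem_enum.
by rewrite permK.
Qed.

Lemma embed_gen_by n (z : OAn A n) :
  gen_by (fun s => if s is Some (i, j) then (i < n) && (j < n) else true)%N
    (embed S z).
Proof.
elim/OAn_ind: z => [|c x y IHx IHy|a f u].
- by rewrite linear0; exact: gen_by0.
- by rewrite linearP; exact: gen_byD.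
rewrite embed_pure; apply: gen_byM; first exact: gen_by_iota.
apply: sprod_gen_by => x /mapP[i _ ->] /=; by rewrite !ltn_ord.
Qed.

End Weights.

(** * The bracket on the strand algebra *)

Lemma linear_skew_transport (k : fieldType) (V : lmodType k)
  (T M1 M2 M1' M2' : V -> V) p q :
  linear T -> linear M1' -> linear M2' ->
  (forall w, T (M1 w) = M1' (T w)) -> (forall w, T (M2 w) = M2' (T w)) ->
  - T (M1 p + M2 q) = M1' (- T p) + M2' (- T q).
Proof.
move=> Tl l1 l2 E1 E2; have N (F : V -> V) x : linear F -> F (- x) = - F x.
  by move=> Fl; rewrite -scaleN1r -[_ *: x]addr0 Fl linear_0 // addr0 scaleN1r.
have := Tl 1 (M1 p) (M2 q); rewrite !scale1r => ->.
by rewrite (N M1') // (N M2') // -E1 -E2 opprD.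
Qed.

Lemma linear_D (k : fieldType) (V W : lmodType k) (f : V -> W) x y :
  linear f -> f (x + y) = f x + f y.
Proof. by move=> fl; have := fl 1 x y; rewrite !scale1r. Qed.

Lemma linear_N (k : fieldType) (V W : lmodType k) (f : V -> W) x :
  linear f -> f (- x) = - f x.
Proof.
by move=> fl; rewrite -scaleN1r -[_ *: x]addr0 fl linear_0 // addr0 scaleN1r.
Qed.

Section StrandDerivation.
Variables (k : fieldType) (A : algType k) (S : strandAlg A).
Local Notation st := (strand S).
Variable D : stshape -> A -> S.
Hypothesis Df : strand_family D.

Definition stder (x : S) : S := stcontr (fun s a z => D s a * z) x 1.

Let d_fam z : strand_family (fun s a => D s a * z).
Proof.
split=> [s c a b|a b]; first by rewrite Df.1 mulrDl scalerAl.
by rewrite Df.2.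
Qed.

Let d_lin s a : linear (fun z : S => D s a * z).
Proof. exact: mul_linear. Qed.

Lemma stder_linear : linear stder.
Proof. exact: stcontr_linearl d_fam d_lin 1. Qed.

Lemma stder0 : stder 0 = 0. Proof. exact: linear_0 stder_linear. Qed.

Lemma stder1 : stder 1 = 0.
Proof. exact: stcontr1 d_fam d_lin 1. Qed.

Lemma stder_st s a : stder (st s a) = D s a.
Proof. by rewrite /stder (stcontr_st d_fam d_lin) mulr1. Qed.

Lemma stderM x y : stder (x * y) = stder x * y + x * stder y.
Proof.
(* For this operator the second argument is a mere factor, which turns [stcontrM] into the usual
   Leibniz rule. *)
have E u z : stcontr (fun s a z => D s a * z) u z = stder u * z.
  rewrite /stder; elim/(@strand_ind _ _ S): u z => [|c u v IHu IHv||s a u IH] z.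
  - by rewrite !(stcontr0l d_fam d_lin) mul0r.
  - by rewrite !(stcontr_linearl d_fam d_lin) IHu IHv mulrDl scalerAl.
  - by rewrite !(stcontr1 d_fam d_lin) mul0r.
  - rewrite !(stcontrM d_fam d_lin) !(stcontr_st d_fam d_lin) IH (IH (_ * 1)).
    by rewrite !mulr1 mulrDl -!mulrA [st s a * z]mulrC.
by rewrite {1}/stder (stcontrM d_fam d_lin) !E !mulr1 [_ * x]mulrC.
Qed.

End StrandDerivation.

Lemma stder_comb (k : fieldType) (A : algType k) (S : strandAlg A) (c : k)
  (D E G : stshape -> A -> S) : strand_family D -> strand_family E ->
  strand_family G -> (forall s a, G s a = c *: D s a + E s a) ->
  forall x, stder G x = c *: stder D x + stder E x.
Proof.
move=> Df Ef Gf GE x; elim/(@strand_ind _ _ S): x => [|b x y IHx IHy||s a x IH].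
- by rewrite !stder0 // scaler0 addr0.
- rewrite !stder_linear // IHx IHy !scalerDr !scalerA [b * c]mulrC.
  by rewrite addrACA.
- by rewrite !stder1 // scaler0 addr0.
- rewrite !stderM // !stder_st // GE IH mulrDl mulrDr scalerDr.
  by rewrite -scalerAl -scalerAr addrACA.
Qed.

(* Exchanging the inputs of two strands; a loop is cut open and spliced in. *)
Definition swap (k : fieldType) (A : algType k) (S : strandAlg A)
    (s t : stshape) (x y : A) : S :=
  match s, t with
  | Some p, Some q =>
      strand S (Some (p.1, q.2)) x * strand S (Some (q.1, p.2)) y
  | Some p, None => strand S (Some p) (y * x)
  | None, Some q => strand S (Some q) (x * y)
  | None, None => strand S None (x * y)
  end.

(* Locked for the same reason as symmetric algebras. *)
HB.lock Definition map2 (k : fieldType) (A : algType k) (g h : A -> A)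
  (w : TA A 2) : TA A 2 := sw2 w (fun x y f => ([tuple g x; h y] \ot f)%dcr).
HB.lock Definition eval2 (k : fieldType) (A : algType k) (S : strandAlg A)
  (s t : stshape) (w : TA A 2) : S :=
  sw2 w (fun x y f => strand S s x * strand S t y * iota_SA S f).
HB.lock Definition eval_swap (k : fieldType) (A : algType k) (S : strandAlg A)
  (s t : stshape) (w : TA A 2) : S :=
  sw2 w (fun x y f => swap S s t x y * iota_SA S f).

Section StrandBracket.
Variables (k : fieldType) (A : algType k) (S : strandAlg A).
Local Notation st := (strand S).
Local Notation ii := (@iota_SA k A S).
Local Notation map2 := (@map2 k A).
Local Notation swap := (@swap k A S).
Local Notation eval2 := (@eval2 k A S).
Local Notation eval_swap := (@eval_swap k A S).
Local Open Scope dcr_scope.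

Lemma mulA_linearl (b : A) : linear (fun a : A => a * b).
Proof. by move=> c x y /=; rewrite mulrDl scalerAl. Qed.
Lemma mulA_linearr (b : A) : linear (fun a : A => b * a).
Proof. by move=> c x y /=; rewrite mulrDr scalerAr. Qed.

Lemma swap_linearl s t y : linear (fun x => swap s t x y).
Proof.
move=> c x x'; have El : (c *: x + x') * y = c *: (x * y) + x' * y.
  by rewrite mulrDl scalerAl.
have Er : y * (c *: x + x') = c *: (y * x) + y * x' by rewrite mulrDr scalerAr.
case: s t => [p|] [q|] /=; rewrite ?El ?Er st_linear ?mulrDl ?scalerAl //.
Qed.

Lemma swap_linearr s t x : linear (swap s t x).
Proof.
move=> c y y'; have El : (c *: y + y') * x = c *: (y * x) + y' * x.
  by rewrite mulrDl scalerAl.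
have Er : x * (c *: y + y') = c *: (x * y) + x * y' by rewrite mulrDr scalerAr.
case: s t => [p|] [q|] /=; rewrite ?El ?Er st_linear ?mulrDr ?scalerAr //.
Qed.

Lemma swapC s t x y : swap t s y x = swap s t x y.
Proof.
case: s t => [p|] [q|]; rewrite /=; [exact: mulrC | by [] | by [] |].
exact: st_comm.
Qed.

Lemma swap_loop t a x y : swap None t (x * a) y = swap None t x (a * y).
Proof. by case: t => [p|] /=; rewrite mulrA. Qed.

Lemma tri_val s t : trilinear (fun x y (f : SA A) => st s x * st t y * ii f).
Proof.
split=> [y f|x f|x y] c u v.
- by rewrite linearP !mulrDl -!scalerAl.
- by rewrite linearP mulrDr mulrDl -scalerAr -scalerAl.
- by rewrite iota_linear mulrDr -scalerAr.
Qed.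

Lemma tri_swap s t : trilinear (fun x y (f : SA A) => swap s t x y * ii f).
Proof.
split=> [y f|x f|x y] c u v.
- by rewrite swap_linearl !mulrDl -!scalerAl.
- by rewrite swap_linearr mulrDl -scalerAl.
- by rewrite iota_linear mulrDr -scalerAr.
Qed.

Lemma eval2_linear s t : linear (eval2 s t).
Proof. rewrite unlock; exact: sw2_linear (tri_val s t). Qed.
HB.instance Definition _ s t := GRing.isLinear.Build k (TA A 2) S *:%R
  (eval2 s t) (eval2_linear s t).
Lemma eval_swap_linear s t : linear (eval_swap s t).
Proof. rewrite unlock; exact: sw2_linear (tri_swap s t). Qed.
HB.instance Definition _ s t := GRing.isLinear.Build k (TA A 2) S *:%R
  (eval_swap s t) (eval_swap_linear s t).

Lemma eval2E s t x y f :
  eval2 s t ([tuple x; y] \ot f) = st s x * st t y * ii f.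
Proof. rewrite unlock; exact: sw2E (tri_val s t). Qed.
Lemma eval_swapE s t x y f :
  eval_swap s t ([tuple x; y] \ot f) = swap s t x y * ii f.
Proof. rewrite unlock; exact: sw2E (tri_swap s t). Qed.

Lemma map2_tri (g h : A -> A) : linear g -> linear h ->
  trilinear (fun x y f => [tuple g x; h y] \ot f : TA A 2).
Proof.
have [T1 T2 T3] := tpure2_trilinear A (SA A).
by move=> gl hl; split=> [y f|x f|x y] c u v; rewrite ?gl ?hl ?T1 ?T2 ?T3.
Qed.

Lemma map2_linear g h : linear g -> linear h -> linear (map2 g h).
Proof. by move=> gl hl; rewrite unlock; exact: sw2_linear (map2_tri gl hl). Qed.

Lemma map2E g h x y f : linear g -> linear h ->
  map2 g h ([tuple x; y] \ot f) = [tuple g x; h y] \ot f.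
Proof. by move=> gl hl; rewrite unlock; exact: sw2E (map2_tri gl hl). Qed.

Lemma tact_multilinear n (s : 'S_n) :
  multilinear (fun a f => [tuple tnth a ((s^-1)%g i) | i < n] \ot f : TA A n).
Proof.
have [tl tr] := tpure_multilinear A (SA A) n; split=> [a f i c x y|a]; last exact: tr.
have E z : [tuple tnth (tset a i z) ((s^-1)%g j) | j < n] =
    tset [tuple tnth a ((s^-1)%g j) | j < n] (s i) z.
  apply: eq_from_tnth => j; rewrite tset_tnth !tnth_mktuple.
  by rewrite -(inj_eq (@perm_inj _ s)) permKV.
by rewrite !E tl.
Qed.

Lemma tact_linear n (s : 'S_n) : linear (@tact k A n s).
Proof. exact: tlift_linear (tact_multilinear s). Qed.
HB.instance Definition _ n s := GRing.isLinear.Build k (TA A n) (TA A n) *:%R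
  (@tact k A n s) (tact_linear s).

Lemma tactE n (s : 'S_n) a f :
  tact s (a \ot f : TA A n) = [tuple tnth a ((s^-1)%g i) | i < n] \ot f.
Proof. exact: tliftE (tact_multilinear s). Qed.

Lemma tact_s12 x y f : tact s12 ([tuple x; y] \ot f : TA A 2) = [tuple y; x] \ot f.
Proof.
rewrite tactE; congr (_ \ot _); apply: eq_from_tnth => i.
rewrite tnth_mktuple /s12 tpermV.
case: (unliftP ord0 i) => [j ->|->]; last by rewrite tpermL.
have -> : lift ord0 j = ord_max :> 'I_2 by apply: val_inj; rewrite [j]ord1.
by rewrite tpermR.
Qed.

Lemma eval2_tact s t w : eval2 t s (tact s12 w) = eval2 s t w.
Proof.
move: w; apply: tens2_ext => [c u v||x y f]; last 2 first.
- exact: eval2_linear.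
- rewrite tact_s12 !eval2E; congr (_ * _); exact: mulrC.
by rewrite tact_linear eval2_linear.
Qed.

Lemma eval_swap_tact s t w : eval_swap t s (tact s12 w) = eval_swap s t w.
Proof.
move: w; apply: tens2_ext => [c u v||x y f]; last 2 first.
- exact: eval_swap_linear.
- by rewrite tact_s12 !eval_swapE swapC.
by rewrite tact_linear eval_swap_linear.
Qed.

Lemma tact_map2 g h w : linear g -> linear h ->
  tact s12 (map2 g h w) = map2 h g (tact s12 w).
Proof.
move=> gl hl; have mgh := map2_linear gl hl; have mhg := map2_linear hl gl.
move: w; apply: tens2_ext => [c u v|c u v|x y f].
- rewrite mgh tact_linear; reflexivity.
- rewrite tact_linear mhg; reflexivity.
- rewrite (map2E _ _ _ gl hl) [LHS]tact_s12 [in RHS]tact_s12 (map2E _ _ _ hl gl).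
  reflexivity.
Qed.

Section Pair.
Variables De Ds : bracket A.
Hypotheses (DeP : right_double_bracket De) (DsP : double_bracket Ds).

Let De_lin : bilinear_for *:%R *:%R De. Proof. by have [] := DeP. Qed.
Let Ds_lin : bilinear_for *:%R *:%R Ds. Proof. by have [] := DsP. Qed.
Let idl : linear (@id A). Proof. by []. Qed.

Lemma De_skew a b : De b a = - tact s12 (De a b).
Proof. by have [_ + _] := DeP; apply. Qed.
Lemma Ds_skew a b : Ds b a = - tact s12 (Ds a b).
Proof. by have [_ + _] := DsP; apply. Qed.

Lemma De_mulr a b c : De a (b * c) =
  map2 id (fun y => y * c) (De a b) + map2 id (fun y => b * y) (De a c).
Proof. by rewrite unlock; have [_ _] := DeP; apply. Qed.
Lemma Ds_mulr a b c : Ds a (b * c) =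
  map2 id (fun y => y * c) (Ds a b) + map2 (fun x => b * x) id (Ds a c).
Proof. by rewrite unlock; have [_ _] := DsP; apply. Qed.

(** Skew-symmetry exchanges the tensor factors: in its first argument a right double bracket is a
    derivation for the two-sided multiplication on the first factor. *)
Lemma De_mull a a' b : De (a * a') b =
  map2 (fun x => x * a') id (De a b) + map2 (fun x => a * x) id (De a' b).
Proof.
have ml := mulA_linearl a'; have mr := mulA_linearr a.
rewrite [LHS]De_skew De_mulr [De a b]De_skew [De a' b]De_skew.
exact: (@linear_skew_transport k (TA A 2) (tact s12)
  (map2 id (fun x => x * a')) (map2 id (fun x => a * x))
  (map2 (fun x => x * a') id) (map2 (fun x => a * x) id) _ _
  (@tact_linear 2 s12) (map2_linear ml idl) (map2_linear mr idl)
  (fun w => tact_map2 w idl ml) (fun w => tact_map2 w idl mr)).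
Qed.

Lemma Ds_mull a a' b : Ds (a * a') b =
  map2 (fun x => x * a') id (Ds a b) + map2 id (fun y => a * y) (Ds a' b).
Proof.
have ml := mulA_linearl a'; have mr := mulA_linearr a.
rewrite [LHS]Ds_skew Ds_mulr [Ds a b]Ds_skew [Ds a' b]Ds_skew.
exact: (@linear_skew_transport k (TA A 2) (tact s12)
  (map2 id (fun x => x * a')) (map2 (fun x => a * x) id)
  (map2 (fun x => x * a') id) (map2 id (fun x => a * x)) _ _
  (@tact_linear 2 s12) (map2_linear ml idl) (map2_linear idl mr)
  (fun w => tact_map2 w idl ml) (fun w => tact_map2 w mr idl)).
Qed.

(** For an open strand s and a loop t the two summands evaluate {a, -}_id and {a, -}_(12) on the
    class of b; see [eval1_act_id] and [eval1_act_s12]. *)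
Definition gen_bracket s a t b : S :=
  eval2 s t (De a b) + eval_swap s t (Ds a b).


Lemma gen_bracket_linearl s t b : linear (fun a => gen_bracket s a t b).
Proof.
move=> c a a'; rewrite /gen_bracket (De_lin.1 b) (Ds_lin.1 b).
by rewrite eval2_linear eval_swap_linear scalerDr addrACA.
Qed.

Lemma eval2_loop t a w : eval2 None t (map2 (fun x => x * a) id w) =
  eval2 None t (map2 (fun x => a * x) id w).
Proof.
have ml := mulA_linearl a; have mr := mulA_linearr a.
move: w; apply: tens2_ext => [c u v|c u v|x y f].
- rewrite (map2_linear ml idl) eval2_linear; reflexivity.
- rewrite (map2_linear mr idl) eval2_linear; reflexivity.
rewrite (map2E _ _ _ ml idl) (map2E _ _ _ mr idl) [LHS]eval2E [RHS]eval2E.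
by rewrite [st None (x * a)]st_comm.
Qed.

Lemma eval_swap_loop t a w : eval_swap None t (map2 (fun x => x * a) id w) =
  eval_swap None t (map2 id (fun x => a * x) w).
Proof.
have ml := mulA_linearl a; have mr := mulA_linearr a.
move: w; apply: tens2_ext => [c u v|c u v|x y f].
- rewrite (map2_linear ml idl) eval_swap_linear; reflexivity.
- rewrite (map2_linear idl mr) eval_swap_linear; reflexivity.
rewrite (map2E _ _ _ ml idl) (map2E _ _ _ idl mr) [LHS]eval_swapE.
by rewrite [RHS]eval_swapE swap_loop.
Qed.

(** On a loop the term x a' of the Leibniz rule of [De] may be rotated to a' x, and for [Ds]
    multiplying x by a' on the right amounts to multiplying y by a' on the left. Each bracket then
    contributes an expression symmetric in a and a'. *)
Lemma gen_bracket_loop t b a a' :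
  gen_bracket None (a * a') t b = gen_bracket None (a' * a) t b.
Proof.
rewrite /gen_bracket !De_mull !Ds_mull.
rewrite !(linear_D _ _ (eval2_linear None t)).
rewrite !(linear_D _ _ (eval_swap_linear None t)).
rewrite !eval2_loop !eval_swap_loop.
by congr (_ + _); rewrite addrC.
Qed.

Lemma gen_bracket_family t b : strand_family (fun s a => gen_bracket s a t b).
Proof.
split=> [s|a a']; [exact: gen_bracket_linearl | exact: gen_bracket_loop].
Qed.

Lemma gen_bracketC s a t b : gen_bracket t b s a = - gen_bracket s a t b.
Proof.
rewrite /gen_bracket [De b a]De_skew [Ds b a]Ds_skew.
rewrite (linear_N _ (eval2_linear t s)) (linear_N _ (eval_swap_linear t s)).
by rewrite eval2_tact eval_swap_tact opprD.
Qed.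

Lemma gen_bracket_familyr s a : strand_family (gen_bracket s a).
Proof.
have E t b : gen_bracket s a t b = - gen_bracket t b s a by exact: gen_bracketC.
have [fl fc] := gen_bracket_family s a.
split=> [t c b b'|b b']; first by rewrite !E fl opprD scalerN.
by rewrite !E fc.
Qed.

Lemma relabel_eval2 phi psi s t w :
  relabel phi psi (eval2 s t w) = eval2 (rlshape phi psi s) (rlshape phi psi t) w.
Proof.
move: w; apply: tens2_ext => [c u v||x y f]; last 2 first.
- exact: eval2_linear.
- by rewrite !eval2E !rmorphM /= !relabel_st relabel_iota.
by rewrite eval2_linear relabel_linear.
Qed.

Lemma relabel_swap phi psi s t x y : relabel phi psi (swap s t x y) =
  swap (rlshape phi psi s) (rlshape phi psi t) x y.
Proof.
case: s t => [p|] [q|]; rewrite /= ?rmorphM /= !relabel_st; reflexivity.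
Qed.

Lemma relabel_eval_swap phi psi s t w : relabel phi psi (eval_swap s t w) =
  eval_swap (rlshape phi psi s) (rlshape phi psi t) w.
Proof.
move: w; apply: tens2_ext => [c u v||x y f]; last 2 first.
- exact: eval_swap_linear.
- by rewrite !eval_swapE rmorphM /= relabel_swap relabel_iota.
by rewrite eval_swap_linear relabel_linear.
Qed.

Lemma relabel_gen_bracket phi psi s a t b :
  relabel phi psi (gen_bracket s a t b) =
  gen_bracket (rlshape phi psi s) a (rlshape phi psi t) b.
Proof. by rewrite linearD /= relabel_eval2 relabel_eval_swap. Qed.

Definition br_fun (y : S) (s : stshape) (a : A) : S := stder (gen_bracket s a) y.
Definition br (x y : S) : S := stder (br_fun y) x.

Lemma br_fun_family y : strand_family (br_fun y).
Proof.
split=> [s c a a'|a a'].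
- apply: (stder_comb (D := gen_bracket s a) (E := gen_bracket s a')).
  + exact: gen_bracket_familyr.
  + exact: gen_bracket_familyr.
  + exact: gen_bracket_familyr.
  + by move=> t b; exact: gen_bracket_linearl.
- rewrite /br_fun; congr (stder _ y); apply: funext => t; apply: funext => b.
  exact: gen_bracket_loop.
Qed.

Lemma br_st s a t b : br (st s a) (st t b) = gen_bracket s a t b.
Proof.
rewrite /br (stder_st (br_fun_family _)) /br_fun.
exact: stder_st (gen_bracket_familyr s a) _ _.
Qed.

Lemma br_linearl y : linear (br^~ y).
Proof. exact: stder_linear (br_fun_family y). Qed.

Lemma br_mull x x' y : br (x * x') y = br x y * x' + x * br x' y.
Proof. exact: stderM (br_fun_family y) _ _. Qed.

Lemma br1l y : br 1 y = 0. Proof. exact: stder1 (br_fun_family y). Qed.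

Lemma br_stl s a y : br (st s a) y = stder (gen_bracket s a) y.
Proof. exact: stder_st (br_fun_family y) _ _. Qed.

(** By construction [br] is a derivation in its first argument only; the laws in the second argument
    are carried from generators to all x by induction. *)
Lemma br_linearr x : linear (br x).
Proof.
move=> c y z; elim/(@strand_ind _ _ S): x => [|b x x' IH IH'||s a x IH].
- by rewrite !(linear_0 (br_linearl _)) scaler0 addr0.
- by rewrite !br_linearl IH IH' !scalerDr !scalerA [b * c]mulrC addrACA.
- by rewrite !br1l scaler0 addr0.
rewrite !br_mull !br_stl (stder_linear (gen_bracket_familyr s a)) IH.
by rewrite mulrDl mulrDr -scalerAl -scalerAr scalerDr addrACA.
Qed.

Lemma br_mulr x y y' : br x (y * y') = br x y * y' + y * br x y'.
Proof.
elim/(@strand_ind _ _ S): x => [|b x x' IH IH'||s a x IH].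
- by rewrite !(linear_0 (br_linearl _)) mul0r mulr0 addr0.
- rewrite !br_linearl IH IH' scalerDr mulrDl mulrDr addrACA.
  by rewrite scalerAl scalerAr.
- by rewrite !br1l mul0r mulr0 addr0.
rewrite !br_mull !br_stl (stderM (gen_bracket_familyr s a)) IH.
ring.
Qed.

Lemma br1r x : br x 1 = 0.
Proof.
have /eqP := br_mulr x 1 1; rewrite !mulr1 mul1r.
by rewrite -subr_eq0 opprD addrA subrr sub0r oppr_eq0 => /eqP.
Qed.

Lemma brC x y : br y x = - br x y.
Proof.
elim/(@strand_ind _ _ S): x => [|b x x' IH IH'||s a x IH].
- by rewrite (linear_0 (br_linearl _)) (linear_0 (br_linearr _)) oppr0.
- by rewrite br_linearl br_linearr IH IH' opprD scalerN.
- by rewrite br1l br1r oppr0.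
suff E : br y (st s a) = - br (st s a) y.
  by rewrite br_mull br_mulr IH E mulrN mulNr opprD.
elim/(@strand_ind _ _ S): y {x IH} => [|b x x' IH IH'||t b x IH].
- by rewrite (linear_0 (br_linearl _)) (linear_0 (br_linearr _)) oppr0.
- by rewrite br_linearl br_linearr IH IH' opprD scalerN.
- by rewrite br1l br1r oppr0.
by rewrite br_mull br_mulr IH !br_st gen_bracketC mulrN mulNr opprD.
Qed.

Lemma relabel_br phi psi x y :
  relabel phi psi (br x y) = br (relabel phi psi x) (relabel phi psi y).
Proof.
elim/(@strand_ind _ _ S): x => [|b x x' IH IH'||s a x IH].
- by rewrite !(linear_0 (br_linearl _), linear0).
- by rewrite br_linearl !relabel_linear br_linearl IH IH'.
- by rewrite rmorph1 !br1l linear0.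
rewrite br_mull rmorphM linearD /= !rmorphM /= IH br_mull.
congr (_ * _ + _); rewrite {x IH}.
elim/(@strand_ind _ _ S): y => [|b x x' IH IH'||t b x IH].
- by rewrite !(linear_0 (br_linearr _), linear0).
- by rewrite br_linearr !relabel_linear br_linearr IH IH'.
- by rewrite rmorph1 !br1r linear0.
rewrite br_mulr rmorphM linearD /= !rmorphM /= IH br_mulr.
by rewrite br_st !relabel_st br_st relabel_gen_bracket.
Qed.

Lemma weight_eval2 s t w :
  weight (outs s ++ outs t) (ins s ++ ins t) (eval2 s t w).
Proof.
elim/tens2_ind: w => [|c x y f w IH].
  by rewrite (linear_0 (eval2_linear s t)); exact: weight0.
rewrite eval2_linear eval2E; apply: weightD => //.
rewrite -[outs s ++ _]cats0 -[ins s ++ _]cats0; apply: weightM (weight_iota _ _).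
by apply: weightM; apply: weight_strand.
Qed.

Lemma weight_swap s t x y :
  weight (outs s ++ outs t) (ins s ++ ins t) (swap s t x y).
Proof.
case: s t => [p|] [q|]; last 3 first.
- exact: (weight_strand S (Some p)).
- exact: (weight_strand S (Some q)).
- exact: (weight_strand S None).
apply: (weight_perm (O := [:: p.1; q.1]) (I := [:: q.2; p.2])) => //.
  by rewrite -[X in perm_eq X _]/([:: q.2] ++ [:: p.2]) perm_catC.
exact: weightM (weight_strand S (Some (p.1, q.2)) x)
  (weight_strand S (Some (q.1, p.2)) y).
Qed.

Lemma weight_eval_swap s t w :
  weight (outs s ++ outs t) (ins s ++ ins t) (eval_swap s t w).
Proof.
elim/tens2_ind: w => [|c x y f w IH].
  by rewrite (linear_0 (eval_swap_linear s t)); exact: weight0.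
rewrite eval_swap_linear eval_swapE; apply: weightD => //.
rewrite -[outs s ++ _]cats0 -[ins s ++ _]cats0; apply: weightM (weight_iota _ _).
exact: weight_swap.
Qed.

Lemma weight_add O I (x y : S) :
  weight O I x -> weight O I y -> weight O I (x + y).
Proof. by move=> wx wy; rewrite -[x]scale1r; exact: weightD. Qed.

Lemma weight_gen_bracket s a t b :
  weight (outs s ++ outs t) (ins s ++ ins t) (gen_bracket s a t b).
Proof.
apply: weight_add; [exact: weight_eval2 | exact: weight_eval_swap].
Qed.

(** The values on generators keep all labels, [Ds] merely exchanging two inputs, and each term of
    the Leibniz rules keeps the labels of the factors left alone. *)
Lemma weight_br O I O' I' x y :
  weight O I x -> weight O' I' y -> weight (O ++ O') (I ++ I') (br x y).
Proof.
move=> wx wy; elim: wx => {O I x} [O I|O I c x z _ IHx _ IHz||s a O I x wx IH|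
  O I P J x pO pI _ IH].
- by rewrite (linear_0 (br_linearl _)); exact: weight0.
- by rewrite br_linearl; exact: weightD.
- by rewrite br1l; exact: weight0.
- rewrite br_mull; apply: weight_add; last first.
    rewrite -!catA; apply: weightM IH; exact: weight_strand.
  apply: (weight_perm (O := (outs s ++ O') ++ O) (I := (ins s ++ I') ++ I)).
  + by rewrite -!catA perm_cat2l perm_catC.
  + by rewrite -!catA perm_cat2l perm_catC.
  apply: weightM wx => {x IH}.
  elim: wy => {O' I' y} [O' I'|O' I' c y z _ IHx _ IHz||t b O' I' y wy IH|
    O' I' P J y pO pI _ IH].
  + by rewrite (linear_0 (br_linearr _)); exact: weight0.
  + by rewrite br_linearr; exact: weightD.
  + by rewrite br1r; exact: weight0.
  + rewrite br_mulr; apply: weight_add.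
      rewrite !catA; apply: weightM wy; rewrite br_st.
      exact: weight_gen_bracket.
    apply: (weight_perm (O := outs t ++ (outs s ++ O')) (I := ins t ++ (ins s ++ I'))).
    * by rewrite perm_catCA.
    * by rewrite perm_catCA.
    exact: weight_st.
  + by apply: weight_perm IH; rewrite perm_cat2l.
- by apply: weight_perm IH; rewrite perm_cat2r.
Qed.

End Pair.
End StrandBracket.

(** * Contraction of a label and its compatibility with the bracket *)

Section Contraction.
Variables (k : fieldType) (A : algType k) (S : strandAlg A) (p : nat).
Local Notation st := (strand S).
Local Notation ii := (@iota_SA k A S).
Local Notation eval2 := (@eval2 k A S).
Local Notation eval_swap := (@eval_swap k A S).
Local Open Scope dcr_scope.

(* The strand of value a arriving at the output p from j is plugged into the
   strands leaving the input p. *)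
Definition plug_fun (a : A) (j : nat) (s : stshape) (b : A) : S :=
  if s is Some (m, l) then if l == p then st (Some (m, j)) (a * b) else 0 else 0.
Definition plug a j : S -> S := stder (plug_fun a j).

(** The two fates of a strand with output [p]: it closes up to a loop if its input is [p] too, and
    it is composed with each strand of [y] leaving [p]. For j = p both terms are present. *)
Definition link_fun (s : stshape) (a : A) (y : S) : S :=
  if s is Some (i, j) then
    if i == p then (if j == p then st None a * y else 0) + plug a j y else 0
  else 0.
Definition link : S -> S -> S := stcontr link_fun.

(* Joins the output p to the input p. *)
Definition contract (x : S) : S := link x 1.

Lemma plug_family a j : strand_family (plug_fun a j).
Proof.
split=> [[[m l]|]|//] c b b' /=; last by rewrite scaler0 addr0.
case: eqP => _; last by rewrite scaler0 addr0.
by rewrite mulrDr -scalerAr st_linear.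
Qed.

Lemma plug_linear a j : linear (plug a j).
Proof. exact: stder_linear (plug_family a j). Qed.
Lemma plug0 a j : plug a j 0 = 0. Proof. exact: linear_0 (plug_linear a j). Qed.
Lemma plugM a j x y : plug a j (x * y) = plug a j x * y + x * plug a j y.
Proof. exact: stderM (plug_family a j) _ _. Qed.
Lemma plug1 a j : plug a j 1 = 0. Proof. exact: stder1 (plug_family a j). Qed.
Lemma plug_st a j s b : plug a j (st s b) = plug_fun a j s b.
Proof. exact: stder_st (plug_family a j) _ _. Qed.

Definition no_input (s : stshape) : Prop := if s is Some q then q.2 != p else True.
Definition no_output (s : stshape) : Prop := if s is Some q then q.1 != p else True.
Definition avoids (s : stshape) : Prop := no_output s /\ no_input s.

Lemma plug_avoid a j y : gen_by no_input y -> plug a j y = 0.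
Proof.
elim=> [|c x x' _ IH _ IH'||[[m l]|] b x ps _ IH].
- exact: plug0.
- by rewrite plug_linear IH IH' scaler0 addr0.
- exact: plug1.
- by rewrite plugM plug_st IH /= (negPf ps) mulr0 mul0r addr0.
- by rewrite plugM plug_st IH /= mulr0 mul0r addr0.
Qed.

Lemma plug_linear_val j y : linear (fun a => plug a j y).
Proof.
move=> c a b; apply: stder_comb; [exact: plug_family..|].
move=> [[m l]|] d /=; last by rewrite scaler0 addr0.
case: eqP => _; last by rewrite scaler0 addr0.
by rewrite mulrDl -scalerAl st_linear.
Qed.

Lemma link_family y : strand_family (fun s a => link_fun s a y).
Proof.
split=> [[[i j]|]|//] c a b /=; last by rewrite scaler0 addr0.
case: eqP => _; last by rewrite scaler0 addr0.
rewrite plug_linear_val; case: eqP => _; last by rewrite !add0r.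
by rewrite st_linear mulrDl -scalerAl scalerDr addrACA.
Qed.

Lemma link_fun_linear s a : linear (link_fun s a).
Proof.
case: s => [[i j]|] c x y /=; last by rewrite scaler0 addr0.
case: eqP => _; last by rewrite scaler0 addr0.
rewrite plug_linear; case: eqP => _; last by rewrite !add0r.
by rewrite mulrDr -scalerAr scalerDr addrACA.
Qed.

Lemma link_linearl y : linear (link^~ y).
Proof. exact: stcontr_linearl link_family link_fun_linear y. Qed.
Lemma link_linearr x : linear (link x).
Proof. exact: stcontr_linearr link_family link_fun_linear x. Qed.
Lemma link0l y : link 0 y = 0. Proof. exact: linear_0 (link_linearl y). Qed.
Lemma link0r x : link x 0 = 0. Proof. exact: linear_0 (link_linearr x). Qed.
Lemma link1l y : link 1 y = 0.
Proof. exact: stcontr1 link_family link_fun_linear y. Qed.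
Lemma link_st s a y : link (st s a) y = link_fun s a y.
Proof. exact: stcontr_st link_family link_fun_linear s a y. Qed.
Lemma linkM x x' y : link (x * x') y = link x (x' * y) + link x' (x * y).
Proof. exact: stcontrM link_family link_fun_linear x x' y. Qed.

Lemma link_no_output x y : gen_by no_output x -> link x y = 0.
Proof.
apply: (stcontr_gen_by link_family link_fun_linear) => -[[i j]|] a z //= ip.
by rewrite (negPf ip).
Qed.

Lemma gen_by_no_input (x : S) : gen_by avoids x -> gen_by no_input x.
Proof. by apply: gen_by_sub => s []. Qed.
Lemma gen_by_no_output (x : S) : gen_by avoids x -> gen_by no_output x.
Proof. by apply: gen_by_sub => s []. Qed.

Lemma link_fun_avoid s a y z : gen_by avoids y ->
  link_fun s a (y * z) = y * link_fun s a z.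
Proof.
move=> /gen_by_no_input yp; case: s => [[i j]|] /=; last by rewrite mulr0.
case: eqP => _; last by rewrite mulr0.
rewrite plugM (plug_avoid _ _ yp) mul0r add0r mulrDr.
by case: eqP => _; [rewrite mulrCA | rewrite mulr0].
Qed.

Lemma link_avoidr x y z : gen_by avoids y -> link x (y * z) = y * link x z.
Proof.
move=> yp; elim/(@strand_ind _ _ S): x z => [|c x x' IH IH'||s a x IH] z.
- by rewrite !link0l mulr0.
- by rewrite !link_linearl IH IH' mulrDr scalerAr.
- by rewrite !link1l mulr0.
rewrite !linkM !link_st mulrDr -IH -link_fun_avoid //.
by congr (link_fun s a _ + link _ _); rewrite mulrCA.
Qed.

Lemma link_avoidl x y z : gen_by avoids y -> link (x * y) z = y * link x z.
Proof.
move=> yp; rewrite linkM link_avoidr // (link_no_output _ (gen_by_no_output yp)).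
by rewrite addr0.
Qed.

Lemma contract_linear : linear contract. Proof. exact: link_linearl. Qed.

Lemma contract_avoid x y : gen_by avoids y -> contract (x * y) = contract x * y.
Proof. by move=> yp; rewrite /contract link_avoidl // mulrC. Qed.

Lemma contract_loop a : contract (st (Some (p, p)) a) = st None a.
Proof. by rewrite /contract link_st /= eqxx plug1 addr0 mulr1. Qed.

Lemma contract_pair i j a b : i != p -> j != p ->
  contract (st (Some (p, j)) a * st (Some (i, p)) b) = st (Some (i, j)) (a * b).
Proof.
move=> ip jp; rewrite /contract linkM !link_st /= eqxx (negPf ip) (negPf jp).
by rewrite mulr1 add0r addr0 plug_st /= eqxx.
Qed.

Section Pair.
Variables De Ds : bracket A.
Hypotheses (DeP : right_double_bracket De) (DsP : double_bracket Ds).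
Local Notation gb := (@gen_bracket k A S De Ds).
Local Notation br := (@br k A S De Ds).

Let idl : linear (@id A). Proof. by []. Qed.
Let hold (b : bool) (x : S) : S := if b then x else 0.

Let link_eval2 j t x y f z : avoids t ->
  link (eval2 (Some (p, j)) t ([tuple x; y] \ot f)) z =
  hold (j == p) (eval2 None t ([tuple x; y] \ot f) * z)
  + st t y * ii f * plug x j z.
Proof.
move=> tp; rewrite !eval2E -[_ * _ * ii f]mulrA link_avoidl; last first.
  apply: gen_byM; first exact: gen_by_strand.
  exact: gen_by_iota.
rewrite link_st /= eqxx mulrDr; congr (_ + _); rewrite /hold.
case: eqP => _; last by rewrite mulr0.
by rewrite mulrA [_ * st None x]mulrC !mulrA.
Qed.

Let link_swap j t x y f z : avoids t ->
  link (eval_swap (Some (p, j)) t ([tuple x; y] \ot f)) z =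
  hold (j == p) (eval_swap None t ([tuple x; y] \ot f) * z)
  + ii f * (if t is Some (m, l) then st (Some (m, j)) y * plug x l z
            else plug (y * x) j z).
Proof.
move=> tp; rewrite !eval_swapE link_avoidl; last exact: gen_by_iota.
case: t tp => [[m l]|] /= tp; last first.
  rewrite link_st /= eqxx mulrDr; congr (_ + _); rewrite /hold.
  case: eqP => _; last by rewrite mulr0.
  by rewrite [st None (y * x)]st_comm mulrA [ii f * _]mulrC.
case: tp => mp lp; rewrite linkM !link_st /= eqxx (negPf mp) (negPf lp) addr0 add0r.
rewrite plugM plug_st /= mulrDr; congr (_ + _); rewrite /hold.
case: eqP => _; last by rewrite mul0r mulr0.
by rewrite mulrA [ii f * _]mulrC.
Qed.

Let hold_linear c : linear (hold c).
Proof. by case: c => d x y //=; rewrite scaler0 addr0. Qed.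

(** [n1] and [n2] are the contributions of the two brackets to a contraction in which a strand of
    the bracket is plugged into z; the loop term is subtracted. They are derivations in z, hence
    determined by their values on strands. *)
Let n1 j t w z : S :=
  link (eval2 (Some (p, j)) t w) z - hold (j == p) (eval2 None t w * z).
Let n2 j t w z : S :=
  link (eval_swap (Some (p, j)) t w) z - hold (j == p) (eval_swap None t w * z).

Let n1_linear j t z : linear (fun w => n1 j t w z).
Proof.
move=> c u v; rewrite /n1 !eval2_linear link_linearl mulrDl -scalerAl.
by rewrite hold_linear opprD scalerBr addrACA.
Qed.

Let n2_linear j t z : linear (fun w => n2 j t w z).
Proof.
move=> c u v; rewrite /n2 !eval_swap_linear link_linearl mulrDl -scalerAl.
by rewrite hold_linear opprD scalerBr addrACA.
Qed.

Let n1E j t x y f z : avoids t ->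
  n1 j t ([tuple x; y] \ot f) z = st t y * ii f * plug x j z.
Proof. by move=> tp; rewrite /n1 link_eval2 // addrC addKr. Qed.

Let n2E j t x y f z : avoids t -> n2 j t ([tuple x; y] \ot f) z =
  ii f * (if t is Some (m, l) then st (Some (m, j)) y * plug x l z
          else plug (y * x) j z).
Proof. by move=> tp; rewrite /n2 link_swap // addrC addKr. Qed.

Let n1M j t w z z' : avoids t ->
  n1 j t w (z * z') = n1 j t w z * z' + z * n1 j t w z'.
Proof.
move=> tp; move: w; apply: tens2_ext => [||x y f]; first exact: n1_linear.
  move=> c u v; rewrite !n1_linear mulrDl mulrDr -scalerAl -scalerAr.
  by rewrite addrACA -scalerDr.
by rewrite !n1E // plugM; ring.
Qed.

Let n2M j t w z z' : avoids t ->
  n2 j t w (z * z') = n2 j t w z * z' + z * n2 j t w z'.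
Proof.
move=> tp; move: w; apply: tens2_ext => [||x y f]; first exact: n2_linear.
  move=> c u v; rewrite !n2_linear mulrDl mulrDr -scalerAl -scalerAr.
  by rewrite addrACA -scalerDr.
by rewrite !n2E //; case: t tp => [[m l]|] _; rewrite plugM; ring.
Qed.

Let n1_linearr j t w : linear (n1 j t w).
Proof.
move=> c u v; rewrite /n1 link_linearr mulrDr -scalerAr hold_linear.
by rewrite opprD scalerBr addrACA.
Qed.

Let n2_linearr j t w : linear (n2 j t w).
Proof.
move=> c u v; rewrite /n2 link_linearr mulrDr -scalerAr hold_linear.
by rewrite opprD scalerBr addrACA.
Qed.

Let n1_1 j t w : avoids t -> n1 j t w 1 = 0.
Proof.
move=> tp; have := n1M j w 1 1 tp; rewrite !mulr1 mul1r => /eqP.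
by rewrite -subr_eq0 opprD addrA subrr sub0r oppr_eq0 => /eqP.
Qed.

Let n2_1 j t w : avoids t -> n2 j t w 1 = 0.
Proof.
move=> tp; have := n2M j w 1 1 tp; rewrite !mulr1 mul1r => /eqP.
by rewrite -subr_eq0 opprD addrA subrr sub0r oppr_eq0 => /eqP.
Qed.

Let n1_st_avoid j t w s a : avoids t -> no_input s -> n1 j t w (st s a) = 0.
Proof.
move=> tp sp; move: w; apply: tens2_ext => [||x y f]; first exact: n1_linear.
  by move=> c u v; rewrite scaler0 addr0.
rewrite n1E // plug_st; case: s sp => [[m l]|] /= sp; last by rewrite mulr0.
by rewrite (negPf sp) mulr0.
Qed.

Let n2_st_avoid j t w s a : avoids t -> no_input s -> n2 j t w (st s a) = 0.
Proof.
move=> tp sp; move: w; apply: tens2_ext => [||x y f]; first exact: n2_linear.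
  by move=> c u v; rewrite scaler0 addr0.
have E b i : plug_fun b i s a = 0.
  by case: s sp => [[m l]|] //= sp; rewrite (negPf sp).
by rewrite n2E //; case: t tp => [[m l]|] tp; rewrite plug_st E !mulr0.
Qed.

Lemma gen_by_eval2 (P : stshape -> Prop) s t w : P None -> P s -> P t ->
  gen_by P (eval2 s t w).
Proof.
move=> P0 Ps Pt; elim/tens2_ind: w => [|c x y f w IH].
  by rewrite (linear_0 (eval2_linear S s t)); exact: gen_by0.
rewrite eval2_linear eval2E; apply: gen_byD IH.
apply: gen_byM (gen_by_iota _ _ P0).
by apply: gen_byM; apply: gen_by_strand.
Qed.

(** Outputs and inputs are constrained independently, so that the constraint survives the exchange
    of the inputs of two strands by the second bracket. *)
Definition within (Po Pi : pred nat) (s : stshape) : Prop :=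
  if s is Some q then Po q.1 && Pi q.2 else True.

Lemma gen_by_gen_bracket (Po Pi : pred nat) s t a b :
  within Po Pi s -> within Po Pi t -> gen_by (within Po Pi) (gb s a t b).
Proof.
move=> Ps Pt; rewrite /gen_bracket -[eval2 _ _ _]scale1r; apply: gen_byD.
  exact: gen_by_eval2.
elim/tens2_ind: (Ds a b) => [|c x y f w IH].
  by rewrite (linear_0 (eval_swap_linear S s t)); exact: gen_by0.
rewrite eval_swap_linear eval_swapE; apply: gen_byD IH.
apply: gen_byM (gen_by_iota _ _ I).
case: s t Ps Pt => [q|] [r|] Ps Pt; try exact: gen_by_strand.
move/andP: Ps => [Pq1 Pq2]; move/andP: Pt => [Pr1 Pr2].
by apply: gen_byM; apply: gen_by_strand; rewrite /= ?Pq1 ?Pr1.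
Qed.

Let gb_no_input s t a b : no_input s -> avoids t -> gen_by no_input (gb s a t b).
Proof.
move=> sp [_ tp]; have := @gen_by_gen_bracket predT (predC1 p) s t a b.
by case: s t sp tp => [q|] [r|] /= sp tp H; apply: gen_by_sub (H _ _) => // -[].
Qed.

Let gb_no_output s t a b : no_output s -> avoids t -> gen_by no_output (gb s a t b).
Proof.
move=> sp [tp _]; have := @gen_by_gen_bracket (predC1 p) predT s t a b.
case: s t sp tp => [q|] [r|] /= sp tp H; apply: gen_by_sub (H _ _) => //;
  by rewrite ?andbT // => -[u|] //=; rewrite andbT.
Qed.

Let plug_eval2 a j m t w : avoids t ->
  plug a j (eval2 (Some (m, p)) t w) =
  eval2 (Some (m, j)) t (map2 (fun x => a * x) id w).
Proof.
move=> tp; have mr := mulA_linearr a.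
move: w; apply: tens2_ext => [c u v|c u v|x y f].
- by rewrite eval2_linear plug_linear.
- by rewrite (map2_linear mr idl) eval2_linear.
rewrite (map2E _ _ _ mr idl) [LHS](congr1 _ (eval2E _ _ _ _ _ _)) [RHS]eval2E.
rewrite -mulrA plugM plug_st /= eqxx [plug _ _ (_ * ii f)]plug_avoid.
  by rewrite mulr0 addr0 mulrA.
apply: gen_byM; last exact: (@gen_by_iota _ _ S no_input f I).
by apply: gen_by_strand; case: tp.
Qed.

Let plug_swap a j m t w : avoids t ->
  plug a j (eval_swap (Some (m, p)) t w) =
  eval_swap (Some (m, j)) t (map2 id (fun x => a * x) w).
Proof.
move=> tp; have mr := mulA_linearr a.
move: w; apply: tens2_ext => [c u v|c u v|x y f].
- by rewrite eval_swap_linear plug_linear.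
- by rewrite (map2_linear idl mr) eval_swap_linear.
rewrite (map2E _ _ _ idl mr) [LHS](congr1 _ (eval_swapE _ _ _ _ _ _)).
rewrite [RHS]eval_swapE plugM.
rewrite [plug _ _ (ii f)]plug_avoid; last exact: (@gen_by_iota _ _ S no_input f I).
rewrite mulr0 addr0; congr (_ * _); case: t tp => [[m' l]|] [/= m'p lp].
  rewrite plugM !plug_st /= (negPf lp) eqxx mul0r add0r; reflexivity.
by rewrite plug_st /= eqxx mulrA.
Qed.

Let n1_st j t w m a : avoids t -> n1 j t w (st (Some (m, p)) a) =
  eval2 (Some (m, j)) t (map2 (fun x => x * a) id w).
Proof.
move=> tp; have ml := mulA_linearl a.
move: w; apply: tens2_ext => [||x y f]; first exact: n1_linear.
  by move=> c u v; rewrite (map2_linear ml idl) eval2_linear.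
rewrite (map2E _ _ _ ml idl) [RHS]eval2E n1E // plug_st /= eqxx.
by rewrite [LHS]mulrC mulrA.
Qed.

Let n2_st j t w m a : avoids t -> n2 j t w (st (Some (m, p)) a) =
  eval_swap (Some (m, j)) t (map2 (fun x => x * a) id w).
Proof.
move=> tp; have ml := mulA_linearl a.
move: w; apply: tens2_ext => [||x y f]; first exact: n2_linear.
  by move=> c u v; rewrite (map2_linear ml idl) eval_swap_linear.
rewrite (map2E _ _ _ ml idl) [RHS]eval_swapE n2E // mulrC; congr (_ * _).
case: t tp => [[m' l]|] _; rewrite plug_st /= eqxx; first exact: mulrC.
by rewrite mulrA.
Qed.

(** Only a strand leaving [p] matters. There the Leibniz rule for a * a' gives two terms for each
    bracket: those with a' bracketed are the plugged bracket, those with a bracketed are [n1] and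
    [n2]. *)
Let br_plug_st j t a b s a' : avoids t ->
  br (plug_fun a j s a') (st t b) - plug a j (gb s a' t b) =
  n1 j t (De a b) (st s a') + n2 j t (Ds a b) (st s a').
Proof.
move=> tp; have E : no_input s \/ exists m, s = Some (m, p).
  case: s => [[m l]|]; last by left.
  by have [->|] := eqVneq l p; [right; exists m | left].
case: E => [sp|[m ->]].
  rewrite n1_st_avoid // n2_st_avoid // addr0 plug_avoid; last exact: gb_no_input.
  have -> : plug_fun a j s a' = 0.
    by case: s sp => [[m l]|] //= sp; rewrite (negPf sp).
  by rewrite (linear_0 (br_linearl DeP DsP _)) subr0.
rewrite /= eqxx (br_st S DeP DsP) /gen_bracket n1_st // n2_st //.
rewrite (De_mull DeP) (Ds_mull DsP).
rewrite !(linear_D _ _ (eval2_linear S _ _)) !(linear_D _ _ (eval_swap_linear S _ _)).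
rewrite (linear_D _ _ (plug_linear a j)) plug_eval2 // plug_swap //.
by rewrite addrACA addrK.
Qed.

(** The left-hand side is a commutator of two derivations in z, and the right-hand side is a
    derivation too, so the case of a strand suffices. *)
Let br_plug j t a b z : avoids t ->
  br (plug a j z) (st t b) - plug a j (br z (st t b)) =
  n1 j t (De a b) z + n2 j t (Ds a b) z.
Proof.
move=> tp; have bl := br_linearl DeP DsP (st t b).
elim/(@strand_ind _ _ S): z => [|c x y IHx IHy||s a' x IH].
- rewrite (linear_0 (n1_linearr _ _ _)) (linear_0 (n2_linearr _ _ _)).
  by rewrite plug0 !(linear_0 bl) plug0 subr0 addr0.
- rewrite n1_linearr n2_linearr plug_linear !bl plug_linear opprD.
  by rewrite [LHS]addrACA [RHS]addrACA -scalerDr -IHx -IHy scalerBr.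
- by rewrite n1_1 // n2_1 // plug1 (br1l DeP DsP) (linear_0 bl) plug0 subr0 addr0.
rewrite n1M // n2M // addrACA -mulrDl -mulrDr -IH -br_plug_st //.
rewrite plugM (linear_D _ _ bl) !(br_mull DeP DsP) (linear_D _ _ (plug_linear a j)).
by rewrite !plugM plug_st (br_st S DeP DsP); ring.
Qed.

(** The derivation {-, t b} passes through [link] as through a product, with the bracket acting on
    either argument. The content is the case of a strand x with output [p]. *)
Let br_link_st t b x z : avoids t -> br (link x z) (st t b) =
  link (br x (st t b)) z + link x (br z (st t b)).
Proof.
move=> tp; have bl := br_linearl DeP DsP (st t b).
elim/(@strand_ind _ _ S): x z => [|c x y IHx IHy||s a x IH] z.
- by rewrite !(linear_0 bl, link0l) addr0.
- by rewrite bl !link_linearl bl IHx IHy scalerDr addrACA.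
- by rewrite (br1l DeP DsP) !link1l (linear_0 bl) link0l addr0.
have Est y : br (link (st s a) y) (st t b) =
    link (br (st s a) (st t b)) y + link (st s a) (br y (st t b)).
  rewrite (br_st S DeP DsP) !link_st.
  have E : no_output s \/ exists j, s = Some (p, j).
    case: s => [[i j]|]; last by left.
    by have [->|] := eqVneq i p; [right; exists j | left].
  case: E => [sp|[j ->]].
    have E u : link_fun s a u = 0.
      by case: s sp => [[i j]|] //= sp; rewrite (negPf sp).
    rewrite !E (linear_0 bl) link_no_output ?addr0 //; exact: gb_no_output.
  rewrite /= eqxx (linear_D _ _ bl).
  (* Here [n1] and [n2] unfold to [link] applied to the bracket of generators, minus loop terms that
     cancel against the bracket of the loop closed by the strand. *)
  have := br_plug j a b y tp => /eqP; rewrite subr_eq => /eqP ->.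
  rewrite /n1 /n2 /gen_bracket /hold (linear_D _ _ (link_linearl _)).
  case: eqP => _; last by rewrite (linear_0 bl) !subr0 !add0r.
  rewrite (br_mull DeP DsP) (br_st S DeP DsP) /gen_bracket; ring.
rewrite linkM (linear_D _ _ bl) Est IH !(br_mull DeP DsP).
by rewrite !(linear_D _ _ (link_linearl _)) !(linear_D _ _ (link_linearr _)) !linkM; ring.
Qed.

(** Factors avoiding [p] can be taken out of [link], so induction on the products that make up y
    reduces the claim to a single strand. *)
Theorem contract_br x y : gen_by avoids y -> contract (br x y) = br (contract x) y.
Proof.
have rl := @br_linearr k A S De Ds DeP DsP.
suff E z : gen_by avoids y -> br (link x z) y = link (br x y) z + link x (br z y).
  by move=> yp; rewrite /contract E // (br1l DeP DsP) link0r addr0.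
elim=> [|c u v _ IHu _ IHv||t b u tp up IH].
- by rewrite !(linear_0 (rl _)) link0l link0r addr0.
- by rewrite !rl IHu IHv link_linearl link_linearr scalerDr addrACA.
- by rewrite !(br1r DeP DsP) link0l link0r addr0.
have tp' := gen_by_strand S b tp.
rewrite !(br_mulr DeP DsP) IH br_link_st //.
rewrite !(linear_D _ _ (link_linearl _)) !(linear_D _ _ (link_linearr _)).
rewrite [st t b * br x u]mulrC (link_avoidl _ _ up) (link_avoidl _ _ tp').
rewrite [br z _ * u]mulrC !(link_avoidr _ _ up) !(link_avoidr _ _ tp').
ring.
Qed.

End Pair.
End Contraction.

(** * The Jacobi identity on strands *)

Section JacobiStrand.
Variables (k : fieldType) (A : algType k) (S : strandAlg A).
Variables De Ds : bracket A.
Hypotheses (DeP : right_double_bracket De) (DsP : double_bracket Ds).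
Local Notation st := (strand S).
Local Notation br := (@br k A S De Ds).
Let bl := @br_linearl k A S De Ds DeP DsP.
Let rl := @br_linearr k A S De Ds DeP DsP.

Definition jac (x y z : S) : S := br x (br y z) + br y (br z x) + br z (br x y).

Lemma jac_rot x y z : jac y z x = jac x y z.
Proof. by rewrite /jac [LHS]addrC addrA. Qed.

Lemma jac_linear y z : linear (fun x => jac x y z).
Proof.
move=> c x x'; rewrite /jac !bl !rl !scalerDr.
by rewrite [X in X + _ = _]addrACA [LHS]addrACA.
Qed.

(** The products of two brackets that arise from the Leibniz rules cancel in pairs by skew-symmetry,
    so the Jacobiator is a derivation in each argument. *)
Lemma jac_mull x x' y z : jac (x * x') y z = x * jac x' y z + jac x y z * x'.
Proof.
have E u v : br v u = - br u v := brC DeP DsP u v.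
rewrite /jac !(br_mull DeP DsP) !(br_mulr DeP DsP).
rewrite !(linear_D _ _ (rl _)).
rewrite !(br_mulr DeP DsP) (E x y) (E x z) (E x' y) (E x' z); ring.
Qed.

Lemma jac1 y z : jac 1 y z = 0.
Proof.
by rewrite /jac !(br1l DeP DsP) !(br1r DeP DsP) !(linear_0 (rl _)) !addr0.
Qed.

Lemma jac0 y z : jac 0 y z = 0. Proof. exact: linear_0 (jac_linear y z). Qed.

Lemma jac_ind : (forall s a t b r c, jac (st s a) (st t b) (st r c) = 0) ->
  forall x y z, jac x y z = 0.
Proof.
move=> J; have ext y z : (forall s a, jac (st s a) y z = 0) -> forall x, jac x y z = 0.
  move=> Jy; elim/(@strand_ind _ _ S) => [|c x x' IH IH'||s a x IH].
  - exact: jac0.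
  - by rewrite jac_linear IH IH' scaler0 addr0.
  - exact: jac1.
  - by rewrite jac_mull IH Jy mulr0 mul0r addr0.
move=> x y z; apply: (ext) => s a; rewrite -jac_rot.
apply: (ext) => t b; rewrite -jac_rot; apply: (ext) => r c; rewrite -jac_rot; exact: J.
Qed.

Lemma relabel_jac phi psi x y z : relabel phi psi (jac x y z) =
  jac (relabel phi psi x) (relabel phi psi y) (relabel phi psi z).
Proof. by rewrite /jac !linearD /= !(relabel_br DeP DsP). Qed.

Lemma gen_by_br (Po Pi : pred nat) x y : gen_by (within Po Pi) x ->
  gen_by (within Po Pi) y -> gen_by (within Po Pi) (br x y).
Proof.
move=> Px Py; elim: Px => [|c u v _ IHu _ IHv||s a u Ps Pu IHu].
- by rewrite (linear_0 (bl _)); exact: gen_by0.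
- by rewrite bl; exact: gen_byD.
- by rewrite (br1l DeP DsP); exact: gen_by0.
rewrite (br_mull DeP DsP) -[_ * u]scale1r; apply: gen_byD; last first.
  exact: gen_by_st.
apply: gen_byM Pu; elim: Py => [|c v w _ IHv _ IHw||t b v Pt Pv IHv].
- by rewrite (linear_0 (rl _)); exact: gen_by0.
- by rewrite rl; exact: gen_byD.
- by rewrite (br1r DeP DsP); exact: gen_by0.
rewrite (br_mulr DeP DsP) -[_ * v]scale1r; apply: gen_byD; last first.
  exact: gen_by_st.
apply: gen_byM Pv; rewrite (br_st S DeP DsP).
exact: gen_by_gen_bracket.
Qed.

Lemma within_avoids p s :
  within (predC1 p) (predC1 p) s -> avoids p s.
Proof. by case: s => [[i j]|] //= /andP[]. Qed.

Lemma contract_jac (p : nat) x y z : gen_by (within (predC1 p) (predC1 p)) y ->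
  gen_by (within (predC1 p) (predC1 p)) z ->
  contract p (jac x y z) = jac (contract p x) y z.
Proof.
move=> yp zp; have av (u : S) : gen_by (within (predC1 p) (predC1 p)) u ->
    gen_by (avoids p) u by apply: gen_by_sub; exact: within_avoids.
have cl := @contract_linear k A S p.
have E u v : gen_by (avoids p) u -> contract p (br u v) = br u (contract p v).
  move=> up; rewrite (brC DeP DsP v) (linear_N _ cl) (contract_br DeP DsP) //.
  by rewrite -(brC DeP DsP).
rewrite /jac !(linear_D _ _ cl) (contract_br DeP DsP); last first.
  by apply: av; exact: gen_by_br.
rewrite (E _ _ (av _ yp)) !(E _ _ (av _ zp)).
by rewrite (contract_br DeP DsP _ (av _ yp)).
Qed.

Lemma jac_strands :
  (forall a b c, jac (st (Some (0, 0)%N) a) (st (Some (1, 1)%N) b)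
                     (st (Some (2, 2)%N) c) = 0) ->
  forall x y z, jac x y z = 0.
Proof.
move=> J; have J3 p a q b r c : jac (st (Some p) a) (st (Some q) b) (st (Some r) c) = 0.
  (* The labels 0, 1, 2 are sent to those of the three given strands, which may coincide. *)
  pose phi := nth 0%N [:: p.1; q.1; r.1]; pose psi := nth 0%N [:: p.2; q.2; r.2].
  have := congr1 (relabel phi psi) (J a b c); rewrite relabel_jac !relabel_st /=.
  by rewrite linear0 /phi /psi /= -!surjective_pairing.
have loop t b r c : (forall p a, jac (st (Some p) a) (st t b) (st r c) = 0) ->
    forall s a, jac (st s a) (st t b) (st r c) = 0.
  move=> Jp [p a|a]; first exact: Jp.
  (* [p] will exceed every label of the other two strands, so that they avoid it and the loop can be
     cut open at [p]. *)
  pose m (s : stshape) := if s is Some q then maxn q.1 q.2 else 0%N.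
  pose p := (maxn (m t) (m r)).+1.
  have mp s : (m s < p)%N -> within (predC1 p) (predC1 p) s.
    case: s => [[i j]|] //=; rewrite gtn_max => /andP[ip jp].
    by rewrite !neq_ltn ip jp.
  rewrite -(contract_loop S p a) -contract_jac.
  - by rewrite Jp (linear_0 (@contract_linear k A S p)).
  - by apply: gen_by_strand; apply: mp; rewrite /p ltnS leq_maxl.
  - by apply: gen_by_strand; apply: mp; rewrite /p ltnS leq_maxr.
apply: jac_ind => s a t b r c; apply: (loop) => p a'; rewrite -jac_rot.
apply: (loop) => q b'; rewrite -jac_rot; apply: (loop) => r' c'; rewrite -jac_rot.
exact: J3.
Qed.

End JacobiStrand.

(** * The terms L, R, X of the coupling conditions in the strand algebra *)

Lemma sum_omit_recl (T : Type) (C : comNzRingType) (W : zmodType)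
    (g : T -> C) (D : C -> T -> W) (v : T) (t : seq T) :
  \sum_(i < size (v :: t))
    D (\prod_(l < size (v :: t) | l != i) g (tnth (in_tuple (v :: t)) l))
      (tnth (in_tuple (v :: t)) i) =
  D (\prod_(x <- t) g x) v +
  \sum_(i < size t)
    D (g v * \prod_(l < size t | l != i) g (tnth (in_tuple t) l))
      (tnth (in_tuple t) i).
Proof.
have tl (i : 'I_(size t)) : tnth (in_tuple (v :: t)) (lift ord0 i) =
    tnth (in_tuple t) i by rewrite !(tnth_nth v).
rewrite big_ord_recl /=; congr (D _ _ + _).
  rewrite big_mkcond big_ord_recl /= mul1r (big_tnth _ _ t).
  by apply: eq_bigr => i _; rewrite tl.
apply: eq_bigr => i _; rewrite tl; congr (D _ _).
rewrite big_mkcond big_ord_recl /=; congr (_ * _).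
rewrite [RHS]big_mkcond; apply: eq_bigr => l _.
by rewrite tl (inj_eq (@lift_inj _ ord0)).
Qed.

Section SweedlerSums.
Variables (k : fieldType) (A : algType k).

(** [plift] is a finite sum over a representative, through which a linear map passes whatever [h]
    is. Nested Sweedler sums can thus be rearranged without proving multilinearity at each level. *)
Lemma plift_sum (X : choiceType) (rel : {malg k[X]} -> Prop) (W W' : lmodType k)
    (L : W -> W') (h : X -> W) (q : lquot rel) :
  linear L -> L (plift h q) = plift (fun x => L (h x)) q.
Proof.
move=> Ll; rewrite /plift /fext; elim: (enum_fset _) => [|x s IH].
  by rewrite !big_nil linear_0.
by rewrite !big_cons Ll IH.
Qed.

Lemma linear_sw2 (W W' : lmodType k) (L : W -> W') (w : TA A 2)
    (F : A -> A -> SA A -> W) :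
  linear L -> L (sw2 w F) = sw2 w (fun x y f => L (F x y f)).
Proof. exact: plift_sum. Qed.

Lemma linear_sw1 (W W' : lmodType k) (L : W -> W') (w : TA A 1)
    (F : A -> SA A -> W) :
  linear L -> L (sw1 w F) = sw1 w (fun x f => L (F x f)).
Proof. exact: plift_sum. Qed.

Lemma eq_sw2 (W : lmodType k) (w : TA A 2) (F G : A -> A -> SA A -> W) :
  (forall x y f, F x y f = G x y f) -> sw2 w F = sw2 w G.
Proof.
move=> E; congr (sw2 w _).
by apply: funext => x; apply: funext => y; apply: funext => f; exact: E.
Qed.

Lemma eq_sw1 (W : lmodType k) (w : TA A 1) (F G : A -> SA A -> W) :
  (forall x f, F x f = G x f) -> sw1 w F = sw1 w G.
Proof.
move=> E; congr (sw1 w _).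
by apply: funext => x; apply: funext => f; exact: E.
Qed.

Lemma sw2D (W : lmodType k) (w : TA A 2) (F G : A -> A -> SA A -> W) :
  sw2 w (fun x y f => F x y f + G x y f) = sw2 w F + sw2 w G.
Proof.
rewrite /sw2 /tlift /plift /fext -big_split; apply: eq_bigr => x _ /=.
by rewrite scalerDr.
Qed.

End SweedlerSums.

HB.lock Definition eval3 (k : fieldType) (A : algType k) (S : strandAlg A)
  (p q r : stshape) (w : TA A 3) : S :=
  strand_val S (fun i : 'I_3 => nth None [:: p; q; r] i) w.
HB.lock Definition eval1 (k : fieldType) (A : algType k) (S : strandAlg A)
  (p : stshape) (w : TA A 1) : S := strand_val S (fun=> p) w.

Section Traces.
Variables (k : fieldType) (A : algType k) (S : strandAlg A).
Local Notation st := (strand S).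
Local Notation ii := (@iota_SA k A S).
Local Notation eval1 := (@eval1 k A S).
Local Notation eval2 := (@eval2 k A S).
Local Notation eval3 := (@eval3 k A S).
Local Open Scope dcr_scope.

Lemma eval1_linear s : linear (eval1 s).
Proof. rewrite unlock; exact: strand_val_linear. Qed.
Lemma eval1E s x f : eval1 s ([tuple x] \ot f) = st s x * ii f.
Proof. by rewrite unlock strand_valE big_ord1 mulrC. Qed.
Lemma eval3_linear p q r : linear (eval3 p q r).
Proof. rewrite unlock; exact: strand_val_linear. Qed.
Lemma eval3E p q r x y z f :
  eval3 p q r ([tuple x; y; z] \ot f) = st p x * st q y * st r z * ii f.
Proof.
rewrite unlock strand_valE mulrC; congr (_ * _).
by rewrite !big_ord_recl big_ord0 /= mulr1 mulrA.
Qed.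

Lemma eval2_sw2 s t w :
  eval2 s t w = sw2 w (fun x y f => st s x * st t y * ii f).
Proof. by rewrite unlock. Qed.

Lemma eval3_Lt p q r Dy Dx a b c : eval3 p q r (Lt Dy Dx a b c) =
  sw2 (Dx b c) (fun w1 w2 w3 => eval2 p q (Dy a w1) * (st r w2 * ii w3)).
Proof.
have l := eval3_linear p q r.
apply: etrans (linear_sw2 _ _ l) _; apply: eq_sw2 => w1 w2 w3.
apply: etrans (linear_sw2 _ _ l) _; rewrite mulrC.
rewrite eval2_sw2 (linear_sw2 _ _ (mul_linear _)); apply: eq_sw2 => x y f.
by rewrite eval3E iotaM; ring.
Qed.

Lemma eval3_Rt p q r Dy Dx a b c : eval3 p q r (Rt Dy Dx a b c) =
  sw2 (Dx b c) (fun w1 w2 w3 => eval2 q r (Dy a w2) * (st p w1 * ii w3)).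
Proof.
have l := eval3_linear p q r.
apply: etrans (linear_sw2 _ _ l) _; apply: eq_sw2 => w1 w2 w3.
apply: etrans (linear_sw2 _ _ l) _; rewrite mulrC.
rewrite eval2_sw2 (linear_sw2 _ _ (mul_linear _)); apply: eq_sw2 => x y f.
by rewrite eval3E iotaM; ring.
Qed.

Lemma eval1_sw1 s w : eval1 s w = sw1 w (fun x f => st s x * ii f).
Proof. rewrite unlock /strand_val /sw1 /tlift; congr (plift _ w).
by apply: funext => -[a f] /=; rewrite big_ord1 mulrC.
Qed.

Lemma eval3_Xt p q r dy Dx a b c : eval3 p q r (Xt dy Dx a b c) =
  sw2 (Dx b c) (fun w1 w2 w3 =>
    st p w1 * st q w2 * eval1 r (act_ext (dy a) w3)).
Proof.
have l := eval3_linear p q r.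
apply: etrans (linear_sw2 _ _ l) _; apply: eq_sw2 => w1 w2 w3.
apply: etrans (linear_sw1 _ _ l) _.
rewrite eval1_sw1 (linear_sw1 _ _ (mul_linear _)); apply: eq_sw1 => x f.
by rewrite eval3E mulrA.
Qed.

End Traces.

Section ContrSums.
Variables (k : fieldType) (V : lmodType k) (T : symAlg V).

Lemma contrw_sum (W : lmodType k) (d : V -> T -> W) (w : seq V) (y : T) :
  contrw d w y = \sum_(i < size w) d (tnth (in_tuple w) i)
    ((\prod_(l < size w | l != i) sgen T (tnth (in_tuple w) l)) * y).
Proof.
elim: w y => [|v w IH] y; first by rewrite big_ord0.
have := @sum_omit_recl _ T W (@sgen _ _ T) (fun y' v' => d v' (y' * y)) v w.
move=> -> /=; rewrite IH; congr (d v (_ * _) + _).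
  elim: (w) => [|u t IHt]; first by rewrite big_nil sword_nil.
  by rewrite sword_cons IHt big_cons.
by apply: eq_bigr => i _; rewrite mulrA [_ * sgen T v]mulrC.
Qed.

Section Along.
Variables (C : comAlgType k) (h : T -> C) (e : V -> C).
Hypotheses (h_lin : linear h) (h1 : h 1 = 1)
  (hM : forall x y, h (x * y) = h x * h y) (e_lin : linear e).

(** The operator belonging to the derivation T -> C along [h] with values [e] on generators. *)
Let d v y := h y * e v.

Let d_bilinear : bilinear_for *:%R *:%R d.
Proof.
split=> [y|v] c x z; rewrite /d /=; first by rewrite e_lin mulrDr scalerAr.
by rewrite h_lin mulrDl scalerAl.
Qed.

Let contr_scale x y : contr d x y = h y * contr d x 1.
Proof.
elim/sgen_ind: x y => [|c x x' IH IH'||v x IH] y.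
- by rewrite !(contr0l d_bilinear) mulr0.
- by rewrite !(contr_linearl d_bilinear) IH IH' mulrDr scalerAr.
- by rewrite !(contr1 d_bilinear) mulr0.
rewrite !(contrM d_bilinear) !(contr_v d_bilinear) IH (IH (_ * 1)) /d !mulr1 !hM.
ring.
Qed.

Lemma along1 : contr d 1 1 = 0. Proof. exact: contr1 d_bilinear 1. Qed.

Lemma along_linear : linear (fun x => contr d x 1).
Proof. exact: contr_linearl d_bilinear 1. Qed.

Lemma along_mul v x :
  contr d (sgen T v * x) 1 = h x * e v + h (sgen T v) * contr d x 1.
Proof.
rewrite (contrM d_bilinear) (contr_v d_bilinear) /d mulr1.
by rewrite [contr d x _]contr_scale mulr1.
Qed.

End Along.
End ContrSums.

Lemma linear_bigsum (k : fieldType) (V W : lmodType k) (L : V -> W) I (r : seq I)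
  (P : pred I) (F : I -> V) :
  linear L -> L (\sum_(i <- r | P i) F i) = \sum_(i <- r | P i) L (F i).
Proof.
by move=> Ll; apply: (big_morph L) => [x y|]; [exact: linear_D | exact: linear_0].
Qed.

Section TraceBrackets.
Variables (k : fieldType) (A : algType k) (S : strandAlg A).
Local Notation st := (strand S).
Local Notation ii := (@iota_SA k A S).
Local Notation eval1 := (@eval1 k A S).
Local Notation eval2 := (@eval2 k A S).
Local Notation eval_swap := (@eval_swap k A S).
Local Notation SAalg := (sym_symAlg (Anat A)).

Lemma eval_swap_sw2 s t w :
  eval_swap s t w = sw2 w (fun x y f => swap S s t x y * ii f).
Proof. by rewrite unlock. Qed.

Lemma eval1_act_id s (D : bracket A) a phi :
  eval1 s (act_id D a phi) = eval2 s None (D a (lrepr phi)).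
Proof.
apply: etrans (linear_sw2 _ _ (eval1_linear S s)) _; rewrite eval2_sw2.
by apply: eq_sw2 => x y f; rewrite eval1E iotaM iota_bar mulrA.
Qed.

Lemma eval1_act_s12 q (D : bracket A) a phi :
  eval1 (Some q) (act_s12 D a phi) = eval_swap (Some q) None (D a (lrepr phi)).
Proof.
apply: etrans (linear_sw2 _ _ (eval1_linear S (Some q))) _; rewrite eval_swap_sw2.
by apply: eq_sw2 => x y f; rewrite eval1E.
Qed.

Lemma eval1_act_ext s (d : Anat A -> TA A 1) (e : Anat A -> S) f :
  (forall phi, eval1 s (d phi) = e phi) ->
  eval1 s (act_ext d f) =
  @contr _ _ SAalg S (fun v y => ii (y : SA A) * e v) f 1.
Proof.
move=> E; apply: etrans (plift_sum _ _ (eval1_linear S s)) _.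
rewrite /contr; congr (symlift _ f); apply: funext => w.
rewrite contrw_sum (linear_bigsum _ _ _ (eval1_linear S s)); apply: eq_bigr => i _.
apply: etrans (linear_sw1 _ _ (eval1_linear S s)) _.
rewrite mulr1 -E eval1_sw1 (linear_sw1 _ _ (mul_linear _)).
by apply: eq_sw1 => x g; rewrite eval1E iotaM mulrCA.
Qed.

Lemma eval1_act_extD s (d d' : Anat A -> TA A 1) (e : Anat A -> S) f :
  (forall phi, eval1 s (d phi) + eval1 s (d' phi) = e phi) ->
  eval1 s (act_ext d f) + eval1 s (act_ext d' f) =
  @contr _ _ SAalg S (fun v y => ii (y : SA A) * e v) f 1.
Proof.
move=> E.
have Ed := @eval1_act_ext s d (fun phi => eval1 s (d phi)) f (fun=> erefl).
have Ed' := @eval1_act_ext s d' (fun phi => eval1 s (d' phi)) f (fun=> erefl).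
apply: (etrans (congr2 +%R Ed Ed')); rewrite /contr.
rewrite /slift /= /symlift /plift /fext -big_split; apply: eq_bigr => w _ /=.
rewrite -scalerDr; congr (_ *: _); rewrite !contrw_sum -big_split.
by apply: eq_bigr => i _; rewrite -E mulrDr.
Qed.

Section Pair.
Variables De Ds : bracket A.
Hypotheses (DeP : right_double_bracket De) (DsP : double_bracket Ds).
Local Notation gb := (@gen_bracket k A S De Ds).
Local Notation br := (@br k A S De Ds).
Let bl := @br_linearl k A S De Ds DeP DsP.
Let rl := @br_linearr k A S De Ds DeP DsP.

(** As functions of f both sides are derivations along the inclusion of S(A_nat) into S, and they
    agree on the class of an element of A. Hence the terms X come from bracketing with the
    S(A_nat)-component of the inner bracket. *)
Lemma eval1_act_br q a f :
  eval1 (Some q) (act_ext (act_id De a) f) + eval1 (Some q) (act_ext (act_s12 Ds a) f)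
  = br (st (Some q) a) (ii f).
Proof.
have [gl gc] := gen_bracket_familyr S DeP DsP (Some q) a.
pose e (phi : Anat A) := gb (Some q) a None (lrepr phi).
have el : linear e by apply: lrepr_linear => [|b c]; [exact: gl | exact: gc].
apply: (etrans (@eval1_act_extD _ _ _ e f _)).
  move=> phi; exact: (congr2 +%R (eval1_act_id _ De a phi) (eval1_act_s12 q Ds a phi)).
have il := @iota_linear k A S; have i1 := iota1 S; have iM := @iotaM k A S.
elim/SA_ind: f => [|c f g IHf IHg||b f IH].
- rewrite (linear_0 il) (linear_0 (rl _)).
  exact: linear_0 (@along_linear _ _ SAalg S ii e il el).
- rewrite il rl -IHf -IHg; exact: (@along_linear _ _ SAalg S ii e il el).
- rewrite i1 (br1r DeP DsP); exact: (@along1 _ _ SAalg S ii e il el).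
apply: etrans (@along_mul _ _ SAalg S ii e il iM el (lpi _ b) f) _.
rewrite iM (br_mulr DeP DsP).
apply: (congr2 +%R _ (congr2 *%R (erefl (ii (bar b))) IH)).
rewrite iota_bar (br_st S DeP DsP) mulrC; congr (_ * _).
exact: (lrepr_lpi (h := fun b => gb (Some q) a None b)).
Qed.

End Pair.
End TraceBrackets.

Local Notation "'lab' i j" := (Some (i, j)%N : stshape) (at level 10, i, j at level 8).

(* Collecting the 36 terms of the Jacobiator of three strands according to the
   permutation through which they connect inputs to outputs. *)
Lemma collect_jacobi (C : comNzRingType) (B : Type)
  (Lee Lse Les Lss Ree Rse Res Rss Xee Xse Xes Xss :
     stshape -> stshape -> stshape -> B -> B -> B -> C) a b c :
  (forall p q r x y z, Rss p q r x y z = - Lss q r p x z y) ->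
  (Lee (lab 0 0) (lab 1 1) (lab 2 2) a b c
  + Lse (lab 0 1) (lab 1 0) (lab 2 2) a b c
  + Ree (lab 1 1) (lab 0 0) (lab 2 2) a b c
  + Rse (lab 1 1) (lab 0 2) (lab 2 0) a b c
  + Xee (lab 1 1) (lab 2 2) (lab 0 0) a b c
  + Xse (lab 1 1) (lab 2 2) (lab 0 0) a b c) +
  (Les (lab 0 0) (lab 1 2) (lab 2 1) a b c
  + Lss (lab 0 2) (lab 1 0) (lab 2 1) a b c
  + Res (lab 1 2) (lab 0 0) (lab 2 1) a b c
  + Rss (lab 1 2) (lab 0 1) (lab 2 0) a b c
  + Xes (lab 1 2) (lab 2 1) (lab 0 0) a b c
  + Xss (lab 1 2) (lab 2 1) (lab 0 0) a b c) +
  ((Lee (lab 1 1) (lab 2 2) (lab 0 0) b c a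
  + Lse (lab 1 2) (lab 2 1) (lab 0 0) b c a
  + Ree (lab 2 2) (lab 1 1) (lab 0 0) b c a
  + Rse (lab 2 2) (lab 1 0) (lab 0 1) b c a
  + Xee (lab 2 2) (lab 0 0) (lab 1 1) b c a
  + Xse (lab 2 2) (lab 0 0) (lab 1 1) b c a) +
  (Les (lab 1 1) (lab 2 0) (lab 0 2) b c a
  + Lss (lab 1 0) (lab 2 1) (lab 0 2) b c a
  + Res (lab 2 0) (lab 1 1) (lab 0 2) b c a
  + Rss (lab 2 0) (lab 1 2) (lab 0 1) b c a
  + Xes (lab 2 0) (lab 0 2) (lab 1 1) b c a
  + Xss (lab 2 0) (lab 0 2) (lab 1 1) b c a)) +
  ((Lee (lab 2 2) (lab 0 0) (lab 1 1) c a b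
  + Lse (lab 2 0) (lab 0 2) (lab 1 1) c a b
  + Ree (lab 0 0) (lab 2 2) (lab 1 1) c a b
  + Rse (lab 0 0) (lab 2 1) (lab 1 2) c a b
  + Xee (lab 0 0) (lab 1 1) (lab 2 2) c a b
  + Xse (lab 0 0) (lab 1 1) (lab 2 2) c a b) +
  (Les (lab 2 2) (lab 0 1) (lab 1 0) c a b
  + Lss (lab 2 1) (lab 0 2) (lab 1 0) c a b
  + Res (lab 0 1) (lab 2 2) (lab 1 0) c a b
  + Rss (lab 0 1) (lab 2 0) (lab 1 2) c a b
  + Xes (lab 0 1) (lab 1 0) (lab 2 2) c a b
  + Xss (lab 0 1) (lab 1 0) (lab 2 2) c a b)) =
  Lee (lab 0 0) (lab 1 1) (lab 2 2) a b c
    + Lee (lab 1 1) (lab 2 2) (lab 0 0) b c a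
    + Lee (lab 2 2) (lab 0 0) (lab 1 1) c a b
    + (Ree (lab 1 1) (lab 0 0) (lab 2 2) a b c
      + Ree (lab 2 2) (lab 1 1) (lab 0 0) b c a
      + Ree (lab 0 0) (lab 2 2) (lab 1 1) c a b)
    + (Xee (lab 1 1) (lab 2 2) (lab 0 0) a b c
      + Xee (lab 2 2) (lab 0 0) (lab 1 1) b c a
      + Xee (lab 0 0) (lab 1 1) (lab 2 2) c a b)
    + (Xse (lab 1 1) (lab 2 2) (lab 0 0) a b c
      + Xse (lab 2 2) (lab 0 0) (lab 1 1) b c a
      + Xse (lab 0 0) (lab 1 1) (lab 2 2) c a b)
  + (Lse (lab 0 1) (lab 1 0) (lab 2 2) a b c
    + Rse (lab 2 2) (lab 1 0) (lab 0 1) b c a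
    + Les (lab 2 2) (lab 0 1) (lab 1 0) c a b
    + Res (lab 0 1) (lab 2 2) (lab 1 0) c a b
    + Xes (lab 0 1) (lab 1 0) (lab 2 2) c a b + Xss (lab 0 1) (lab 1 0) (lab 2 2) c a b)
  + (Lse (lab 1 2) (lab 2 1) (lab 0 0) b c a
    + Rse (lab 0 0) (lab 2 1) (lab 1 2) c a b
    + Les (lab 0 0) (lab 1 2) (lab 2 1) a b c
    + Res (lab 1 2) (lab 0 0) (lab 2 1) a b c
    + Xes (lab 1 2) (lab 2 1) (lab 0 0) a b c + Xss (lab 1 2) (lab 2 1) (lab 0 0) a b c)
  + (Lse (lab 2 0) (lab 0 2) (lab 1 1) c a b
    + Rse (lab 1 1) (lab 0 2) (lab 2 0) a b c
    + Les (lab 1 1) (lab 2 0) (lab 0 2) b c a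
    + Res (lab 2 0) (lab 1 1) (lab 0 2) b c a
    + Xes (lab 2 0) (lab 0 2) (lab 1 1) b c a + Xss (lab 2 0) (lab 0 2) (lab 1 1) b c a)
  + (Lss (lab 0 2) (lab 1 0) (lab 2 1) a b c
    + Lss (lab 1 0) (lab 2 1) (lab 0 2) b c a
    + Lss (lab 2 1) (lab 0 2) (lab 1 0) c a b)
  - (Lss (lab 0 1) (lab 2 0) (lab 1 2) a c b
    + Lss (lab 2 0) (lab 1 2) (lab 0 1) c b a
    + Lss (lab 1 2) (lab 0 1) (lab 2 0) b a c).
Proof. by move=> E; rewrite !E; ring. Qed.

(** * The Jacobiator of three strands and the coupling conditions *)

Section JacobiCoupled.
Variables (k : fieldType) (A : algType k) (S : strandAlg A).
Local Notation st := (strand S).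
Local Notation ii := (@iota_SA k A S).
Local Notation eval1 := (@eval1 k A S).
Local Notation eval2 := (@eval2 k A S).
Local Notation eval3 := (@eval3 k A S).
Local Notation eval_swap := (@eval_swap k A S).

Lemma ord3_ind (P : 'I_3 -> Prop) : P l1 -> P l2 -> P l3 -> forall i, P i.
Proof.
move=> P1 P2 P3 [[|[|[|//]]] lt3].
- by rewrite (_ : Ordinal lt3 = l1) //; apply: val_inj.
- by rewrite (_ : Ordinal lt3 = l2) //; apply: val_inj.
- by rewrite (_ : Ordinal lt3 = l3) //; apply: val_inj.
Qed.

Lemma p123_1 : p123 l1 = l2. Proof. by apply: val_inj; rewrite permE. Qed.
Lemma p123_2 : p123 l2 = l3. Proof. by apply: val_inj; rewrite permE. Qed.
Lemma p123_3 : p123 l3 = l1. Proof. by apply: val_inj; rewrite permE. Qed.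
Lemma p132_1 : p132 l1 = l3. Proof. by rewrite -p123_3 permK. Qed.
Lemma p132_2 : p132 l2 = l1. Proof. by rewrite -p123_1 permK. Qed.
Lemma p132_3 : p132 l3 = l2. Proof. by rewrite -p123_2 permK. Qed.
Lemma p12_1 : p12 l1 = l2. Proof. exact: tpermL. Qed.
Lemma p12_2 : p12 l2 = l1. Proof. exact: tpermR. Qed.
Lemma p12_3 : p12 l3 = l3. Proof. by rewrite tpermD. Qed.
Lemma p13_1 : p13 l1 = l3. Proof. exact: tpermL. Qed.
Lemma p13_2 : p13 l2 = l2. Proof. by rewrite tpermD. Qed.
Lemma p13_3 : p13 l3 = l1. Proof. exact: tpermR. Qed.
Lemma p23_1 : p23 l1 = l1. Proof. by rewrite tpermD. Qed.
Lemma p23_2 : p23 l2 = l3. Proof. exact: tpermL. Qed.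
Lemma p23_3 : p23 l3 = l2. Proof. exact: tpermR. Qed.

Definition perm3E := (p123_1, p123_2, p123_3, p132_1, p132_2, p132_3,
  p12_1, p12_2, p12_3, p13_1, p13_2, p13_3, p23_1, p23_2, p23_3).

Lemma strand_val_tact n (p : 'I_n -> stshape) (s : 'S_n) w :
  strand_val S p (tact s w) = strand_val S (fun i => p (s i)) w.
Proof.
move: w; apply: tens_ext => [c u v||a f]; last 2 first.
- exact: strand_val_linear.
- rewrite (congr1 _ (tactE s a f)) !strand_valE; congr (_ * _).
  rewrite (reindex_inj (@perm_inj _ s)); apply: eq_bigr => i _.
  by rewrite tnth_mktuple permK.
by rewrite tact_linear strand_val_linear.
Qed.

Lemma eval3_val p q r w :
  eval3 p q r w = strand_val S (fun i : 'I_3 => nth None [:: p; q; r] i) w.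
Proof. by rewrite unlock. Qed.

Lemma val_eval3 (p : 'I_3 -> stshape) w :
  strand_val S p w = eval3 (p l1) (p l2) (p l3) w.
Proof.
by rewrite eval3_val; congr (strand_val S _ w); apply: funext; apply: ord3_ind.
Qed.

Lemma eval3_tact p q r (s : 'S_3) (w : TA A 3)
    (f := fun i : 'I_3 => nth None [:: p; q; r] (s i)) :
  eval3 p q r (tact s w) = eval3 (f l1) (f l2) (f l3) w.
Proof. by rewrite eval3_val strand_val_tact val_eval3. Qed.

Lemma eval3_p12 p q r w : eval3 p q r (tact p12 w) = eval3 q p r w.
Proof. by rewrite eval3_tact !perm3E. Qed.
Lemma eval3_p13 p q r w : eval3 p q r (tact p13 w) = eval3 r q p w.
Proof. by rewrite eval3_tact !perm3E. Qed.
Lemma eval3_p23 p q r w : eval3 p q r (tact p23 w) = eval3 p r q w.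
Proof. by rewrite eval3_tact !perm3E. Qed.
Lemma eval3_p123 p q r w : eval3 p q r (tact p123 w) = eval3 q r p w.
Proof. by rewrite eval3_tact !perm3E. Qed.
Lemma eval3_p132 p q r w : eval3 p q r (tact p132 w) = eval3 r p q w.
Proof. by rewrite eval3_tact !perm3E. Qed.

Let addE p q r x y X Y : eval3 p q r x = X -> eval3 p q r y = Y ->
  eval3 p q r (x + y) = X + Y.
Proof. by move=> <- <-; exact: linear_D (eval3_linear S p q r). Qed.

Lemma eval3_coupled3 p q r (x1 x2 x3 : TA A 3) :
  eval3 p q r (x1 + tact p123 x2 + tact p132 x3) =
  eval3 p q r x1 + eval3 q r p x2 + eval3 r p q x3.
Proof.
exact: (addE (addE (erefl _) (eval3_p123 _ _ _ _)) (eval3_p132 _ _ _ _)).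
Qed.

Lemma eval3_coupled1 p q r (x1 x2 x3 y1 y2 y3 u1 u2 u3 v1 v2 v3 : TA A 3) :
  eval3 p q r (x1 + tact p123 x2 + tact p132 x3
    + tact p12 (y1 + tact p132 y2 + tact p123 y3)
    + tact p123 (u1 + tact p123 u2 + tact p132 u3)
    + tact p123 (v1 + tact p123 v2 + tact p132 v3)) =
  eval3 p q r x1 + eval3 q r p x2 + eval3 r p q x3
    + (eval3 q p r y1 + eval3 r q p y2 + eval3 p r q y3)
    + (eval3 q r p u1 + eval3 r p q u2 + eval3 p q r u3)
    + (eval3 q r p v1 + eval3 r p q v2 + eval3 p q r v3).
Proof.
exact: (addE (addE (addE (eval3_coupled3 _ _ _ _ _ _)
  (etrans (eval3_p12 _ _ _ _) (addE (addE (erefl _) (eval3_p132 _ _ _ _))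
     (eval3_p123 _ _ _ _))))
  (etrans (eval3_p123 _ _ _ _) (eval3_coupled3 _ _ _ _ _ _)))
  (etrans (eval3_p123 _ _ _ _) (eval3_coupled3 _ _ _ _ _ _))).
Qed.

Lemma eval3_coupled2 p q r (x1 y2 x3 y3 z1 z2 : TA A 3) :
  eval3 p q r (x1 + tact p13 y2 + tact p132 x3 + tact p23 y3 + z1 + z2) =
  eval3 p q r x1 + eval3 r q p y2 + eval3 r p q x3 + eval3 p r q y3
    + eval3 p q r z1 + eval3 p q r z2.
Proof.
exact: (addE (addE (addE (addE (addE (erefl _) (eval3_p13 _ _ _ _))
  (eval3_p132 _ _ _ _)) (eval3_p23 _ _ _ _)) (erefl _)) (erefl _)).
Qed.

Lemma eval_swap_open p q w :
  eval_swap (Some p) (Some q) w = eval2 (Some (p.1, q.2)) (Some (q.1, p.2)) w.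
Proof. by rewrite eval_swap_sw2 eval2_sw2. Qed.

Section Pair.
Variables De Ds : bracket A.
Hypotheses (DeP : right_double_bracket De) (DsP : double_bracket Ds).
Local Notation br := (@br k A S De Ds).
Let bl := @br_linearl k A S De Ds DeP DsP.
Let rl := @br_linearr k A S De Ds DeP DsP.

(** The Leibniz rule over the three factors w', w'', w''' of the inner bracket produces L, R and X,
    once for each outer bracket. In L and R the outer [Ds] exchanges the input of a with that of the
    factor it meets. *)
Lemma br_eval2 (s t r : nat * nat) a b c (Dx : bracket A) :
  br (st (Some s) a) (eval2 (Some t) (Some r) (Dx b c)) =
  eval3 (Some s) (Some t) (Some r) (Lt De Dx a b c)
  + eval3 (Some (s.1, t.2)) (Some (t.1, s.2)) (Some r) (Lt Ds Dx a b c)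
  + eval3 (Some t) (Some s) (Some r) (Rt De Dx a b c)
  + eval3 (Some t) (Some (s.1, r.2)) (Some (r.1, s.2)) (Rt Ds Dx a b c)
  + eval3 (Some t) (Some r) (Some s) (Xt (act_id De) Dx a b c)
  + eval3 (Some t) (Some r) (Some s) (Xt (act_s12 Ds) Dx a b c).
Proof.
apply: (etrans _ (esym (congr2 +%R (congr2 +%R (congr2 +%R (congr2 +%R
  (congr2 +%R (eval3_Lt S _ _ _ De Dx a b c) (eval3_Lt S _ _ _ Ds Dx a b c))
  (eval3_Rt S _ _ _ De Dx a b c)) (eval3_Rt S _ _ _ Ds Dx a b c))
  (eval3_Xt S _ _ _ (act_id De) Dx a b c))
  (eval3_Xt S _ _ _ (act_s12 Ds) Dx a b c)))).
rewrite eval2_sw2 (linear_sw2 _ _ (rl _)) -!sw2D.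
apply: eq_sw2 => w1 w2 w3; rewrite !(br_mulr DeP DsP) !(br_st S DeP DsP).
rewrite -[br _ (ii w3)](eval1_act_br S DeP DsP) /gen_bracket.
rewrite (eval_swap_open s t) (eval_swap_open s r).
generalize (eval1 (Some s) (act_ext (act_id De a) w3)) => X.
generalize (eval1 (Some s) (act_ext (act_s12 Ds a) w3)) => Y.
ring.
Qed.

Let jac_terms (s t r : nat * nat) a b c :
  br (st (Some s) a) (br (st (Some t) b) (st (Some r) c)) =
  (eval3 (Some s) (Some t) (Some r) (Lt De De a b c)
  + eval3 (Some (s.1, t.2)) (Some (t.1, s.2)) (Some r) (Lt Ds De a b c)
  + eval3 (Some t) (Some s) (Some r) (Rt De De a b c)
  + eval3 (Some t) (Some (s.1, r.2)) (Some (r.1, s.2)) (Rt Ds De a b c)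
  + eval3 (Some t) (Some r) (Some s) (Xt (act_id De) De a b c)
  + eval3 (Some t) (Some r) (Some s) (Xt (act_s12 Ds) De a b c)) +
  (eval3 (Some s) (Some (t.1, r.2)) (Some (r.1, t.2)) (Lt De Ds a b c)
  + eval3 (Some (s.1, r.2)) (Some (t.1, s.2)) (Some (r.1, t.2)) (Lt Ds Ds a b c)
  + eval3 (Some (t.1, r.2)) (Some s) (Some (r.1, t.2)) (Rt De Ds a b c)
  + eval3 (Some (t.1, r.2)) (Some (s.1, t.2)) (Some (r.1, s.2)) (Rt Ds Ds a b c)
  + eval3 (Some (t.1, r.2)) (Some (r.1, t.2)) (Some s) (Xt (act_id De) Ds a b c)
  + eval3 (Some (t.1, r.2)) (Some (r.1, t.2)) (Some s)
      (Xt (act_s12 Ds) Ds a b c)).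
Proof.
rewrite (br_st S DeP DsP) /gen_bracket eval_swap_open.
apply: etrans (linear_D _ _ (rl _)) _.
exact: (congr2 +%R (br_eval2 _ _ _ _ _ _ _) (br_eval2 _ _ _ _ _ _ _)).
Qed.

(** Skew-symmetry of the inner [Ds]. It turns the R terms left along the second 3-cycle into the L
    terms of condition 3, with a sign and two arguments exchanged. *)
Let rss_lss p q r a b c :
  eval3 p q r (Rt Ds Ds a b c) = - eval3 q r p (Lt Ds Ds a c b).
Proof.
have Dl : bilinear_for *:%R *:%R Ds by case: DsP.
apply: etrans (eval3_Rt S _ _ _ Ds Ds a b c) _.
apply: (etrans _ (esym (congr1 -%R (eval3_Lt S _ _ _ Ds Ds a c b)))).
have tri : trilinear (fun w1 w2 w3 => eval2 q r (Ds a w1) * (st p w2 * ii w3)).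
  split=> [y f|x f|x y] d u v.
  - by rewrite (Dl.2 a) eval2_linear mulrDl scalerAl.
  - by rewrite st_linear mulrDl mulrDr -scalerAl -scalerAr.
  - by rewrite iota_linear !mulrDr -!scalerAr.
rewrite [Ds b c](Ds_skew DsP).
have [T1 T2 T3] := tri.
have tri' : trilinear (fun w1 w2 w3 => eval2 q r (Ds a w2) * (st p w1 * ii w3)).
  by split=> [y f|x f|x y]; [exact: T2 | exact: T1 | exact: T3].
rewrite (linear_N _ (sw2_linear tri')); congr (- _).
move: (Ds c b); apply: tens2_ext => [d u v||x y f].
- rewrite tact_linear; exact: sw2_linear tri' _ _ _.
- exact: sw2_linear tri.
apply: etrans (congr1 (fun w => sw2 w _) (tact_s12 x y f)) _.
exact: (etrans (sw2E _ _ _ tri') (esym (sw2E _ _ _ tri))).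
Qed.

Definition coupled1_term a b c : TA A 3 :=
  Lt De De a b c + tact p123 (Lt De De b c a) + tact p132 (Lt De De c a b)
  + tact p12 (Rt De De a b c + tact p132 (Rt De De b c a)
              + tact p123 (Rt De De c a b))
  + tact p123 (Xt (act_id De) De a b c + tact p123 (Xt (act_id De) De b c a)
               + tact p132 (Xt (act_id De) De c a b))
  + tact p123 (Xt (act_s12 Ds) De a b c + tact p123 (Xt (act_s12 Ds) De b c a)
               + tact p132 (Xt (act_s12 Ds) De c a b)).
Definition coupled2_term a b c : TA A 3 :=
  Lt Ds De a b c + tact p13 (Rt Ds De b c a) + tact p132 (Lt De Ds c a b)
  + tact p23 (Rt De Ds c a b) + Xt (act_id De) Ds c a b
  + Xt (act_s12 Ds) Ds c a b.
Definition coupled3_term a b c : TA A 3 :=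
  Lt Ds Ds a b c + tact p123 (Lt Ds Ds b c a) + tact p132 (Lt Ds Ds c a b).

(** The inputs listed after the outputs 0, 1, 2 tell the permutation of each summand: the identity,
    the transpositions (12), (23), (13), then the cycles (123) and (132). *)
Lemma jac_coupled a b c :
  jac De Ds (st (lab 0 0) a) (st (lab 1 1) b) (st (lab 2 2) c) =
  eval3 (lab 0 0) (lab 1 1) (lab 2 2) (coupled1_term a b c)
  + eval3 (lab 0 1) (lab 1 0) (lab 2 2) (coupled2_term a b c)
  + eval3 (lab 1 2) (lab 2 1) (lab 0 0) (coupled2_term b c a)
  + eval3 (lab 2 0) (lab 0 2) (lab 1 1) (coupled2_term c a b)
  + eval3 (lab 0 2) (lab 1 0) (lab 2 1) (coupled3_term a b c)
  - eval3 (lab 0 1) (lab 2 0) (lab 1 2) (coupled3_term a c b).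
Proof.
apply: (etrans _ (esym (congr2 +%R (congr2 +%R (congr2 +%R (congr2 +%R
  (congr2 +%R (eval3_coupled1 _ _ _ _ _ _ _ _ _ _ _ _ _ _ _)
   (eval3_coupled2 _ _ _ _ _ _ _ _ _)) (eval3_coupled2 _ _ _ _ _ _ _ _ _))
   (eval3_coupled2 _ _ _ _ _ _ _ _ _)) (eval3_coupled3 _ _ _ _ _ _))
   (congr1 -%R (eval3_coupled3 _ _ _ _ _ _))))).
apply: (etrans (congr2 +%R (congr2 +%R (jac_terms (0, 0) (1, 1) (2, 2) a b c)
  (jac_terms (1, 1) (2, 2) (0, 0) b c a)) (jac_terms (2, 2) (0, 0) (1, 1) c a b)) _)%N.
pose F (T : A -> A -> A -> TA A 3) p q r x y z := eval3 p q r (T x y z).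
exact: (@collect_jacobi S A (F (Lt De De)) (F (Lt Ds De)) (F (Lt De Ds))
  (F (Lt Ds Ds)) (F (Rt De De)) (F (Rt Ds De)) (F (Rt De Ds)) (F (Rt Ds Ds))
  (F (Xt (act_id De) De)) (F (Xt (act_s12 Ds) De)) (F (Xt (act_id De) Ds))
  (F (Xt (act_s12 Ds) Ds)) a b c rss_lss).
Qed.

End Pair.
End JacobiCoupled.

Section JacobiIff.
Variables (k : fieldType) (A : algType k) (S : strandAlg A).
Local Notation eval3 := (@eval3 k A S).

Lemma embed_gtens3 (w : TA A 3) (u : 'S_3) : embed S (gtens w u) =
  eval3 (perm_shape u l1) (perm_shape u l2) (perm_shape u l3) w.
Proof. by rewrite embed_gtens val_eval3. Qed.

(** The six summands are the components of a single element of O(A)_3, to which injectivity of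
    [embed] applies. Three components are enough, as the others repeat conditions 2 and 3 for
    permuted arguments. *)
Lemma eval3_separate (w1 w2 w3 w4 w5 w6 : TA A 3) :
  eval3 (lab 0 0) (lab 1 1) (lab 2 2) w1 + eval3 (lab 0 1) (lab 1 0) (lab 2 2) w2
  + eval3 (lab 1 2) (lab 2 1) (lab 0 0) w3 + eval3 (lab 2 0) (lab 0 2) (lab 1 1) w4
  + eval3 (lab 0 2) (lab 1 0) (lab 2 1) w5 - eval3 (lab 0 1) (lab 2 0) (lab 1 2) w6
  = 0 -> [/\ w1 = 0, w2 = 0 & w5 = 0].
Proof.
(* [tact] reorders the tensor factors so that the strands stand in the order of their outputs. *)
pose z : OAn A 3 := gtens w1 1%g + gtens w2 p12 + gtens (tact p123 w3) p23
  + gtens (tact p132 w4) p13 + gtens w5 p123 - gtens (tact p23 w6) p132.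
have p123V : (p123^-1 = p132)%g by [].
have p132V : (p132^-1 = p123)%g by rewrite /p132 invgK.
have <- : embed S z = eval3 (lab 0 0) (lab 1 1) (lab 2 2) w1
  + eval3 (lab 0 1) (lab 1 0) (lab 2 2) w2
  + eval3 (lab 1 2) (lab 2 1) (lab 0 0) w3 + eval3 (lab 2 0) (lab 0 2) (lab 1 1) w4
  + eval3 (lab 0 2) (lab 1 0) (lab 2 1) w5 - eval3 (lab 0 1) (lab 2 0) (lab 1 2) w6.
  have l := @embed_linear k A S 3.
  have addE (x y : OAn A 3) X Y : embed S x = X -> embed S y = Y ->
    embed S (x + y) = X + Y by move=> <- <-; exact: linear_D.
  have oppE (x : OAn A 3) X : embed S x = X -> embed S (- x) = - X.
    by move=> <-; exact: linear_N.
  have gE w u p q r X : perm_shape u l1 = p -> perm_shape u l2 = q ->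
      perm_shape u l3 = r -> eval3 p q r w = X -> embed S (gtens w u) = X.
    by move=> <- <- <- <-; exact: embed_gtens3.
  apply: (addE _ _ _ _ (addE _ _ _ _ (addE _ _ _ _ (addE _ _ _ _ (addE _ _ _ _
    (gE _ _ _ _ _ _ _ _ _ (erefl _)) (gE _ _ _ _ _ _ _ _ _ (erefl _)))
    (gE _ _ _ _ _ _ _ _ _ (eval3_p123 _ _ _ _ _)))
    (gE _ _ _ _ _ _ _ _ _ (eval3_p132 _ _ _ _ _)))
    (gE _ _ _ _ _ _ _ _ _ (erefl _)))
    (oppE _ _ (gE _ _ _ _ _ _ _ _ _ (eval3_p23 _ _ _ _ _))));
  by rewrite /perm_shape ?invg1 ?perm1 ?tpermV ?p123V ?p132V ?perm3E.
rewrite -(linear0 (embed S (n := 3))) => /embed_inj/ffunP E.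
have zE u : (if u == 1%g then w1 else 0) + (if u == p12 then w2 else 0)
    + (if u == p23 then tact p123 w3 else 0)
    + (if u == p13 then tact p132 w4 else 0) + (if u == p123 then w5 else 0)
    - (if u == p132 then tact p23 w6 else 0) = 0.
  have addf (x y : OAn A 3) X Y : x u = X -> y u = Y -> (x + y) u = X + Y.
    by move=> <- <-; rewrite ffunE.
  have oppf (x : OAn A 3) X : x u = X -> (- x) u = - X by move=> <-; rewrite ffunE.
  have g w v : (gtens w v : OAn A 3) u = if u == v then w else 0 by rewrite ffunE.
  have E0 : (0 : OAn A 3) u = 0 by rewrite ffunE.
  apply: (etrans _ (etrans (E u) E0)); apply: esym.
  exact: (addf _ _ _ _ (addf _ _ _ _ (addf _ _ _ _ (addf _ _ _ _ (addf _ _ _ _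
    (g _ _) (g _ _)) (g _ _)) (g _ _)) (g _ _)) (oppf _ _ (g _ _))).
have neq (u v : 'S_3) (i : 'I_3) : u i != v i -> (u == v) = false.
  by move=> uv; apply/eqP => uv'; rewrite uv' eqxx in uv.
have E1 := zE 1%g; have E2 := zE p12; have E3 := zE p123.
rewrite eqxx (neq 1%g p12 l1) ?(neq 1%g p23 l2) ?(neq 1%g p13 l1)
  ?(neq 1%g p123 l1) ?(neq 1%g p132 l1) ?perm1 ?perm3E // in E1.
rewrite eqxx (neq p12 1%g l1) ?(neq p12 p23 l1) ?(neq p12 p13 l1)
  ?(neq p12 p123 l2) ?(neq p12 p132 l1) ?perm1 ?perm3E // in E2.
rewrite eqxx (neq p123 1%g l1) ?(neq p123 p23 l1) ?(neq p123 p13 l1)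
  ?(neq p123 p12 l2) ?(neq p123 p132 l1) ?perm1 ?perm3E // in E3.
rewrite !(addr0, add0r, subr0) in E1 E2 E3.
by split.
Qed.

Section Pair.
Variables De Ds : bracket A.
Hypotheses (DeP : right_double_bracket De) (DsP : double_bracket Ds).

Lemma jac_iff_coupled : (forall x y z : S, jac De Ds x y z = 0) <->
  [/\ coupled1 De Ds, coupled2 De Ds & coupled3 Ds].
Proof.
split=> [J|[C1 C2 C3]].
  have sep a b c := eval3_separate (etrans (esym (jac_coupled S DeP DsP a b c))
    (J _ _ _)).
  by split=> a b c; have [h1 h2 h3] := sep a b c; [exact: h1 | exact: h2 | exact: h3].
apply: jac_strands => // a b c; apply: etrans (jac_coupled S DeP DsP a b c) _.
have z p q r w : w = 0 -> eval3 p q r w = 0.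
  by move=> ->; exact: linear_0 (eval3_linear S p q r).
have E : 0 + 0 + 0 + 0 + 0 - 0 = 0 :> S by rewrite subr0 !addr0.
apply: (etrans _ E).
congr (_ + _ + _ + _ + _ - _); apply: z.
- exact: C1.
- exact: C2.
- exact: C2.
- exact: C2.
- exact: C3.
- exact: C3.
Qed.

End Pair.
End JacobiIff.

(** * The operations of O(A) in the strand algebra *)

Section Homogeneous.
Variables (k : fieldType) (V : nat -> lmodType k).

Lemma dcomp_linear n : linear (fun x : dsum V => dcomp x n).
Proof. by []. Qed.

Lemma dinj_linear n : linear (@dinj k V n).
Proof.
move=> c x y; apply: dsumP => m; rewrite (dcomp_linear m c).
have [->|mn] := eqVneq m n; first by rewrite !(dinj_comp (V := V)).
by rewrite !(@dinj_homog k V n _ m mn) scaler0 addr0.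
Qed.

Lemma homog_dinj (P : dsum V -> Prop) n : (forall x : V n, P (dinj x)) ->
  forall x, homog x n -> P x.
Proof. by move=> Pd x /homogE ->. Qed.

Lemma dlift_bigsum (W W' : lmodType k) (L : W -> W') (h : forall n, V n -> W) x :
  linear L -> L (dlift h x) = dlift (fun n y => L (h n y)) x.
Proof. by move=> Ll; rewrite /dlift (linear_bigsum _ _ _ Ll). Qed.

End Homogeneous.

Section OAEmbedding.
Variables (k : fieldType) (A : algType k) (S : strandAlg A).
Local Notation OA := (OA A).
Local Notation OAn := (OAn A).
Local Open Scope dcr_scope.

Definition embedO : OA -> S := dlift (V := OAn) (fun n => embed S (n := n)).

Lemma embedO_linear : linear embedO.
Proof. by apply: dlift_linear => n; exact: embed_linear. Qed.

Lemma embedO_dinj n (x : OAn n) : embedO (dinj x) = embed S x.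
Proof. by apply: dliftE => m; exact: embed_linear. Qed.

Lemma embedO_inj n (x y : OA) :
  homog x n -> homog y n -> embedO x = embedO y -> x = y.
Proof.
move=> /homogE -> /homogE ->; rewrite !embedO_dinj => /embed_inj ->.
reflexivity.
Qed.

Lemma linear_oext (W W' : lmodType k) (L : W -> W')
    (F : forall n, n.-tuple A -> SA A -> 'S_n -> W) x :
  linear L -> L (oext F x) = oext (fun n a f u => L (F n a f u)) x.
Proof.
move=> Ll; rewrite /oext (dlift_bigsum _ _ Ll); apply: eq_bigr => n _.
rewrite (linear_bigsum _ _ _ Ll); apply: eq_bigr => u _.
exact: plift_sum.
Qed.

Lemma oext_dinj (W : lmodType k) (L : forall n, OAn n -> W) n (x : OAn n) :
  (forall n, linear (L n)) ->
  oext (fun n a f u => L n (gtens (a \ot f) u)) (dinj x) = L n x.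
Proof.
move=> Ll.
have gl m u : linear (fun t : TA A m => gtens t u : OAn m).
  move=> c s t; apply/ffunP => v; rewrite !ffunE; case: ifP => _ //.
  by rewrite scaler0 addr0.
have ml m u : multilinear (fun a f => L m (gtens (a \ot f : TA A m) u)).
  have [tl tr] := tpure_multilinear A (SA A) m.
  by split=> [a f i c y z|a c f g]; rewrite ?tl ?tr gl Ll.
have hl m : linear (fun y : OAn m =>
    \sum_(u : 'S_m) tlift (fun a f => L m (gtens (a \ot f : TA A m) u)) (y u)).
  move=> c y z; rewrite scaler_sumr -big_split; apply: eq_bigr => u _ /=.
  by rewrite !ffunE (tlift_linear (ml m u)).
rewrite /oext (dliftE hl); move: x; elim/OAn_ind => [|c y z IHy IHz|a f u].
- by rewrite (linear_0 (hl n)) (linear_0 (Ll n)).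
- by rewrite hl Ll IHy IHz.
rewrite (bigD1 u) //= big1 ?addr0 => [|v /negPf vu].
  by rewrite ffunE eqxx (tliftE _ _ (ml n u)).
by rewrite ffunE vu (linear_0 (tlift_linear (ml n v))).
Qed.

End OAEmbedding.

(** Continued by the identity, since relabellings act on all natural numbers while O(A)_n only has
    labels below n. *)
Definition perm_nat n (u : 'S_n) (i : nat) : nat :=
  if insub i is Some i' then val (u (i' : 'I_n)) else i.

Lemma perm_natE n (u : 'S_n) (i : 'I_n) : perm_nat u i = u i.
Proof. by rewrite /perm_nat valK. Qed.

Lemma pcross_lshift n m (u : 'S_n) (v : 'S_m) i :
  pcross u v (lshift m i) = lshift m (u i).
Proof. by rewrite permE /pcross_fun (unsplitK (inl i)). Qed.

Lemma pcross_rshift n m (u : 'S_n) (v : 'S_m) i :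
  pcross u v (rshift n i) = rshift n (v i).
Proof. by rewrite permE /pcross_fun (unsplitK (inr i)). Qed.

Lemma pcrossV n m (u : 'S_n) (v : 'S_m) :
  ((pcross u v)^-1 = pcross u^-1 v^-1)%g.
Proof.
apply/permP => i; apply: (@perm_inj _ (pcross u v)); rewrite permKV.
case: (splitP i) => j ij.
  have -> : i = lshift m j by apply: val_inj.
  by rewrite !pcross_lshift permKV.
have -> : i = rshift n j by apply: val_inj.
by rewrite !pcross_rshift permKV.
Qed.

Lemma pdel_lift n (u : 'S_n.+1) i : lift ord0 (pdel u i) =
  if u (lift ord0 i) == ord0 then u ord0 else u (lift ord0 i).
Proof.
rewrite permE /pdel_fun; case: unliftP => [j ->|ui].
  by rewrite eq_sym (negPf (neq_lift _ _)).
rewrite ui eqxx; case: unliftP => [j -> //|u0].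
by have := perm_inj (etrans ui (esym u0)).
Qed.

Lemma pdelV n (u : 'S_n.+1) : ((pdel u)^-1 = pdel u^-1)%g.
Proof.
apply/permP => j; apply: (@perm_inj _ (pdel u)); rewrite permKV.
apply: (@lift_inj _ ord0); rewrite pdel_lift pdel_lift.
case: (eqVneq ((u^-1)%g (lift ord0 j)) ord0) => [uj|uj].
  by rewrite permKV eqxx -[X in _ = u X]uj permKV.
by rewrite permKV eq_sym (negPf (neq_lift _ _)).
Qed.

Section Operations.
Variables (k : fieldType) (A : algType k) (S : strandAlg A).
Local Notation st := (strand S).
Local Notation ii := (@iota_SA k A S).
Local Notation OA := (OA A).
Local Notation OAn := (OAn A).
Local Notation embedO := (@embedO k A S).
Local Open Scope dcr_scope.

Definition shift (n : nat) : S -> S := relabel (addn n) (addn n).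

Lemma relabel_strand_val phi psi n (p : 'I_n -> stshape) t :
  relabel phi psi (strand_val S p t) =
  strand_val S (fun i => rlshape phi psi (p i)) t.
Proof.
move: t; apply: tens_ext => [c u v||a f]; last 2 first.
- exact: strand_val_linear.
- rewrite (congr1 _ (strand_valE S p a f)) strand_valE rmorphM /= relabel_iota.
  rewrite rmorph_prod; congr (_ * _); apply: eq_bigr => i _.
  exact: relabel_st.
by rewrite strand_val_linear relabel_linear.
Qed.

Lemma gtens_linear n (u : 'S_n) : linear (fun t : TA A n => gtens t u : OAn n).
Proof.
move=> c s t; apply/ffunP => v; rewrite !ffunE; case: ifP => _ //.
by rewrite scaler0 addr0.
Qed.

Lemma tens_embed_ext n (W : lmodType k) (F G : OAn n -> W) :
  linear F -> linear G -> (forall t u, F (gtens t u) = G (gtens t u)) ->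
  forall x, F x = G x.
Proof.
move=> Fl Gl E; elim/OAn_ind => [|c x y IHx IHy|a f u]; last exact: E.
  by rewrite !linear_0.
by rewrite Fl Gl IHx IHy.
Qed.

Lemma lactn_linear n (u : 'S_n) : linear (lactn u : OAn n -> OAn n).
Proof.
move=> c x y; rewrite /lactn scaler_sumr -big_split; apply: eq_bigr => v _ /=.
by rewrite !ffunE tact_linear gtens_linear.
Qed.

Lemma ractn_linear n (u : 'S_n) : linear (fun x : OAn n => ractn x u).
Proof.
move=> c x y; rewrite /ractn scaler_sumr -big_split; apply: eq_bigr => v _ /=.
by rewrite !ffunE gtens_linear.
Qed.

Lemma gtens0 n (u : 'S_n) : gtens (0 : TA A n) u = 0.
Proof. exact: linear_0 (gtens_linear u). Qed.

Lemma lactn_gtens n (u v : 'S_n) (t : TA A n) :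
  lactn u (gtens t v) = gtens (tact u t) (rlcomp u v).
Proof.
rewrite /lactn (bigD1 v) //= big1 => [|w /negPf wv].
  by rewrite addr0 ffunE eqxx.
by rewrite ffunE wv (linear_0 (tact_linear u)) gtens0.
Qed.

Lemma ractn_gtens n (u v : 'S_n) (t : TA A n) :
  ractn (gtens t v) u = gtens t (rlcomp v u).
Proof.
rewrite /ractn (bigD1 v) //= big1 => [|w /negPf wv].
  by rewrite addr0 ffunE eqxx.
by rewrite ffunE wv gtens0.
Qed.

Lemma embed_lactn n (u : 'S_n) x :
  embed S (lactn u x) = relabel (perm_nat u) id (embed S x).
Proof.
have el := @embed_linear k A S n; have ll := lactn_linear u.
move: x; apply: tens_embed_ext => [c x y|c x y|t v].
- by rewrite ll el.
- by rewrite el relabel_linear.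
rewrite lactn_gtens !embed_gtens strand_val_tact relabel_strand_val.
congr (strand_val S _ t); apply: funext => i.
by rewrite /perm_shape /rlcomp invMg permM permK /= perm_natE.
Qed.

Lemma embed_ractn n (u : 'S_n) x :
  embed S (ractn x u) = relabel id (perm_nat u^-1%g) (embed S x).
Proof.
have el := @embed_linear k A S n; have ll := ractn_linear u.
move: x; apply: tens_embed_ext => [c x y|c x y|t v].
- by rewrite ll el.
- by rewrite el relabel_linear.
rewrite ractn_gtens !embed_gtens relabel_strand_val.
congr (strand_val S _ t); apply: funext => i.
by rewrite /perm_shape /rlcomp invMg permM /= perm_natE.
Qed.

Lemma homog_lactO n (u : 'S_n) (x : OA) : homog (lactO u x) n.
Proof. exact: dinj_homog. Qed.
Lemma homog_ractO n (u : 'S_n) (x : OA) : homog (ractO x u) n.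
Proof. exact: dinj_homog. Qed.
Lemma homog_AdO n (u : 'S_n) (x : OA) : homog (AdO u x) n.
Proof. exact: dinj_homog. Qed.

Lemma embedO_lactO n (u : 'S_n) (x : OA) : homog x n ->
  embedO (lactO u x) = relabel (perm_nat u) id (embedO x).
Proof.
move: x; apply: homog_dinj => x; rewrite /lactO !embedO_dinj dinj_comp.
exact: embed_lactn.
Qed.

Lemma embedO_ractO n (u : 'S_n) (x : OA) : homog x n ->
  embedO (ractO x u) = relabel id (perm_nat u^-1%g) (embedO x).
Proof.
move: x; apply: homog_dinj => x; rewrite /ractO !embedO_dinj dinj_comp.
exact: embed_ractn.
Qed.

Lemma embedO_AdO n (u : 'S_n) (x : OA) : homog x n ->
  embedO (AdO u x) = relabel (perm_nat u) (perm_nat u) (embedO x).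
Proof.
move=> xn; rewrite embedO_ractO; last exact: homog_lactO.
by rewrite invgK embedO_lactO // relabel_comp.
Qed.

Lemma embedO_ogen n (a : n.-tuple A) f u :
  embedO (ogen a f u) = ii f * \prod_i st (perm_shape u i) (tnth a i).
Proof. by rewrite embedO_dinj embed_gtens strand_valE. Qed.

Lemma embedO_ogen_mul n m (a : n.-tuple A) f u (b : m.-tuple A) g v :
  embedO (ogen [tuple of a ++ b] (f * g) (pcross u v)) =
  embedO (ogen a f u) * shift n (embedO (ogen b g v)).
Proof.
rewrite !embedO_ogen /shift rmorphM /= relabel_iota rmorph_prod iotaM.
rewrite big_split_ord [LHS]mulrACA; congr (_ * _ * (_ * _)); apply: eq_bigr => i _.
  by rewrite /perm_shape pcrossV pcross_lshift tnth_lshift.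
by rewrite /perm_shape pcrossV pcross_rshift tnth_rshift /= relabel_st.
Qed.

Lemma linear_if (b : bool) (V W : lmodType k) (L : V -> W) :
  linear L -> linear (fun x => if b then L x else 0).
Proof. by move=> Ll c x y; case: b; rewrite ?Ll ?scaler0 ?addr0. Qed.

(** Seeing one degree at a time, it yields at once the degree and the value of products and of
    [opi], which [embedO] mixes. *)
Definition embed_at (n : nat) (x : OA) : S := embed S (dcomp x n).

Lemma embed_at_linear n : linear (embed_at n).
Proof. by move=> c x y; rewrite /embed_at (dcomp_linear n c) embed_linear. Qed.

Lemma embed_at_dinj n m (x : OAn m) :
  embed_at n (dinj x) = if n == m then embed S x else 0.
Proof.
rewrite /embed_at; have [->|nm] := eqVneq n m; first by rewrite dinj_comp.
by rewrite (@dinj_homog k OAn m x n nm) linear0.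
Qed.

Lemma embed_at_omul N n m (x : OAn n) (y : OAn m) :
  embed_at N (omul (dinj x) (dinj y)) =
  if N == (n + m)%N then embed S x * shift n (embed S y) else 0.
Proof.
rewrite /omul (linear_oext _ _ (embed_at_linear N)).
pose L n (x : OAn n) : S :=
  if N == (n + m)%N then embed S x * shift n (embed S y) else 0.
have Ll n' : linear (L n').
  apply: linear_if => c u v; rewrite embed_linear mulrDl scalerAl; reflexivity.
rewrite -[RHS](oext_dinj x Ll); congr (oext _ _).
apply: functional_extensionality_dep => n'; apply: funext => a; apply: funext => f.
apply: funext => u; rewrite (linear_oext _ _ (embed_at_linear N)).
pose L' m (y : OAn m) : S := if N == (n' + m)%N then
  embed S (gtens (a \ot f) u) * shift n' (embed S y) else 0.
have L'l m' : linear (L' m').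
  apply: linear_if => c v w; rewrite embed_linear /shift relabel_linear mulrDr scalerAr.
  reflexivity.
rewrite -[RHS](oext_dinj y L'l); congr (oext _ _).
apply: functional_extensionality_dep => m'; apply: funext => b; apply: funext => g.
apply: funext => v; rewrite /L' embed_at_dinj; case: ifP => // _.
have := embedO_ogen_mul a f u b g v; rewrite !embedO_dinj; apply.
Qed.

Lemma homog_embed_at n x : (forall N, N != n -> embed_at N x = 0) -> homog x n.
Proof.
move=> E N Nn; apply: (@embed_inj _ _ S N); rewrite linear0; exact: E.
Qed.

Lemma homog_omul n m (x y : OA) : homog x n -> homog y m -> homog (omul x y) (n + m).
Proof.
move=> /homogE -> /homogE ->; apply: homog_embed_at => N Nnm.
by rewrite embed_at_omul (negPf Nnm).
Qed.

Lemma embedO_at n x : homog x n -> embedO x = embed_at n x.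
Proof. by move=> /homogE xn; rewrite {1}xn embedO_dinj. Qed.

Lemma embedO_omul n m (x y : OA) : homog x n -> homog y m ->
  embedO (omul x y) = embedO x * shift n (embedO y).
Proof.
move=> xn yn; rewrite (embedO_at (homog_omul xn yn)).
by rewrite (homogE xn) (homogE yn) embed_at_omul eqxx !embedO_dinj.
Qed.

End Operations.

(** * The map pi as the contraction of label 0 *)

Section PartialTrace.
Variables (k : fieldType) (A : algType k) (S : strandAlg A).
Local Notation OA := (OA A).
Local Notation OAn := (OAn A).
Local Notation embedO := (@embedO k A S).
Local Notation embed_at := (@embed_at k A S).
Local Open Scope dcr_scope.

Definition unshift : S -> S := relabel predn predn.

(** On the image of [embed] no label 0 remains after the contraction, so [predn] only meets positive
    labels there. *)
Definition ptrace (x : S) : S := unshift (contract 0 x).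

Lemma ptrace_linear : linear ptrace.
Proof. by move=> c x y; rewrite /ptrace contract_linear /unshift relabel_linear. Qed.

Lemma pdelV_pred n (u : 'S_n.+1) (j : 'I_n) : val ((pdel u)^-1%g j) =
  (val (if (u^-1)%g (lift ord0 j) == ord0 then (u^-1)%g ord0
        else (u^-1)%g (lift ord0 j))).-1.
Proof. by rewrite -pdel_lift -pdelV. Qed.

(** The two cases of pi are the two kinds of contraction: if u fixes the first letter, the strand
    with output 0 closes to a loop; otherwise it is composed with the strand leaving input 0, and
    deleting the letter from u is the resulting connection. *)
Lemma ptrace_gen n (a : n.+1.-tuple A) f (u : 'S_n.+1) :
  embedO (opi_gen a f u) = ptrace (embed S (gtens (a \ot f) u)).
Proof.
rewrite embed_gtens strand_valE big_ord_recl /ptrace.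
have lift0 (j : 'I_n) : lift ord0 j != ord0 by rewrite eq_sym neq_lift.
rewrite /opi_gen; case: eqP => [u0|/eqP u0].
  have uV0 : (u^-1)%g ord0 = ord0 by rewrite -{1}u0 permK.
  rewrite {1}/perm_shape uV0 mulrCA contract_avoid; last first.
    apply: gen_byM; first by apply: gen_by_iota.
    apply: gen_by_prod => j; apply: gen_by_strand; split; first exact: lift0.
    rewrite /no_input /perm_shape /=.
    by rewrite -[X in _ != X]/(val (ord0 : 'I_n.+1)) val_eqE
      -[X in _ != X]uV0 (inj_eq perm_inj) lift0.
  rewrite contract_loop embedO_ogen iotaM iota_bar /unshift !rmorphM /= relabel_st.
  rewrite relabel_iota rmorph_prod -mulrA; congr (_ * (_ * _)).
  apply: eq_bigr => j _; rewrite tnth_mktuple /= relabel_st /perm_shape /=.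
  rewrite pdelV_pred; case: eqP => [uj|_ //].
  by have := lift0 j; rewrite -(permKV u (lift ord0 j)) uj u0 eqxx.
(* The strand leaving input 0 has output u(0), the letter k in the definition of pi; it receives the
   value a_1 a_k. *)
case: (unliftP ord0 (u ord0)) u0 => [j0 uj0|-> //] _.
have uVj0 : (u^-1)%g (lift ord0 j0) = ord0 by rewrite -uj0 permK.
have uVj j : ((u^-1)%g (lift ord0 j) == ord0) = (j == j0).
  by rewrite -[X in _ == X]uVj0 (inj_eq perm_inj) (inj_eq (@lift_inj _ ord0)).
have uV0 : (u^-1)%g ord0 != ord0.
  by apply/eqP => E; have := lift0 j0; rewrite -uj0 -{1}E permKV eqxx.
have E0 : perm_shape u ord0 = Some (0%N, val ((u^-1)%g ord0)) by [].
have Ej : perm_shape u (lift ord0 j0) = Some (val (lift ord0 j0), 0%N).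
  by rewrite /perm_shape uVj0.
rewrite embedO_ogen [in RHS](bigD1 j0) //= [in LHS](bigD1 j0) //= E0 Ej.
have AC (x y z w : S) : x * (y * (z * w)) = y * z * (x * w) by ring.
rewrite [X in contract 0 X]AC.
rewrite contract_avoid; last first.
  apply: gen_byM; first by apply: gen_by_iota.
  rewrite big_mkcond; apply: gen_by_prod => j; case: ifP => [jj0|_]; last exact: gen_by1.
  apply: gen_by_strand; split; first exact: lift0.
  rewrite /no_input /perm_shape /=.
  by rewrite -[X in _ != X]/(val (ord0 : 'I_n.+1)) val_eqE uVj jj0.
have lj0 : val (lift ord0 j0) != 0%N by exact: lift0.
have uq0 : val ((u^-1)%g ord0) != 0%N by exact: uV0.
rewrite contract_pair //.
rewrite /unshift !rmorphM /= relabel_st relabel_iota rmorph_prod /=.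
rewrite [RHS]mulrCA; congr (_ * (_ * _)).
  rewrite tnth_mktuple uj0 eqxx /perm_shape /= pdelV_pred uVj eqxx.
  reflexivity.
apply: eq_bigr => j /negPf jj0; rewrite tnth_mktuple uj0 (inj_eq (@lift_inj _ ord0)) jj0.
by rewrite relabel_st /perm_shape pdelV_pred uVj jj0.
Qed.

Lemma embed_at_opi N n (x : OAn n) : embed_at N (opi (dinj x)) =
  if N.+1 == n then ptrace (embed S x) else 0.
Proof.
rewrite /opi (linear_oext _ _ (@embed_at_linear _ _ S N)).
pose L n (x : OAn n) : S := if N.+1 == n then ptrace (embed S x) else 0.
have Ll n' : linear (L n').
  apply: linear_if => c u v; rewrite embed_linear ptrace_linear; reflexivity.
rewrite -[RHS](oext_dinj x Ll); congr (oext _ _).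
apply: functional_extensionality_dep => n'; apply: funext => a; apply: funext => f.
apply: funext => u; rewrite /L; case: n' a u => [|n'] a u.
  exact: linear_0 (@embed_at_linear _ _ S N).
rewrite -ptrace_gen eqSS /opi_gen; case: (u ord0 == ord0);
  by rewrite embed_at_dinj embedO_dinj.
Qed.

Lemma homog_opi n (x : OA) : homog x n.+1 -> homog (opi x) n.
Proof.
move=> /homogE ->; apply: (@homog_embed_at _ _ S) => N Nn.
by rewrite embed_at_opi eqSS (negPf Nn).
Qed.

Lemma embedO_opi n (x : OA) : homog x n.+1 -> embedO (opi x) = ptrace (embedO x).
Proof.
move=> xn; rewrite (embedO_at _ (homog_opi xn)) {1}(homogE xn) embed_at_opi eqxx.
by rewrite {2}(homogE xn) embedO_dinj.
Qed.

End PartialTrace.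

Section BlockPermutations.

(** [a] and [b] are the positions at which block i starts before and after the permutation; offsets
    inside the block are kept. *)
Lemma bperm_block r (s : 'S_r) (d : 'I_r -> nat) (i : 'I_r) a b o :
  (\sum_(l : 'I_r | (l < i)%N) d l)%N = a ->
  (\sum_(l : 'I_r | (s l < s i)%N) d l)%N = b -> (o < d i)%N ->
  perm_nat (bperm s d) (a + o) = (b + o)%N.
Proof.
move=> <- <- lt; rewrite -[o in LHS]/(val (Ordinal lt)) -tagnat.RankEsum.
rewrite perm_natE permE /= /bperm_nat; congr (_ + _)%N.
  by apply: eq_bigl => l; rewrite tagnat.Rank1K.
by rewrite tagnat.Rank2K.
Qed.

Lemma sum_ord2 (F : 'I_2 -> nat) : (\sum_i F i = F ord0 + F ord_max)%N.
Proof.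
rewrite !big_ord_recl big_ord0 addn0; congr (_ + F _)%N; exact: val_inj.
Qed.

Lemma sum_ord3 (F : 'I_3 -> nat) : (\sum_i F i = F l1 + F l2 + F l3)%N.
Proof.
rewrite !big_ord_recl big_ord0 addn0 addnA.
by congr (_ + F _ + F _)%N; apply: val_inj.
Qed.

Lemma bperm2_size n m : (\sum_(i < 2) tnth [tuple n; m] i = n + m)%N.
Proof. by rewrite sum_ord2. Qed.

Lemma bperm3_size n m p : (\sum_(i < 3) tnth [tuple n; m; p] i = n + m + p)%N.
Proof. by rewrite sum_ord3. Qed.

Variables n m p : nat.

Lemma bperm2_1 i : (i < n)%N -> perm_nat (bperm2 s12 n m) i = (m + i)%N.
Proof.
apply: (@bperm_block 2 s12 (tnth [tuple n; m]) ord0 0 m).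
  by rewrite big_mkcond sum_ord2.
by rewrite big_mkcond sum_ord2 tpermL tpermR.
Qed.

Lemma bperm2_2 i : (i < m)%N -> perm_nat (bperm2 s12 n m) (n + i) = i.
Proof.
apply: (@bperm_block 2 s12 (tnth [tuple n; m]) ord_max n 0).
  by rewrite big_mkcond sum_ord2 /= addn0.
by rewrite big_mkcond sum_ord2 tpermL tpermR.
Qed.

Lemma bperm3_1 (s : 'S_3) i : (i < n)%N -> perm_nat (bperm3 s n m p) i =
  ((if s l2 < s l1 then m else 0) + (if s l3 < s l1 then p else 0) + i)%N.
Proof.
apply: (@bperm_block 3 s (tnth [tuple n; m; p]) l1 0).
  by rewrite big_mkcond sum_ord3.
by rewrite big_mkcond sum_ord3 ltnn.
Qed.

Lemma bperm3_2 (s : 'S_3) i : (i < m)%N -> perm_nat (bperm3 s n m p) (n + i) =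
  ((if s l1 < s l2 then n else 0) + (if s l3 < s l2 then p else 0) + i)%N.
Proof.
apply: (@bperm_block 3 s (tnth [tuple n; m; p]) l2 n).
  by rewrite big_mkcond sum_ord3 /= !addn0.
by rewrite big_mkcond sum_ord3 ltnn addn0.
Qed.

Lemma bperm3_3 (s : 'S_3) i : (i < p)%N -> perm_nat (bperm3 s n m p) (n + m + i) =
  ((if s l1 < s l3 then n else 0) + (if s l2 < s l3 then m else 0) + i)%N.
Proof.
apply: (@bperm_block 3 s (tnth [tuple n; m; p]) l3 (n + m)).
  by rewrite big_mkcond sum_ord3 /= !addn0.
by rewrite big_mkcond sum_ord3 ltnn addn0.
Qed.

End BlockPermutations.

(** * The bracket on O(A) *)

(** All axioms except the Jacobi identity. They suffice to recover a bracket from its restriction,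
    so that a given di-twisted bracket can be identified with the one built on S before the coupling
    conditions are known. *)
Record twisted_biderivation (k : fieldType) (A : algType k)
    (B : OA A -> OA A -> OA A) : Prop := TwistedBiderivation {
  tb_bilinear : bilinear_for *:%R *:%R B;
  tb_homog : forall n m (x y : OA A), homog x n -> homog y m ->
    homog (B x y) (n + m);
  tb_bimod : forall n m (x y : OA A) (u u' : 'S_n) (v v' : 'S_m),
    homog x n -> homog y m ->
    B (ractO (lactO u x) u') (ractO (lactO v y) v') =
    ractO (lactO (pcross u v) (B x y)) (pcross u' v');
  tb_pi : forall n m (x y : OA A), (0 < n)%N -> homog x n -> homog y m ->
    B (opi x) y = opi (B x y);
  tb_skew : forall n m (x y : OA A), homog x n -> homog y m ->
    B y x = - AdO (bperm2 s12 n m) (B x y);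
  tb_leibnizr : forall n m p (x y z : OA A),
    homog x n -> homog y m -> homog z p ->
    B x (omul y z) =
    omul (B x y) z + AdO (bperm3 p12 m n p) (omul y (B x z));
  tb_leibnizl : forall n m p (x y z : OA A),
    homog x n -> homog y m -> homog z p ->
    B (omul x y) z =
    AdO (bperm3 p23 n p m) (omul (B x z) y) + omul x (B y z)
}.

Lemma ditwisted_tb (k : fieldType) (A : algType k) (B : OA A -> OA A -> OA A) :
  ditwisted B -> twisted_biderivation B.
Proof. by case. Qed.

Section HomogeneousLinear.
Variables (k : fieldType) (V : nat -> lmodType k).
Lemma homogD n (x y : dsum V) : homog x n -> homog y n -> homog (x + y) n.
Proof.
move=> xn yn m mn.
by rewrite -[x]scale1r (dcomp_linear m 1) xn // yn // scaler0 addr0.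
Qed.
Lemma homogN n (x : dsum V) : homog x n -> homog (- x) n.
Proof.
move=> xn m mn; rewrite -scaleN1r -[_ *: x]addr0 (dcomp_linear m (-1)) xn //.
by rewrite scaler0 add0r; exact: linear_0 (dcomp_linear m).
Qed.
Lemma homogZ n c (x : dsum V) : homog x n -> homog (c *: x) n.
Proof.
move=> xn m mn; rewrite -[_ *: x]addr0 (dcomp_linear m c) xn //.
by rewrite scaler0 add0r; exact: linear_0 (dcomp_linear m).
Qed.
Lemma homog0 n : homog (0 : dsum V) n.
Proof. by move=> m _; exact: linear_0 (dcomp_linear m). Qed.
Lemma dlift_combine (W : lmodType k) (h1 h2 h3 : forall n, V n -> W) c x :
  (forall n y, h3 n y = c *: h1 n y + h2 n y) ->
  dlift h3 x = c *: dlift h1 x + dlift h2 x.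
Proof.
by move=> E; rewrite /dlift scaler_sumr -big_split; apply: eq_bigr => n _ /=.
Qed.
End HomogeneousLinear.

Section BracketOA.
Variables (k : fieldType) (A : algType k) (S : strandAlg A).
Variables De Ds : bracket A.
Hypotheses (DeP : right_double_bracket De) (DsP : double_bracket Ds).
Local Notation OA := (OA A).
Local Notation OAn := (OAn A).
Local Notation embedO := (@embedO k A S).
Local Notation br := (@br k A S De Ds).
Let bl := @br_linearl k A S De Ds DeP DsP.
Let rl := @br_linearr k A S De Ds DeP DsP.

Lemma shift_linear n : linear (@shift k A S n).
Proof. exact: relabel_linear. Qed.

(** The labels of x are 0, ..., n - 1, those of the shifted y are n, ..., n + m - 1, and the bracket
    keeps them all. *)
Lemma br_embed n m (x : OAn n) (y : OAn m) :
  exists z : OAn (n + m), br (embed S x) (shift n (embed S y)) = embed S z.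
Proof.
apply: weight_embed; rewrite iotaD add0n.
have -> : iota n m = map (addn n) (iota 0 m) by rewrite -iotaDl addn0.
apply: weight_br => //; first exact: embed_weight.
exact/weight_relabel/embed_weight.
Qed.

(** The preimage is unique by [embed_inj], from which bilinearity follows. *)
Definition bcomp n m (x : OAn n) (y : OAn m) : OAn (n + m) :=
  projT1 (cid (br_embed x y)).

Lemma bcompE n m (x : OAn n) (y : OAn m) :
  embed S (bcomp x y) = br (embed S x) (shift n (embed S y)).
Proof. by rewrite /bcomp; case: cid. Qed.

Lemma bcomp_linearl n m (y : OAn m) : linear (fun x : OAn n => bcomp x y).
Proof.
move=> c x x'; apply: (@embed_inj _ _ S).
by rewrite embed_linear !bcompE embed_linear bl.
Qed.

Lemma bcomp_linearr n m (x : OAn n) : linear (fun y : OAn m => bcomp x y).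
Proof.
move=> c y y'; apply: (@embed_inj _ _ S).
by rewrite embed_linear !bcompE embed_linear shift_linear rl.
Qed.

Definition bracketO (x y : OA) : OA :=
  dlift (V := OAn) (fun n x => dlift (V := OAn) (fun m y => dinj (bcomp x y)) y) x.

Let dinjl n := @dinj_linear k OAn n.

Lemma bracketO_inner n (x : OAn n) :
  forall m, linear (fun y : OAn m => dinj (V := OAn) (bcomp x y)).
Proof. by move=> m c y y'; rewrite bcomp_linearr dinjl. Qed.

Lemma bracketO_outer y : forall n, linear (fun x : OAn n =>
  dlift (V := OAn) (fun m y => dinj (V := OAn) (bcomp x y)) y).
Proof.
move=> n c x x'; apply: dlift_combine => m z.
by rewrite bcomp_linearl dinjl.
Qed.

Lemma bracketO_bilinear : bilinear_for *:%R *:%R bracketO.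
Proof.
split=> [y|x] c u v; first exact: dlift_linear (bracketO_outer y) c u v.
apply: dlift_combine => n x'; exact: dlift_linear (bracketO_inner x') c u v.
Qed.

Lemma bracketO_dinj n m (x : OAn n) (y : OAn m) :
  bracketO (dinj x) (dinj y) = dinj (bcomp x y).
Proof.
rewrite /bracketO (dliftE (bracketO_outer _)); exact: dliftE (bracketO_inner x) _ _.
Qed.

Lemma homog_bracketO n m x y :
  homog x n -> homog y m -> homog (bracketO x y) (n + m).
Proof.
by move=> /homogE -> /homogE ->; rewrite bracketO_dinj; exact: dinj_homog.
Qed.

Lemma embedO_bracketO n m x y : homog x n -> homog y m ->
  embedO (bracketO x y) = br (embedO x) (shift n (embedO y)).
Proof.
by move=> /homogE -> /homogE ->; rewrite bracketO_dinj !embedO_dinj bcompE.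
Qed.

Lemma eq_relabel_homog n (x : OA) phi psi phi' psi' : homog x n ->
  (forall i, (i < n)%N -> phi i = phi' i) ->
  (forall i, (i < n)%N -> psi i = psi' i) ->
  relabel phi psi (embedO x) = relabel phi' psi' (embedO x).
Proof.
move=> /homogE -> Ep Eq; rewrite embedO_dinj.
apply: eq_relabel (embed_gen_by S _) => -[[i j]|] //= /andP[lt_i lt_j].
by rewrite Ep // Eq.
Qed.

Lemma relabel_homog_id n (x : OA) phi psi : homog x n ->
  (forall i, (i < n)%N -> phi i = i) -> (forall i, (i < n)%N -> psi i = i) ->
  relabel phi psi (embedO x) = embedO x.
Proof.
move=> xn Ep Eq; rewrite -[RHS]relabel_id; exact: eq_relabel_homog xn Ep Eq.
Qed.

Lemma relabel_shift n m (x : OA) phi psi phi' psi' : homog x m ->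
  (forall i, (i < m)%N -> phi (n + i)%N = phi' i) ->
  (forall i, (i < m)%N -> psi (n + i)%N = psi' i) ->
  relabel phi psi (shift n (embedO x)) = relabel phi' psi' (embedO x).
Proof. by move=> xm Ep Eq; rewrite relabel_comp; exact: eq_relabel_homog xm _ _. Qed.

Lemma shift_shift n m (x : S) : shift n (shift m x) = shift (n + m) x.
Proof.
rewrite /shift relabel_comp; congr (relabel _ _ x);
  by apply: funext => i /=; rewrite addnA.
Qed.

Lemma shift_br n x y : shift n (br x y) = br (shift n x) (shift n y).
Proof. exact: relabel_br. Qed.

Lemma perm_nat_cross_l n m (u : 'S_n) (v : 'S_m) i : (i < n)%N ->
  perm_nat (pcross u v) i = perm_nat u i.
Proof.
move=> lt; rewrite -[i in LHS]/(val (lshift m (Ordinal lt))) perm_natE.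
by rewrite pcross_lshift -[i]/(val (Ordinal lt)) perm_natE.
Qed.

Lemma perm_nat_cross_r n m (u : 'S_n) (v : 'S_m) i : (i < m)%N ->
  perm_nat (pcross u v) (n + i) = (n + perm_nat v i)%N.
Proof.
move=> lt; rewrite -[(n + i)%N]/(val (rshift n (Ordinal lt))) perm_natE.
by rewrite pcross_rshift -[i]/(val (Ordinal lt)) perm_natE.
Qed.

End BracketOA.

(** * The axioms for the induced bracket *)

Section BracketAxioms.
Variables (k : fieldType) (A : algType k) (S : strandAlg A).
Variables De Ds : bracket A.
Hypotheses (DeP : right_double_bracket De) (DsP : double_bracket Ds).
Local Notation OA := (OA A).
Local Notation embedO := (@embedO k A S).
Local Notation br := (@br k A S De Ds).
Local Notation B := (bracketO S DeP DsP).

Lemma gen_by_relabel (P Q : stshape -> Prop) phi psi (x : S) :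
  (forall s, P s -> Q (rlshape phi psi s)) -> gen_by P x ->
  gen_by Q (relabel phi psi x).
Proof.
move=> PQ; elim=> [|c u v _ IHu _ IHv||s a u Ps _ IH].
- by rewrite (linear_0 (relabel_linear _ _)); exact: gen_by0.
- by rewrite relabel_linear; exact: gen_byD.
- by rewrite rmorph1; exact: gen_by1.
- by rewrite rmorphM /= relabel_st; apply: gen_by_st => //; exact: PQ.
Qed.

Lemma shiftM n (x y : S) : shift n (x * y) = shift n x * shift n y.
Proof. exact: rmorphM. Qed.

Lemma shift_st n s a :
  shift n (strand S s a) = strand S (rlshape (addn n) (addn n) s) a.
Proof. exact: relabel_st. Qed.

Lemma bracketO_bimod n m (x y : OA) (u u' : 'S_n) (v v' : 'S_m) :
  homog x n -> homog y m ->
  B (ractO (lactO u x) u') (ractO (lactO v y) v') =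
  ractO (lactO (pcross u v) (B x y)) (pcross u' v').
Proof.
move=> xn ym; have Bh := homog_bracketO S DeP DsP xn ym.
have hl j (w w' : 'S_j) (z : OA) : homog (ractO (lactO w z) w') j.
  exact: homog_ractO.
have El j (w w' : 'S_j) (z : OA) : homog z j -> embedO (ractO (lactO w z) w') =
    relabel (perm_nat w) (perm_nat w'^-1%g) (embedO z).
  move=> zj; rewrite (embedO_ractO S w' (homog_lactO w z)).
  by rewrite (embedO_lactO S w zj) relabel_comp.
apply: (@embedO_inj k A S (n + m)).
- exact: homog_bracketO.
- exact: hl.
rewrite (embedO_bracketO S DeP DsP (hl _ u u' x) (hl _ v v' y)).
rewrite (El _ u u' _ xn) (El _ v v' _ ym) (El _ _ _ _ Bh).
rewrite (embedO_bracketO S DeP DsP xn ym) (relabel_br DeP DsP) pcrossV.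
congr (br _ _).
  apply: (eq_relabel_homog S xn) => i lt_i; rewrite perm_nat_cross_l //.
apply: etrans (relabel_comp _ _ _ _ _) _; apply: esym.
apply: (relabel_shift S ym) => i lt_i /=; exact: perm_nat_cross_r.
Qed.

Lemma bracketO_pi n m (x y : OA) : (0 < n)%N -> homog x n -> homog y m ->
  B (opi x) y = opi (B x y).
Proof.
case: n => // n _ xn ym; have Bh := homog_bracketO S DeP DsP xn ym.
have px := homog_opi S xn.
apply: (@embedO_inj k A S (n + m)).
- exact: homog_bracketO.
- exact: (homog_opi S Bh).
rewrite (embedO_bracketO S DeP DsP px ym) (embedO_opi S xn).
rewrite (embedO_opi S (n := n + m) Bh) (embedO_bracketO S DeP DsP xn ym).
rewrite /ptrace (contract_br DeP DsP); last first.
  (* Shifted by n + 1, all labels of y are positive, hence distinct from the contracted label 0. *)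
  by apply: gen_by_relabel (gen_by_all _) => -[[i j]|] _; split.
rewrite /unshift (relabel_br DeP DsP); congr (br _ _); apply: esym.
by apply: (@relabel_shift _ _ S n.+1 m) => //.
Qed.

Lemma bracketO_skew n m (x y : OA) : homog x n -> homog y m ->
  B y x = - AdO (bperm2 s12 n m) (B x y).
Proof.
move=> xn ym; have Bh := homog_bracketO S DeP DsP xn ym.
have Bh' := homog_bracketO S DeP DsP ym xn.
have Bs : homog (B x y) (\sum_(i < 2) tnth [tuple n; m] i).
  by rewrite bperm2_size.
apply: (@embedO_inj k A S (m + n)).
- exact: Bh'.
- rewrite addnC -bperm2_size; apply: homogN; exact: homog_AdO.
rewrite (linear_N _ (embedO_linear S)) (embedO_AdO S _ Bs).
rewrite (embedO_bracketO S DeP DsP xn ym) (embedO_bracketO S DeP DsP ym xn).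
rewrite (relabel_br DeP DsP) -(brC DeP DsP); congr (br _ _).
  rewrite -[LHS]relabel_id; apply: esym.
  by apply: (relabel_shift S ym) => i lt_i; rewrite bperm2_2.
apply: esym; apply: (eq_relabel_homog S xn) => i lt_i; exact: bperm2_1.
Qed.

(** In S this is the Leibniz rule for [br]. The block permutation restores the labels: in the
    product of y with {x, z} the labels of y come first, whereas in {x, y z} those of x do. *)
Lemma bracketO_leibnizr n m p (x y z : OA) :
  homog x n -> homog y m -> homog z p ->
  B x (omul y z) =
  omul (B x y) z + AdO (bperm3 p12 m n p) (omul y (B x z)).
Proof.
move=> xn ym zp; have Bxy := homog_bracketO S DeP DsP xn ym.
have Bxz := homog_bracketO S DeP DsP xn zp.
have yz := homog_omul S ym zp; have yBxz := homog_omul S ym Bxz.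
have yBs : homog (omul y (B x z)) (\sum_(i < 3) tnth [tuple m; n; p] i).
  by rewrite bperm3_size -addnA.
apply: (@embedO_inj k A S (n + (m + p))).
- exact: homog_bracketO.
- apply: homogD; first by rewrite addnA; apply: (homog_omul S).
  rewrite addnA [(n + m)%N]addnC -bperm3_size; exact: homog_AdO.
rewrite (linear_D _ _ (embedO_linear S)) (embedO_AdO S _ yBs).
rewrite (embedO_bracketO S DeP DsP xn yz) (embedO_omul S ym zp).
rewrite (embedO_omul S Bxy zp) (embedO_omul S ym Bxz).
rewrite (embedO_bracketO S DeP DsP xn ym) (embedO_bracketO S DeP DsP xn zp).
rewrite shiftM shift_shift (br_mulr DeP DsP); congr (_ + _).
set s := perm_nat _; apply: esym; apply: etrans (rmorphM (relabel s s) _ _) _.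
rewrite (shift_br DeP DsP) shift_shift /= (relabel_br DeP DsP).
congr (_ * br _ _).
- by apply: (eq_relabel_homog S ym) => i lt_i; rewrite /s bperm3_1 // !perm3E /= ?addn0.
- rewrite -[RHS]relabel_id.
  by apply: (relabel_shift S xn) => i lt_i; rewrite /s bperm3_2 // !perm3E /= ?addn0.
by apply: (relabel_shift S zp) => i lt_i; rewrite /s bperm3_3 // !perm3E
    /= ?addn0 ?add0n [(m + n)%N]addnC.
Qed.

Lemma bracketO_leibnizl n m p (x y z : OA) :
  homog x n -> homog y m -> homog z p ->
  B (omul x y) z =
  AdO (bperm3 p23 n p m) (omul (B x z) y) + omul x (B y z).
Proof.
move=> xn ym zp; have Byz := homog_bracketO S DeP DsP ym zp.
have Bxz := homog_bracketO S DeP DsP xn zp.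
have xy := homog_omul S xn ym; have Bxzy := homog_omul S Bxz ym.
have Bs : homog (omul (B x z) y) (\sum_(i < 3) tnth [tuple n; p; m] i).
  by rewrite bperm3_size.
apply: (@embedO_inj k A S (n + m + p)).
- exact: homog_bracketO.
- apply: homogD; last by rewrite -addnA; apply: (homog_omul S).
  rewrite addnAC -bperm3_size; exact: homog_AdO.
rewrite (linear_D _ _ (embedO_linear S)) (embedO_AdO S _ Bs).
rewrite (embedO_bracketO S DeP DsP xy zp) (embedO_omul S xn ym).
rewrite (embedO_omul S Bxz ym) (embedO_omul S xn Byz).
rewrite (embedO_bracketO S DeP DsP xn zp) (embedO_bracketO S DeP DsP ym zp).
rewrite (shift_br DeP DsP) shift_shift (br_mull DeP DsP); congr (_ + _).
set s := perm_nat _; apply: esym; apply: etrans (rmorphM (relabel s s) _ _) _.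
rewrite /= (relabel_br DeP DsP); congr (br _ _ * _).
- rewrite -[RHS]relabel_id.
  by apply: (eq_relabel_homog S xn) => i lt_i; rewrite /s bperm3_1 // !perm3E /= ?addn0.
- by apply: (relabel_shift S zp) => i lt_i; rewrite /s bperm3_2 // !perm3E /= ?addn0.
by apply: (relabel_shift S ym) => i lt_i; rewrite /s bperm3_3 // !perm3E /= ?addn0.
Qed.

Lemma bracketO_twisted : twisted_biderivation B.
Proof.
split; [exact: bracketO_bilinear|exact: homog_bracketO|exact: bracketO_bimod|
  exact: bracketO_pi|exact: bracketO_skew|exact: bracketO_leibnizr|
  exact: bracketO_leibnizl].
Qed.

(** The two block permutations bring the labels of all three summands to the common order x, y, z,
    so that the twisted sum becomes the plain Jacobiator. *)
Lemma embedO_jacobi n m p (x y z : OA) :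
  homog x n -> homog y m -> homog z p ->
  embedO (B x (B y z) + AdO (bperm3 p123 m p n) (B y (B z x))
    + AdO (bperm3 p132 p n m) (B z (B x y))) =
  jac De Ds (embedO x) (shift n (embedO y)) (shift (n + m) (embedO z)).
Proof.
move=> xn ym zp; have Bh := homog_bracketO S DeP DsP.
have Byz := Bh _ _ _ _ ym zp; have Bzx := Bh _ _ _ _ zp xn.
have Bxy := Bh _ _ _ _ xn ym.
have Bs2 : homog (B y (B z x)) (\sum_(i < 3) tnth [tuple m; p; n] i).
  by rewrite bperm3_size -addnA; apply: Bh.
have Bs3 : homog (B z (B x y)) (\sum_(i < 3) tnth [tuple p; n; m] i).
  by rewrite bperm3_size -addnA; apply: Bh.
rewrite !(linear_D _ _ (embedO_linear S)) (embedO_AdO S _ Bs2) (embedO_AdO S _ Bs3).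
have Eb := embedO_bracketO S DeP DsP.
rewrite (Eb _ _ _ _ xn Byz) (Eb _ _ _ _ ym Bzx) (Eb _ _ _ _ zp Bxy).
rewrite (Eb _ _ _ _ ym zp) (Eb _ _ _ _ zp xn) (Eb _ _ _ _ xn ym).
rewrite /jac !(shift_br DeP DsP) !shift_shift !(relabel_br DeP DsP).
congr (_ + br _ (br _ _) + br _ (br _ _)).
- by apply: (eq_relabel_homog S ym) => i lt_i; rewrite bperm3_1 // !perm3E /= ?addn0.
- by apply: (relabel_shift S zp) => i lt_i; rewrite bperm3_2 // !perm3E
    /= ?addn0 ?add0n [(m + n)%N]addnC.
- rewrite -[RHS]relabel_id.
  by apply: (relabel_shift S xn) => i lt_i; rewrite bperm3_3 // !perm3E /= ?addn0.
- by apply: (eq_relabel_homog S zp) => i lt_i; rewrite bperm3_1 // !perm3E /= ?addn0.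
- rewrite -[RHS]relabel_id.
  by apply: (relabel_shift S xn) => i lt_i; rewrite bperm3_2 // !perm3E /= ?addn0.
by apply: (relabel_shift S ym) => i lt_i; rewrite bperm3_3 // !perm3E /= ?addn0.
Qed.

Lemma embedO_iota a : embedO (oiota a) = strand S (Some (0, 0)%N) a.
Proof.
rewrite embedO_ogen iota1 mul1r big_ord_recl big_ord0 mulr1.
by rewrite /perm_shape invg1 perm1.
Qed.

Lemma homog_iota (a : A) : homog (oiota a) 1.
Proof. exact: dinj_homog. Qed.

Lemma bracketO_jacobi :
  (forall n m p (x y z : OA), homog x n -> homog y m -> homog z p ->
   B x (B y z) + AdO (bperm3 p123 m p n) (B y (B z x))
    + AdO (bperm3 p132 p n m) (B z (B x y)) = 0)
  <-> [/\ coupled1 De Ds, coupled2 De Ds & coupled3 Ds].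
Proof.
rewrite -(jac_iff_coupled S DeP DsP); split=> [J|J n m p x y z xn ym zp].
  apply: jac_strands => // a b c.
  have K x y z X Y Z : homog x 1 -> homog y 1 -> homog z 1 -> embedO x = X ->
      embedO y = Y -> embedO z = Z -> jac De Ds X (shift 1 Y) (shift 2 Z) = 0.
    move=> xn yn zn <- <- <-; apply: etrans (esym (embedO_jacobi xn yn zn)) _.
    by rewrite J // (linear_0 (embedO_linear S)).
  have := K _ _ _ _ _ _ (homog_iota a) (homog_iota b) (homog_iota c)
    (embedO_iota a) (embedO_iota b) (embedO_iota c).
  by rewrite (shift_st 1 _ b) (shift_st 2 _ c).
apply: (@embedO_inj k A S (n + m + p)).
- have Bh := homog_bracketO S DeP DsP.
  apply: homogD; first apply: homogD.
  + by rewrite -addnA; apply: (Bh) => //; apply: Bh.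
  + by rewrite -addnA addnC -bperm3_size; exact: homog_AdO.
  by rewrite addnC addnA -bperm3_size; exact: homog_AdO.
- exact: homog0.
by rewrite embedO_jacobi // J (linear_0 (embedO_linear S)).
Qed.

Lemma embed_gtens_id (w : TA A 2) :
  embed S (gtens w 1%g) = eval2 S (Some (0, 0)%N) (Some (1, 1)%N) w.
Proof.
rewrite embed_gtens; move: w; apply: tens2_ext => [||x y f].
- exact: strand_val_linear.
- exact: eval2_linear.
rewrite (congr1 _ (strand_valE S _ _ f)) eval2E big_ord_recl big_ord1 mulrC.
by rewrite /perm_shape invg1 !perm1.
Qed.

Lemma embed_gtens_s12 (w : TA A 2) :
  embed S (gtens w s12) = eval_swap S (Some (0, 0)%N) (Some (1, 1)%N) w.
Proof.
rewrite embed_gtens; move: w; apply: tens2_ext => [||x y f].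
- exact: strand_val_linear.
- exact: eval_swap_linear.
rewrite (congr1 _ (strand_valE S _ _ f)) eval_swapE big_ord_recl big_ord1 mulrC.
rewrite /perm_shape tpermV tpermL.
have -> : s12 (lift ord0 ord0) = ord0.
  by rewrite -[RHS](tpermR _ ord_max); congr (s12 _); apply: val_inj.
reflexivity.
Qed.

Lemma restriction_bracketO : restriction B = (De, Ds).
Proof.
have K x y X Y : homog x 1 -> homog y 1 -> embedO x = X -> embedO y = Y ->
    embed S (dcomp (B x y) 2) = br X (shift 1 Y).
  move=> xn yn <- <-; have Bh := homog_bracketO S DeP DsP xn yn.
  rewrite -(embedO_bracketO S DeP DsP xn yn); apply: esym; exact: embedO_at.
have E a b : dcomp (B (oiota a) (oiota b)) 2 =
    gtens (De a b) 1%g + gtens (Ds a b) s12 :> OAn A 2.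
  apply: (@embed_inj k A S).
  apply: etrans (K _ _ _ _ (homog_iota a) (homog_iota b)
    (embedO_iota a) (embedO_iota b)) _.
  rewrite (shift_st 1 _ b) (br_st S DeP DsP) /gen_bracket.
  apply: esym; apply: etrans (linear_D _ _ (@embed_linear k A S 2)) _.
  by apply: congr2; [exact: embed_gtens_id | exact: embed_gtens_s12].
have s1 : (s12 == 1%g) = false.
  by apply/negbTE/eqP => /permP/(_ ord0); rewrite tpermL perm1.
rewrite /restriction; congr pair; apply: funext => a; apply: funext => b;
  rewrite E !ffunE eqxx.
  by rewrite eq_sym s1 addr0.
by rewrite s1 add0r.
Qed.
End BracketAxioms.

(** * Restriction to A *)

Section Generation.
Variables (k : fieldType) (A : algType k) (S : strandAlg A).
Local Notation OA := (OA A).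
Local Notation OAn := (OAn A).
Local Notation embedO := (@embedO k A S).

Definition oone : OA := ogen [tuple] 1 1%g.

Lemma homog_one : homog oone 0.
Proof. exact: dinj_homog. Qed.

Lemma embedO_one : embedO oone = 1.
Proof. by rewrite embedO_ogen big_ord0 iota1 mulr1. Qed.

Lemma homog_ogen n (a : n.-tuple A) f u : homog (ogen a f u) n.
Proof. exact: dinj_homog. Qed.

Lemma ogen_linear n (a : n.-tuple A) u : linear (fun f => ogen a f u).
Proof.
have [_ tr] := tpure_multilinear A (SA A) n.
by move=> c f g; rewrite /ogen tr gtens_linear (@dinj_linear k OAn n).
Qed.

Lemma ogen_ract n (a : n.-tuple A) f u : ogen a f u = ractO (ogen a f 1%g) u.
Proof.
apply: (@embedO_inj k A S n); [exact: homog_ogen|exact: homog_ractO|].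
rewrite (embedO_ractO S u (homog_ogen a f 1%g)) !embedO_ogen.
rewrite rmorphM /= relabel_iota rmorph_prod; congr (_ * _).
apply: eq_bigr => i _; rewrite /perm_shape /= relabel_st invg1 perm1 /=.
by rewrite perm_natE.
Qed.

Lemma ogen_bar n (a : n.-tuple A) b f :
  ogen a (bar b * f) 1%g = omul (opi (oiota b)) (ogen a f 1%g).
Proof.
have hb := homog_iota b; have hp := homog_opi S hb; have ha := homog_ogen a f 1%g.
apply: (@embedO_inj k A S n).
- exact: homog_ogen.
- exact: (homog_omul S hp ha).
have Eb : embedO (opi (oiota b)) = strand S None b.
  apply: etrans (embedO_opi S hb) _; rewrite embedO_iota /ptrace contract_loop.
  exact: relabel_st.
apply: etrans (embedO_ogen S _ _ _) _.
apply: esym; apply: etrans (embedO_omul S hp ha) _.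
rewrite Eb (embedO_ogen S a f) iota_barM -mulrA.
congr (_ * _); exact: relabel_id.
Qed.

Lemma ogen_cons n (a : n.+1.-tuple A) :
  ogen a 1 1%g = omul (oiota (thead a)) (ogen [tuple of behead a] 1 1%g).
Proof.
have hb := homog_iota (thead a); have ha := homog_ogen [tuple of behead a] 1 1%g.
apply: (@embedO_inj k A S n.+1).
- exact: homog_ogen.
- exact: (homog_omul S hb ha).
have Eb := embedO_iota S (thead a).
apply: etrans (embedO_ogen S _ _ _) _.
apply: esym; apply: etrans (embedO_omul S hb ha) _; apply: esym.
rewrite Eb (embedO_ogen S [tuple of behead a]) iota1 !mul1r.
have shift_prod I (r : seq I) (F : I -> S) :
  shift 1 (\prod_(i <- r) F i) = \prod_(i <- r) shift 1 (F i) by exact: rmorph_prod.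
rewrite big_ord_recl shift_prod.
congr (_ * _); first by rewrite /perm_shape invg1 perm1.
apply: eq_bigr => i _; rewrite shift_st tnth_behead /perm_shape !invg1 !perm1.
apply: congr2; first reflexivity.
congr (tnth a _); apply: val_inj; rewrite /= inordK //; exact: ltn_ord.
Qed.

(** A pure tensor is the product of elements pi(b), one for each factor of f, and of the letters
    a_1, ..., a_n, acted upon by u from the right. *)
Lemma OA_gen (P : nat -> OA -> Prop) :
  (forall n, P n 0) ->
  (forall n c x y, homog x n -> homog y n -> P n x -> P n y -> P n (c *: x + y)) ->
  P 0%N oone -> (forall a, P 1%N (oiota a)) ->
  (forall n m x y, homog x n -> homog y m -> P n x -> P m y ->
     P (n + m)%N (omul x y)) ->
  (forall n x, homog x n.+1 -> P n.+1 x -> P n (opi x)) ->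
  (forall n x (u : 'S_n), homog x n -> P n x -> P n (ractO x u)) ->
  forall n x, homog x n -> P n x.
Proof.
move=> P0 Pl P1 Pi PM Pp Pr n x /homogE ->; move: (dcomp x n) => {x}.
have dl := @dinj_linear k OAn n.
elim/OAn_ind => [|c x y Px Py|a f u].
- by rewrite (linear_0 dl).
- by rewrite dl; apply: Pl => //; exact: dinj_homog.
rewrite -/(ogen a f u) ogen_ract; apply: Pr; first exact: homog_ogen.
have ol := ogen_linear a 1%g.
elim/SA_ind: f => [|c f g Pf Pg||b f Pf].
- by rewrite (linear_0 ol).
- by rewrite ol; apply: Pl => //; exact: homog_ogen.
- elim: n a {dl u ol} => [|n IH] a; first by rewrite (tuple0 a).
  rewrite ogen_cons; apply: (PM 1%N n) => //; first exact: homog_iota.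
  exact: homog_ogen.
rewrite ogen_bar; apply: (PM 0%N n) => //.
- apply: (homog_opi S); exact: homog_iota.
- exact: homog_ogen.
by apply: Pp => //; exact: homog_iota.
Qed.

Lemma dlift_dinj (x : OA) : dlift (fun n => @dinj k OAn n) x = x.
Proof.
have dl n : linear (@dinj k OAn n) by exact: dinj_linear.
apply: dsumP => m; apply: etrans (dlift_bigsum _ _ (@dcomp_linear k OAn m)) _.
have hl n : linear (fun y : OAn n => dcomp (dinj (V := OAn) y) m).
  by move=> c y z; rewrite dl (dcomp_linear m c).
have [N xN] := dcompP x.
rewrite (dliftEw hl (N := maxn m.+1 N)) => [|n]; last first.
  by rewrite geq_max => /andP[_ /xN].
have lt : (m < maxn m.+1 N)%N by rewrite leq_max leqnn.
rewrite (bigD1 (Ordinal lt)) //= big1 => [|i im]; last first.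
  by apply: dinj_homog; rewrite eq_sym.
by rewrite addr0; exact: dinj_comp.
Qed.

End Generation.

(** * A bracket is determined by its values on A *)

Section Uniqueness.
Variables (k : fieldType) (A : algType k) (S : strandAlg A).
Local Notation OA := (OA A).
Local Notation embedO := (@embedO k A S).

Lemma lactO1 n (x : OA) : homog x n -> lactO (1%g : 'S_n) x = x.
Proof.
move=> xn; apply: (@embedO_inj k A S n) => //; first exact: homog_lactO.
rewrite (embedO_lactO S _ xn).
apply: (relabel_homog_id S xn) => // i lt_i.
by rewrite -[i in LHS]/(val (Ordinal lt_i)) perm_natE perm1.
Qed.

Lemma ractO1 n (x : OA) : homog x n -> ractO x (1%g : 'S_n) = x.
Proof.
move=> xn; apply: (@embedO_inj k A S n) => //; first exact: homog_ractO.
rewrite (embedO_ractO S _ xn) invg1.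
apply: (relabel_homog_id S xn) => // i lt_i.
by rewrite -[i in LHS]/(val (Ordinal lt_i)) perm_natE perm1.
Qed.

Section Twisted.
Variable B : OA -> OA -> OA.
Hypothesis BP : twisted_biderivation B.

(** The Leibniz rule for 1 = 1 * 1 gives {1, y} = {1, y} + {1, y}: the block permutation only moves
    an empty block past y and acts trivially. *)
Lemma tb_one n (y : OA) : homog y n -> B (oone A) y = 0.
Proof.
move=> yn; have h1 := homog_one A; have Bh := tb_homog BP h1 yn.
apply: (@embedO_inj k A S n); [exact: Bh | exact: homog0 |].
have one2 : omul (oone A) (oone A) = oone A.
  apply: (@embedO_inj k A S 0) => //; first exact: (homog_omul S h1 h1).
  by rewrite (embedO_omul S h1 h1) embedO_one mul1r /shift rmorph1.
have Bs : homog (omul (B (oone A) y) (oone A))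
    (\sum_(i < 3) tnth [tuple 0%N; n; 0%N] i).
  by rewrite bperm3_size; exact: (homog_omul S Bh h1).
have shift1 j : shift j 1 = 1 by exact: rmorph1.
have := congr1 embedO (tb_leibnizl BP h1 h1 yn); rewrite one2.
rewrite (linear_D _ _ (embedO_linear S)) (embedO_AdO S _ Bs).
rewrite (embedO_omul S Bh h1) (embedO_omul S h1 Bh) !embedO_one shift1 mulr1 mul1r.
rewrite [shift 0 _]relabel_id (relabel_homog_id S (n := n)) //; first last.
- move=> i lt_i; have := bperm3_2 0 0 p23 lt_i; rewrite add0n => ->.
  by rewrite !perm3E.
- move=> i lt_i; have := bperm3_2 0 0 p23 lt_i; rewrite add0n => ->.
  by rewrite !perm3E.
rewrite (linear_0 (embedO_linear S)); move: (embedO _) => e /(congr1 (fun z => z - e)).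
by rewrite subrr addrK.
Qed.

Lemma pcross1 n m : pcross (1%g : 'S_n) (1%g : 'S_m) = 1%g.
Proof.
apply/permP => i; rewrite perm1 -[i]splitK; case: (fintype.split i) => j /=.
  by rewrite pcross_lshift perm1.
by rewrite pcross_rshift perm1.
Qed.

Lemma tb_ractl n m (x y : OA) (u : 'S_n) : homog x n -> homog y m ->
  B (ractO x u) y = ractO (B x y) (pcross u (1%g : 'S_m)).
Proof.
move=> xn ym; have Bh := tb_homog BP xn ym.
have := tb_bimod BP 1%g u 1%g 1%g xn ym.
by rewrite (lactO1 xn) (lactO1 ym) (ractO1 ym) pcross1 (lactO1 Bh).
Qed.

Lemma tb_ractr n m (x y : OA) (u : 'S_m) : homog x n -> homog y m ->
  B x (ractO y u) = ractO (B x y) (pcross (1%g : 'S_n) u).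
Proof.
move=> xn ym; have Bh := tb_homog BP xn ym.
have := tb_bimod BP 1%g 1%g 1%g u xn ym.
by rewrite (lactO1 xn) (lactO1 ym) (ractO1 xn) pcross1 (lactO1 Bh).
Qed.

End Twisted.

Section Pair.
Variables B C : OA -> OA -> OA.
Hypotheses (BP : twisted_biderivation B) (CP : twisted_biderivation C).

Lemma tb_agreel m y : homog y m -> (forall a, B (oiota a) y = C (oiota a) y) ->
  forall n x, homog x n -> B x y = C x y.
Proof.
move=> ym Ei; have [Bl _] := tb_bilinear BP; have [Cl _] := tb_bilinear CP.
apply: (OA_gen S (P := fun _ x => B x y = C x y)) => //.
- by move=> n; rewrite (linear_0 (Bl y)) (linear_0 (Cl y)).
- by move=> n c x z xn zn Ex Ez; rewrite (Bl y) (Cl y) Ex Ez.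
- by rewrite (tb_one BP ym) (tb_one CP ym).
- move=> n p x z xn zn Ex Ez.
  by rewrite (tb_leibnizl BP xn zn ym) (tb_leibnizl CP xn zn ym) Ex Ez.
- move=> n x xn Ex.
  by rewrite (tb_pi BP (ltn0Sn n) xn ym) (tb_pi CP (ltn0Sn n) xn ym) Ex.
- move=> n x u xn Ex.
  by rewrite (tb_ractl BP u xn ym) (tb_ractl CP u xn ym) Ex.
Qed.

Lemma tb_agreeC n m x y : homog x n -> homog y m -> B x y = C x y -> B y x = C y x.
Proof. by move=> xn ym E; rewrite (tb_skew BP xn ym) (tb_skew CP xn ym) E. Qed.

(** Generation is used in the first argument twice: to free one argument from A, then, after an
    exchange by skew-symmetry, to free the other one. *)
Lemma tb_uniq : (forall a b, B (oiota a) (oiota b) = C (oiota a) (oiota b)) -> B = C.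
Proof.
move=> Ei; have Eh n m x y : homog x n -> homog y m -> B x y = C x y.
  move=> xn ym; apply: (tb_agreel ym _ xn) => a.
  have ha := homog_iota a; apply: (tb_agreeC ym ha).
  by apply: (tb_agreel ha _ ym) => b; exact: Ei.
have [Bl Br] := tb_bilinear BP; have [Cl Cr] := tb_bilinear CP.
apply: funext => x; apply: funext => y.
rewrite -[x]dlift_dinj -[y]dlift_dinj.
rewrite (dlift_bigsum _ _ (Bl _)) (dlift_bigsum _ _ (Cl _)).
apply: eq_bigr => n _.
rewrite (dlift_bigsum _ _ (Br _)) (dlift_bigsum _ _ (Cr _)).
apply: eq_bigr => m _; apply: Eh; exact: dinj_homog.
Qed.

End Pair.
End Uniqueness.

Lemma s12_neq1 : (s12 == 1%g) = false.
Proof. by apply/negbTE/eqP => /permP/(_ ord0); rewrite tpermL perm1. Qed.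

Lemma ord2_ind (P : 'I_2 -> Prop) : P ord0 -> P ord_max -> forall i, P i.
Proof.
move=> P0 P1 [[|[|i]] lt] //; [have <- : ord0 = Ordinal lt by exact: val_inj|
  have <- : ord_max = Ordinal lt by exact: val_inj]; by [].
Qed.

Lemma perm2_neq1 (u : 'S_2) : u != 1%g -> u = s12.
Proof.
have two (i j : 'I_2) : i != j -> j = s12 i.
  elim/ord2_ind: i; elim/ord2_ind: j; by rewrite ?eqxx ?tpermL ?tpermR.
move=> u1; have [i ui] : exists i, i != u i.
  by apply/existsP; apply: contraNT u1 => /existsPn H; apply/eqP/permP => i;
    rewrite perm1; have /negPn/eqP := H i.
apply/permP => j; have [->|ji] := eqVneq j i; first exact: two.
have uj : u j != u i by rewrite (inj_eq perm_inj).
rewrite (two (u i) (u j)) 1?eq_sym //; congr (s12 _).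
by rewrite (two i j) 1?eq_sym //; exact: two.
Qed.

Lemma perm_nat_s12_0 : perm_nat s12 0 = 1%N.
Proof. by rewrite (perm_natE s12 ord0) tpermL. Qed.

Lemma perm_nat_s12_1 : perm_nat s12 1 = 0%N.
Proof. by rewrite (perm_natE s12 ord_max) tpermR. Qed.

Lemma rlshapeE phi psi i j : rlshape phi psi (lab i j) = lab (phi i) (psi j).
Proof. by []. Qed.

Section Contractions.
Variables (k : fieldType) (A : algType k) (S : strandAlg A).
Local Notation st := (strand S).
Local Notation eval2 := (@eval2 k A S).
Local Notation eval_swap := (@eval_swap k A S).
Let idl : linear (@id A). Proof. by []. Qed.

Let contract_mul (W : lmodType k) (F : W -> S) y : linear F ->
  linear (fun w => contract 0 (F w * y)).
Proof.
by move=> Fl c u v; rewrite Fl mulrDl -scalerAl (@contract_linear k A S).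
Qed.

Let avoid f x i j : gen_by (avoids 0) (iota_SA S f * st (lab i.+1 j.+1) x).
Proof.
by apply: gen_byM; [exact: gen_by_iota | exact: gen_by_strand].
Qed.

(** This and the next three contractions are the four terms of {a, b c}. The label 2 belongs to a,
    moved to the end by skew-symmetry so that pi joins b and c at the label 0. *)
Lemma contract_eval2_r c w :
  contract 0 (eval2 (lab 2 2) (lab 0 1) w * st (lab 1 0) c) =
  eval2 (lab 2 2) (lab 1 1) (map2 id (fun y => y * c) w).
Proof.
have ml := mulA_linearl c.
move: w; apply: tens2_ext => [||x y f].
- exact: contract_mul (eval2_linear S _ _).
- by move=> d u v; rewrite (map2_linear idl ml) eval2_linear.
rewrite (map2E _ _ _ idl ml) !eval2E.
have AC (p q r s : S) : p * q * r * s = q * s * (r * p) by ring.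
by rewrite AC (contract_avoid _ (avoid _ _ _ _)) contract_pair //; ring.
Qed.

Lemma contract_eval_swap_r c w :
  contract 0 (eval_swap (lab 2 2) (lab 0 1) w * st (lab 1 0) c) =
  eval_swap (lab 2 2) (lab 1 1) (map2 id (fun y => y * c) w).
Proof.
have ml := mulA_linearl c.
move: w; apply: tens2_ext => [||x y f].
- exact: contract_mul (eval_swap_linear S _ _).
- by move=> d u v; rewrite (map2_linear idl ml) eval_swap_linear.
rewrite (map2E _ _ _ idl ml) !eval_swapE /swap /=.
have AC (p q r s : S) : p * q * r * s = q * s * (r * p) by ring.
by rewrite AC (contract_avoid _ (avoid _ _ _ _)) contract_pair //; ring.
Qed.

Lemma contract_eval2_l b w :
  contract 0 (eval2 (lab 2 2) (lab 1 0) w * st (lab 0 1) b) =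
  eval2 (lab 2 2) (lab 1 1) (map2 id (fun y => b * y) w).
Proof.
have ml := mulA_linearr b.
move: w; apply: tens2_ext => [||x y f].
- exact: contract_mul (eval2_linear S _ _).
- by move=> d u v; rewrite (map2_linear idl ml) eval2_linear.
rewrite (map2E _ _ _ idl ml) !eval2E.
have AC (p q r s : S) : p * q * r * s = s * q * (r * p) by ring.
by rewrite AC (contract_avoid _ (avoid _ _ _ _)) contract_pair //; ring.
Qed.

Lemma contract_eval_swap_l b w :
  contract 0 (eval_swap (lab 2 2) (lab 1 0) w * st (lab 0 1) b) =
  eval_swap (lab 2 2) (lab 1 1) (map2 (fun x => b * x) id w).
Proof.
have ml := mulA_linearr b.
move: w; apply: tens2_ext => [||x y f].
- exact: contract_mul (eval_swap_linear S _ _).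
- by move=> d u v; rewrite (map2_linear ml idl) eval_swap_linear.
rewrite (map2E _ _ _ ml idl) !eval_swapE /swap /=.
have AC (p q r s : S) : p * q * r * s = s * p * (r * q) by ring.
by rewrite AC (contract_avoid _ (avoid _ _ _ _)) contract_pair //; ring.
Qed.

Lemma eval_pair_inj (w v w' v' : TA A 2) :
  eval2 (lab 0 0) (lab 1 1) w + eval_swap (lab 0 0) (lab 1 1) v =
  eval2 (lab 0 0) (lab 1 1) w' + eval_swap (lab 0 0) (lab 1 1) v' ->
  w = w' /\ v = v'.
Proof.
have E t u : embed S (gtens t 1%g + gtens u s12) =
    eval2 (lab 0 0) (lab 1 1) t + eval_swap (lab 0 0) (lab 1 1) u.
  apply: etrans (linear_D _ _ (@embed_linear k A S 2)) _.
  by apply: congr2; [exact: embed_gtens_id | exact: embed_gtens_s12].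
rewrite -!E => /embed_inj/ffunP H.
have s1 := s12_neq1.
have g1 t u : (gtens t 1%g + gtens u s12 : OAn A 2) 1%g = t.
  by rewrite !ffunE eqxx eq_sym s1 addr0.
have g2 t u : (gtens t 1%g + gtens u s12 : OAn A 2) s12 = u.
  by rewrite !ffunE eqxx s1 add0r.
split; first exact: etrans (esym (g1 _ _)) (etrans (H 1%g) (g1 _ _)).
exact: etrans (esym (g2 _ _)) (etrans (H s12) (g2 _ _)).
Qed.

End Contractions.

Section Restriction.
Variables (k : fieldType) (A : algType k) (S : strandAlg A).
Local Notation OA := (OA A).
Local Notation OAn := (OAn A).
Local Notation st := (strand S).
Local Notation embedO := (@embedO k A S).
Variable B : OA -> OA -> OA.
Hypothesis BP : twisted_biderivation B.

Lemma tb_restriction a b : B (oiota a) (oiota b) =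
  dinj (V := OAn) (gtens ((restriction B).1 a b) 1%g +
                   gtens ((restriction B).2 a b) s12).
Proof.
have Bh := tb_homog BP (homog_iota a) (homog_iota b).
rewrite {1}(homogE Bh) /restriction /=; congr dinj.
move: (dcomp _ 2) => x; apply/ffunP => u; rewrite !ffunE.
have [->|u1] := eqVneq u 1%g; first by rewrite eq_sym s12_neq1 addr0.
suff -> : u = s12 by rewrite eqxx add0r.
exact: perm2_neq1.
Qed.

Variables De Ds : bracket A.
Hypothesis BE : forall a b, B (oiota a) (oiota b) =
  dinj (V := OAn) (gtens (De a b) 1%g + gtens (Ds a b) s12).
Local Notation gen := (gen_bracket S De Ds).

Lemma embedO_tb_iota a b :
  embedO (B (oiota a) (oiota b)) = gen (lab 0 0) a (lab 1 1) b.
Proof.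
rewrite BE; apply: etrans (embedO_dinj _ _) _.
apply: etrans (linear_D _ _ (@embed_linear k A S 2)) _.
by apply: congr2; [exact: embed_gtens_id | exact: embed_gtens_s12].
Qed.

Let gen_inj a b w v : gen (lab 0 0) a (lab 1 1) b =
  eval2 S (lab 0 0) (lab 1 1) w + eval_swap S (lab 0 0) (lab 1 1) v ->
  De a b = w /\ Ds a b = v.
Proof. exact: eval_pair_inj. Qed.

Lemma restriction_linear : bilinear_for *:%R *:%R De /\ bilinear_for *:%R *:%R Ds.
Proof.
have il c (a b : A) : oiota (c *: a + b) = c *: oiota a + oiota b.
  have h x := homog_iota (x : A).
  apply: (@embedO_inj k A S 1 (oiota (c *: a + b)) (c *: oiota a + oiota b)).
  - exact: h.
  - apply: homogD; [apply: homogZ|]; exact: h.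
  apply: etrans (embedO_iota S _) _; apply: etrans (st_linear S _ _ _ _) _.
  apply: esym; apply: etrans (embedO_linear S c _ _) _.
  by apply: (congr2 (fun u v => c *: u + v)); exact: embedO_iota.
have [Bl Br] := tb_bilinear BP.
have l2 := eval2_linear S (lab 0 0) (lab 1 1).
have ls := eval_swap_linear S (lab 0 0) (lab 1 1).
have El c a a' b : De (c *: a + a') b = c *: De a b + De a' b /\
    Ds (c *: a + a') b = c *: Ds a b + Ds a' b.
  apply: gen_inj; apply: etrans (esym (embedO_tb_iota _ _)) _.
  rewrite il (Bl (oiota b)); apply: etrans (embedO_linear S c _ _) _.
  apply: etrans (congr2 (fun u v => c *: u + v) (embedO_tb_iota a b)
    (embedO_tb_iota a' b)) _; rewrite (l2 c) (ls c) /gen_bracket.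
  by rewrite scalerDr addrACA.
have Er a c b b' : De a (c *: b + b') = c *: De a b + De a b' /\
    Ds a (c *: b + b') = c *: Ds a b + Ds a b'.
  apply: gen_inj; apply: etrans (esym (embedO_tb_iota _ _)) _.
  rewrite il (Br (oiota a)); apply: etrans (embedO_linear S c _ _) _.
  apply: etrans (congr2 (fun u v => c *: u + v) (embedO_tb_iota a b)
    (embedO_tb_iota a b')) _; rewrite (l2 c) (ls c) /gen_bracket.
  by rewrite scalerDr addrACA.
split; split=> [b c a a'|a c b b'].
- exact: (El _ _ _ _).1.
- exact: (Er _ _ _ _).1.
- exact: (El _ _ _ _).2.
exact: (Er _ _ _ _).2.
Qed.

Lemma restriction_skew : Defs.skew De /\ Defs.skew Ds.
Proof.
have E a b : De a b = - tact s12 (De b a) /\ Ds a b = - tact s12 (Ds b a).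
  have h x := homog_iota (x : A).
  apply: gen_inj; rewrite -embedO_tb_iota (tb_skew BP (h b) (h a)).
  have Bh := tb_homog BP (h b) (h a).
  have Bs : homog (B (oiota b) (oiota a)) (\sum_(i < 2) tnth [tuple 1%N; 1%N] i).
    by rewrite bperm2_size.
  rewrite (linear_N _ (embedO_linear S)) (embedO_AdO S _ Bs) embedO_tb_iota.
  rewrite relabel_gen_bracket !rlshapeE.
  rewrite (@bperm2_1 1 1 0 isT : perm_nat _ 0 = 1%N).
  rewrite (@bperm2_2 1 1 0 isT : perm_nat _ 1 = 0%N).
  rewrite (linear_N _ (eval2_linear S _ _)) (linear_N _ (eval_swap_linear S _ _)).
  by rewrite eval2_tact eval_swap_tact -opprD.
by split=> a b; have [] := E a b.
Qed.

Lemma iota_mul (b c : A) :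
  oiota (b * c) = opi (ractO (omul (oiota b) (oiota c)) s12).
Proof.
have h x := homog_iota (x : A); have hw := homog_omul S (h b) (h c).
have hz : homog (ractO (omul (oiota b) (oiota c)) s12) 2 by exact: homog_ractO.
apply: (@embedO_inj k A S 1); [exact: h | exact: (homog_opi S hz) |].
apply: etrans (embedO_iota S _) _; apply: esym; apply: etrans (embedO_opi S hz) _.
have -> : embedO (ractO (omul (oiota b) (oiota c)) s12) =
    st (lab 0 1) b * st (lab 1 0) c.
  apply: etrans (embedO_ractO S _ hw) _.
  apply: etrans (congr1 _ (embedO_omul S (h b) (h c))) _.
  apply: etrans (congr1 _ (congr2 (fun u v => u * shift 1 v) (embedO_iota S b)
    (embedO_iota S c))) _.
  rewrite (shift_st S 1 _ c) rmorphM /= !relabel_st tpermV !rlshapeE.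
  by rewrite perm_nat_s12_0 perm_nat_s12_1.
by rewrite /ptrace contract_pair // /unshift relabel_st.
Qed.

(** {a, b c} is computed as {a, pi(z)} for z = (b (x) c) . (12), from the Leibniz rule in O(A) for
    {a, b (x) c}. Contracting an uncrossed strand of the bracket multiplies y by b on the left,
    while contracting a crossed one multiplies x: this is the difference between a right double
    bracket and a double bracket. *)
Lemma restriction_leibniz a b c :
  De a (b * c) = map2 id (fun y => y * c) (De a b)
    + map2 id (fun y => b * y) (De a c) /\
  Ds a (b * c) = map2 id (fun y => y * c) (Ds a b)
    + map2 (fun x => b * x) id (Ds a c).
Proof.
have relD phi psi (u v : S) : relabel phi psi (u + v) =
    relabel phi psi u + relabel phi psi v by exact: rmorphD.
have relN phi psi (u : S) : relabel phi psi (- u) = - relabel phi psi u.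
  exact: rmorphN.
have relM phi psi (u v : S) : relabel phi psi (u * v) =
    relabel phi psi u * relabel phi psi v by exact: rmorphM.
apply: gen_inj; apply: etrans (esym (embedO_tb_iota _ _)) _; rewrite iota_mul.
have ha := homog_iota a; have hb := homog_iota b; have hc := homog_iota c.
have Ebc := tb_leibnizr BP ha hb hc.
have Eab := embedO_tb_iota a b; have Eac := embedO_tb_iota a c.
have Eb := embedO_iota S b; have Ec := embedO_iota S c.
have hab := tb_homog BP ha hb; have hac := tb_homog BP ha hc.
move: (oiota a) (oiota b) (oiota c) ha hb hc Ebc Eab Eac Eb Ec hab hac.
move=> x y z ha hb hc Ebc Eab Eac Eb Ec hab hac.
have hw := homog_omul S hb hc; have hxw := tb_homog BP ha hw.
have EW : embedO (B x (omul y z)) =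
    gen (lab 0 0) a (lab 1 1) b * st (lab 2 2) c
    + gen (lab 0 0) a (lab 2 2) c * st (lab 1 1) b.
  have hs : homog (omul y (B x z)) (\sum_(i < 3) tnth [tuple 1%N; 1%N; 1%N] i).
    by rewrite bperm3_size; exact: (homog_omul S hb hac).
  rewrite Ebc (linear_D _ _ (embedO_linear S)) (embedO_AdO S _ hs).
  rewrite (embedO_omul S hab hc) (embedO_omul S hb hac) Eab Eac Eb Ec.
  rewrite rmorphM /= !shift_st /shift !relabel_gen_bracket relabel_st !rlshapeE.
  rewrite (@bperm3_1 1 1 1 p12 0 isT : perm_nat _ 0 = _).
  rewrite (@bperm3_2 1 1 1 p12 0 isT : perm_nat _ 1 = _).
  rewrite (@bperm3_3 1 1 1 p12 0 isT : perm_nat _ 2 = _) !perm3E /=.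
  by rewrite [X in _ + X]mulrC.
move: (omul y z) hw hxw EW => w hw hxw EW {Ebc Eab Eac Eb Ec hab hac y z hb hc}.
have hz := homog_ractO (A := A) s12 w.
have EZ : embedO (B x (ractO w s12)) =
    gen (lab 0 0) a (lab 1 2) b * st (lab 2 1) c
    + gen (lab 0 0) a (lab 2 1) c * st (lab 1 2) b.
  rewrite (tb_ractr S BP s12 ha hw) (embedO_ractO S _ hxw) EW.
  have p0 : perm_nat (pcross (1%g : 'S_1) s12)^-1 0 = 0%N.
    rewrite pcrossV (perm_nat_cross_l _ _ (isT : 0 < 1)%N) invg1.
    by rewrite (perm_natE 1%g (ord0 : 'I_1)) perm1.
  have p1 : perm_nat (pcross (1%g : 'S_1) s12)^-1 1 = 2%N.
    by rewrite pcrossV (@perm_nat_cross_r 1 2 _ _ 0 isT) tpermV perm_nat_s12_0.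
  have p2 : perm_nat (pcross (1%g : 'S_1) s12)^-1 2 = 1%N.
    by rewrite pcrossV (@perm_nat_cross_r 1 2 _ _ 1 isT) tpermV perm_nat_s12_1.
  by rewrite relD !relM !relabel_gen_bracket !relabel_st !rlshapeE p0 p1 p2.
move: (ractO w s12) hz EZ => z hz EZ {EW hw hxw w}.
have hxz := tb_homog BP ha hz; have hzx := tb_homog BP hz ha.
have hp := homog_opi S hz; have hpx := tb_homog BP hp ha.
(* Axiom (ii) concerns the first argument, so skew-symmetry is used before and after it; the two
   signs cancel. *)
rewrite (tb_skew BP hp ha) (linear_N _ (embedO_linear S)).
have hs1 : homog (B (opi z) x) (\sum_(i < 2) tnth [tuple 1%N; 1%N] i).
  by rewrite bperm2_size.
have hs2 : homog (B x z) (\sum_(i < 2) tnth [tuple 1%N; 2%N] i).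
  by rewrite bperm2_size.
rewrite (embedO_AdO S _ hs1) (tb_pi BP (isT : 0 < 2)%N hz ha) (embedO_opi S hzx).
rewrite (tb_skew BP ha hz) (linear_N _ (embedO_linear S)) (embedO_AdO S _ hs2) EZ.
rewrite (linear_N _ (@ptrace_linear k A S)) relN opprK.
rewrite relD !relM !relabel_gen_bracket !relabel_st !rlshapeE.
rewrite (@bperm2_1 1 2 0 isT : perm_nat _ 0 = 2%N).
rewrite (@bperm2_2 1 2 0 isT : perm_nat _ 1 = 0%N).
rewrite (@bperm2_2 1 2 1 isT : perm_nat _ 2 = 1%N).
rewrite /ptrace (linear_D _ _ (@contract_linear k A S 0)) /gen_bracket !mulrDl.
rewrite !(linear_D _ _ (@contract_linear k A S 0)).
rewrite contract_eval2_r contract_eval_swap_r contract_eval2_l contract_eval_swap_l.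
rewrite /unshift !relD !relabel_eval2 !relabel_eval_swap !rlshapeE.
rewrite (@bperm2_1 1 1 0 isT : perm_nat _ 0 = 1%N).
rewrite (@bperm2_2 1 1 0 isT : perm_nat _ 1 = 0%N).
rewrite (linear_D _ _ (eval2_linear S _ _)) (linear_D _ _ (eval_swap_linear S _ _)).
exact: addrACA.
Qed.

Lemma restriction_double : right_double_bracket De /\ double_bracket Ds.
Proof.
have [De_lin Ds_lin] := restriction_linear; have [De_skew Ds_skew] := restriction_skew.
split; split=> // a b c.
  by have [-> _] := restriction_leibniz a b c; rewrite !map2.unlock.
by have [_ ->] := restriction_leibniz a b c; rewrite !map2.unlock.
Qed.

End Restriction.

(** * The bijection between brackets and coupled pairs *)

Section Correspondence.
Variables (k : fieldType) (A : algType k) (S : strandAlg A).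
Local Notation OA := (OA A).

Lemma tb_restriction_double (B : OA -> OA -> OA) : twisted_biderivation B ->
  right_double_bracket (restriction B).1 /\ double_bracket (restriction B).2.
Proof. by move=> BP; apply: (restriction_double S BP) => a b; exact: tb_restriction. Qed.

Lemma tb_restriction_inj (B C : OA -> OA -> OA) :
  twisted_biderivation B -> twisted_biderivation C ->
  restriction B = restriction C -> B = C.
Proof.
move=> BP CP E; apply: (tb_uniq S BP CP) => a b.
by rewrite (tb_restriction BP) (tb_restriction CP) E.
Qed.

Lemma bracketO_restriction (B : OA -> OA -> OA) (BP : twisted_biderivation B)
    (DeP : right_double_bracket (restriction B).1)
    (DsP : double_bracket (restriction B).2) : bracketO S DeP DsP = B.
Proof.
apply: tb_restriction_inj => //; first exact: bracketO_twisted.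
by rewrite restriction_bracketO -surjective_pairing.
Qed.

(** By uniqueness B is the bracket built on S from its own restriction, so its Jacobi identity
    translates into the coupling conditions. *)
Lemma restriction_coupled (B : OA -> OA -> OA) :
  ditwisted B -> coupled_double_poisson (restriction B).
Proof.
move=> BD; have BP := ditwisted_tb BD.
have [DeP DsP] := tb_restriction_double BP.
have [J _] := bracketO_jacobi S DeP DsP.
rewrite (bracketO_restriction BP) in J.
by have [] := J (ditwisted_jacobi BD).
Qed.

Lemma coupled_ditwisted (D : bracket A * bracket A) :
  coupled_double_poisson D -> exists2 B, ditwisted B & restriction B = D.
Proof.
case: D => De Ds [/= DeP DsP c1 c2 c3].
have [_ J] := bracketO_jacobi S DeP DsP.
exists (bracketO S DeP DsP); last exact: restriction_bracketO.
have [] := bracketO_twisted S DeP DsP.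
by split=> //; apply: J.
Qed.

End Correspondence.

Theorem theorem1p1 (k : closedFieldType) (hk : [pchar k] =i pred0)
    (A : algType k) (fgA : finitely_generated A) :
  set_bij (@ditwisted k A) (@coupled_double_poisson k A) (@restriction k A) /\
  (forall B : OA A -> OA A -> OA A, ditwisted B ->
   forall a b : A,
     B (oiota a) (oiota b) =
     dinj (V := @OAn k A) (gtens ((restriction B).1 a b) 1%g +
                          gtens ((restriction B).2 a b) s12)).
Proof.
(* The statement does not mention S: any model of the strand algebra serves. *)
have S := strandAlg_exists A.
split; last by move=> B BD a b; exact: tb_restriction (ditwisted_tb BD) a b.
split.
- by move=> B; exact: restriction_coupled.
- move=> B C /set_mem BD /set_mem CD.
  exact: (tb_restriction_inj S (ditwisted_tb BD) (ditwisted_tb CD)).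
by move=> D /(coupled_ditwisted S) [B BD <-]; exists B.
Qed.
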